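(* Let $(\mathfrak g,g,D)$ be any entry of the list in the context (a nilpotent Lie algebra of dimension $3$ or $4$ with a metric and a derivation), and let $\tilde{\mathfrak g}=\mathfrak g\rtimes_D\mathbb R$ be the Einstein solvmanifold it determines, with metric $\tilde g=g+e^0\otimes e^0$. Then $(\tilde{\mathfrak g},\tilde g)$ is not isometric to any Einstein solvmanifold of pseudo-Iwasawa type obtained by extending a nilsoliton that admits a nice orthonormal basis.
   Context: A metric on a Lie algebra is a nondegenerate symmetric bilinear form of arbitrary signature; a solvmanifold is a (simply connected) solvable Lie group with the left-invariant pseudo-Riemannian metric determined by a metric on its Lie algebra, and ''isometric'' means isometric as pseudo-Riemannian manifolds. It is Einstein if its Ricci operator is a multiple of the identity. Semidirect products. For a derivation $D$ of $\mathfrak g$, $\mathfrak g\rtimes_D\mathbb R=\mathfrak g\rtimes_D\operatorname{Span}\{e_0\}$ has bracket $[e_0,x]=Dx$ for $x\in\mathfrak g$, extending the bracket of $\mathfrak g$. The metric $\tilde g=g+e^0\otimes e^0$ restricts to $g$ on $\mathfrak g$, with $e_0$ orthogonal to $\mathfrak g$ and $\tilde g(e_0,e_0)=1$. Nice basis. A basis $e_1,\dotsc,e_n$ with dual basis $e^1,\dotsc,e^n$ is nice if each $[e_i,e_j]$ is a multiple of a single basis element and each $e_i\lrcorner de^j=de^j(e_i,\cdot)$ is a multiple of a single dual basis element, where $d\alpha(x,y)=-\alpha([x,y])$. Orthonormal means $g(e_i,e_j)=0$ for $i\ne j$ and $g(e_i,e_i)=\pm1$. Nilsolitons and pseudo-Iwasawa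 type. A nilsoliton is a nilpotent Lie algebra with a metric (of any signature) satisfying $\operatorname{Ric}=\lambda\operatorname{Id}+D'$ for some $\lambda\in\mathbb R$ and some derivation $D'$. A standard decomposition of a Lie algebra with a metric is an orthogonal decomposition $\mathfrak h\rtimes\mathfrak a$, with $\mathfrak h$ a nilpotent ideal and $\mathfrak a$ an abelian subalgebra; it is of pseudo-Iwasawa type if $\operatorname{ad}X$ is symmetric with respect to the metric for all $X\in\mathfrak a$. The Einstein solvmanifolds of pseudo-Iwasawa type obtained by extending a nilsoliton $\mathfrak h$ are those of the form $\mathfrak h\rtimes_{D''}\mathbb R$, with $\mathfrak h$ the nilradical, $\mathbb R$ orthogonal to $\mathfrak h$, the metric on $\mathfrak h$ a nilsoliton metric, and $D''$ a symmetric derivation of $\mathfrak h$. The list. Each line has the form: $\mathfrak g$; $D$; $\mathbf S$. The Lie algebra is given by the $n$-tuple $(de^1,\dotsc,de^n)$, with $e^{ij}=e^i\wedge e^j$. The derivation is written $v+\sum a_{ji}e^i\otimes e_j$, where the vector $v$ stands for the diagonal endomorphism with diagonal $v$ and $e^i\otimes e_j$ maps $e_i$ to $e_j$ and the other basis elements to zero. Each element of $\mathbf S$ is a string of indices specifying the metric $g=\sum\epsilon_ie^i\otimes e^i$ with $\epsilon_i=-1$ if $i$ is in the string and $\epsilon_i=1$ otherwise. An entry is a line with a choice of one element of its $\mathbf S$. - $(0,0,\frac47e^{12})$; $(\frac67,-\frac27,\frac47)+\frac87e^1\otimes e_2$; $\{13,23\}$ - $(0,0,0)$; $(1,-\frac15,\frac25)+\frac65e^1\otimes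 e_2$; $\{1,13,2,23\}$ - $(0,0,\frac{14}{51}\sqrt3e^{12},\frac7{51}\sqrt{34}e^{13})$; $(\frac{28}{51},-\frac7{17},\frac7{51},\frac{35}{51})+\frac7{51}\sqrt{66}e^1\otimes e_2$; $\{13,234\}$ - $(0,0,0,\frac2{17}\sqrt{22}e^{12})$; $(\frac{15}{17},-\frac7{17},\frac6{17},\frac8{17})+\frac{22}{17}e^1\otimes e_2$; $\{134,14,234,24\}$ - $(0,0,0,\frac13\sqrt6e^{12})$; $(0,0,1,0)+\frac23\sqrt3e^3\otimes e_4$; $\{123,14,3\}$ - $(0,0,0,\frac13\sqrt6e^{12})$; $(\frac23,0,-\frac13,\frac23)+\frac23\sqrt3e^1\otimes e_3$; $\{12,14,234,3\}$ - $(0,0,0,\frac29\sqrt6e^{12})$; $(\frac13,-\frac13,\frac23,0)+\frac23e^1\otimes e_2+\frac49\sqrt3e^3\otimes e_4$; $\{14,24\}$ - $(0,0,0,0)$; $(1,-\frac13,\frac13,\frac13)+\frac43e^1\otimes e_2$; $\{1,13,134,2,23,234\}$ - $(0,0,0,0)$; $(\frac35,\frac35,-\frac15,-\frac15)+\frac45e^1\otimes e_3+\frac45e^2\otimes e_4$; $\{12,14,34\}$ *)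

(* Defs.v *)
From HB Require Import structures.
From mathcomp Require Import all_boot all_order all_algebra.
From mathcomp Require Import all_classical all_reals all_analysis.

Set Implicit Arguments.
Unset Strict Implicit.
Unset Printing Implicit Defensive.

Import Order.TTheory GRing.Theory Num.Theory.
Import numFieldNormedType.Exports.

Local Open Scope ring_scope.

(* Lie algebras are given in coordinates: the underlying vector space is
   'rV[R]_n.  Endomorphisms are matrices acting on the right of row vectors
   (x is sent to x *m D), and a bilinear form is given by its Gram matrix. *)

Definition bform (R : realType) (n : nat) (G : 'M[R]_n) (x y : 'rV[R]_n) : R :=
  (x *m G *m y^T) 0 0.

Record metric_algebra (R : realType) (n : nat) := MetricAlgebra {
  br : 'rV[R]_n -> 'rV[R]_n -> 'rV[R]_n;
  gram : 'M[R]_n }.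

Definition lie_bracket_axioms (R : realType) (n : nat)
    (b : 'rV[R]_n -> 'rV[R]_n -> 'rV[R]_n) : Prop :=
  [/\ forall a x y z, b (a *: x + y) z = a *: b x z + b y z,
      forall a x y z, b z (a *: x + y) = a *: b z x + b z y,
      forall x, b x x = 0
    & forall x y z, b x (b y z) + b y (b z x) + b z (b x y) = 0].

(* Nondegenerate and symmetric; the signature is arbitrary. *)
Definition is_metric (R : realType) (n : nat) (G : 'M[R]_n) : Prop :=
  G \in unitmx /\ G^T = G.

Definition is_metric_lie_algebra (R : realType) (n : nat)
    (A : metric_algebra R n) : Prop :=
  lie_bracket_axioms (br A) /\ is_metric (gram A).

Section LieAlgebra.
Variables (R : realType) (n : nat) (A : metric_algebra R n).
Implicit Types (x y z : 'rV[R]_n) (U V I N : {vspace 'rV[R]_n}) (D : 'M[R]_n).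

Definition derivation D : Prop :=
  forall x y, br A x y *m D = br A (x *m D) y + br A x (y *m D).

Definition symmetric_endo D : Prop :=
  forall x y, bform (gram A) (x *m D) y = bform (gram A) x (y *m D).

Definition bracket_space U V : {vspace 'rV[R]_n} :=
  <<[seq br A u v | u <- vbasis U, v <- vbasis V]>>%VS.

Definition lower_central U (k : nat) : {vspace 'rV[R]_n} :=
  iter k (bracket_space U) U.

Definition nilpotent_alg U : Prop := exists k, lower_central U k = 0%VS.

Definition ideal_of I : Prop := forall x y, y \in I -> br A x y \in I.

Definition is_nilradical N : Prop :=
  [/\ ideal_of N, nilpotent_alg N
    & forall I, ideal_of I -> nilpotent_alg I -> (I <= N)%VS].

(* Koszul formula for left-invariant fields:
   2<nabla_x y, z> = <[x,y],z> - <[y,z],x> + <[z,x],y>. *)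
Definition koszul x y z : R :=
  2^-1 * (bform (gram A) (br A x y) z - bform (gram A) (br A y z) x
          + bform (gram A) (br A z x) y).

Definition nabla x y : 'rV[R]_n :=
  (\row_k koszul x y (delta_mx 0 k)) *m invmx (gram A).

Definition curvature x y z : 'rV[R]_n :=
  nabla x (nabla y z) - nabla y (nabla x z) - nabla (br A x y) z.

Definition ricci y z : R := \tr (lin1_mx (fun x => curvature x y z)).

(* bform (y *m ricci_op) z = ricci y z *)
Definition ricci_op : 'M[R]_n :=
  (\matrix_(i, j) ricci (delta_mx 0 i) (delta_mx 0 j)) *m invmx (gram A).

Definition einstein : Prop := exists lambda : R, ricci_op = lambda%:M.

Definition nilsoliton : Prop :=
  [/\ is_metric_lie_algebra A,
      nilpotent_alg fullv
    & exists (lambda : R) (D : 'M[R]_n),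
        derivation D /\ ricci_op = lambda%:M + D].

(* The rows of B are the basis vectors; dual_coord B j is the j-th element of
   the dual basis. *)
Definition dual_coord (B : 'M[R]_n) (j : 'I_n) x : R := (x *m invmx B) 0 j.

(* (d alpha)(x, y) = - alpha([x, y]) *)
Definition ce_diff (alpha : 'rV[R]_n -> R) x y : R := - alpha (br A x y).

Definition nice_basis (B : 'M[R]_n) : Prop :=
  [/\ B \in unitmx,
      forall i j, exists k c, br A (row i B) (row j B) = c *: row k B
    & forall i j, exists k c, forall x,
        ce_diff (dual_coord B j) (row i B) x = c * dual_coord B k x].

Definition orthonormal_basis (B : 'M[R]_n) : Prop :=
  [/\ B \in unitmx,
      forall i j, i != j -> bform (gram A) (row i B) (row j B) = 0
    & forall i, bform (gram A) (row i B) (row i B) = 1 \/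
                bform (gram A) (row i B) (row i B) = -1].

Definition has_nice_orthonormal_basis : Prop :=
  exists B : 'M[R]_n, nice_basis B /\ orthonormal_basis B.

(* The semidirect product by Span{e_0}, with metric g + c e^0 (x) e^0; the
   coordinate along e_0 comes first. *)
Definition semidirect (D : 'M[R]_n) (c : R) : metric_algebra R (1 + n) :=
  MetricAlgebra
    (fun u v : 'rV[R]_(1 + n) =>
       row_mx (0 : 'rV[R]_1)
         (br A (rsubmx u) (rsubmx v)
          + lsubmx u 0 0 *: (rsubmx v *m D)
          - lsubmx v 0 0 *: (rsubmx u *m D)))
    (block_mx (c%:M : 'M[R]_1) 0 0 (gram A)).

End LieAlgebra.

(* The image of 'rV_n in the semidirect product: zero e_0-coordinate. *)
Definition base_ideal (R : realType) (n : nat) : {vspace 'rV[R]_(1 + n)} :=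
  lker (linfun (@lsubmx R 1 1 n)).

(* The metric on the line orthogonal to the nilradical is c e^0 (x) e^0 with
   c any nonzero real, so that both signs are allowed. *)
Definition pseudo_iwasawa_einstein_extension (R : realType) (n : nat)
    (h : metric_algebra R n) (D : 'M[R]_n) (c : R) : Prop :=
  [/\ nilsoliton h, derivation h D /\ symmetric_endo h D, c != 0,
      is_nilradical (semidirect h D c) (base_ideal R n)
    & einstein (semidirect h D c)].

(* A simply connected solvable Lie group is diffeomorphic to a Euclidean
    space, so Lie groups are given here as smooth group laws on 'rV[R]_n; every
    tangent space is then identified with 'rV[R]_n. *)

(* All iterated directional derivatives exist and are Frechet differentiable,
   i.e. f is of class C^infinity. *)
Definition smooth (R : realType) (V W : normedModType R) (f : V -> W) : Prop :=
  forall (vs : seq V) (x : V),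
    differentiable (foldr (fun v (h : V -> W) => 'D_v h) f vs) x.

Record lie_group (R : realType) (n : nat) := LieGroup {
  gmul : 'rV[R]_n -> 'rV[R]_n -> 'rV[R]_n;
  gone : 'rV[R]_n;
  ginv : 'rV[R]_n -> 'rV[R]_n;
  gmulA : forall p q r, gmul p (gmul q r) = gmul (gmul p q) r;
  gmul1 : forall p, gmul gone p = p;
  gmulV : forall p, gmul (ginv p) p = gone;
  gmul_smooth : smooth (fun pq : 'rV[R]_n * 'rV[R]_n => gmul pq.1 pq.2);
  ginv_smooth : smooth ginv }.

Definition left_invariant_field (R : realType) (n : nat) (G : lie_group R n)
    (u p : 'rV[R]_n) : 'rV[R]_n := 'd (gmul G p) (gone G) u.

Definition field_bracket (R : realType) (n : nat)
    (X Y : 'rV[R]_n -> 'rV[R]_n) (p : 'rV[R]_n) : 'rV[R]_n :=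
  'd Y p (X p) - 'd X p (Y p).

Definition group_bracket (R : realType) (n : nat) (G : lie_group R n)
    (u v : 'rV[R]_n) : 'rV[R]_n :=
  field_bracket (left_invariant_field G u) (left_invariant_field G v) (gone G).

(* x |-> x *m P is an isomorphism from the Lie algebra onto the tangent space
   of G at the identity. *)
Definition lie_algebra_iso (R : realType) (n : nat) (A : metric_algebra R n)
    (G : lie_group R n) (P : 'M[R]_n) : Prop :=
  P \in unitmx /\
  forall x y, group_bracket G (x *m P) (y *m P) = br A x y *m P.

Definition left_invariant_metric (R : realType) (n : nat)
    (A : metric_algebra R n) (G : lie_group R n) (P : 'M[R]_n)
    (p u v : 'rV[R]_n) : R :=
  bform (gram A) ('d (gmul G (ginv G p)) p u *m invmx P)
                ('d (gmul G (ginv G p)) p v *m invmx P).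

(* gM and gN are fields of bilinear forms on 'rV_n and 'rV_m. *)
Definition isometric (R : realType) (n m : nat)
    (gM : 'rV[R]_n -> 'rV[R]_n -> 'rV[R]_n -> R)
    (gN : 'rV[R]_m -> 'rV[R]_m -> 'rV[R]_m -> R) : Prop :=
  exists (f : 'rV[R]_n -> 'rV[R]_m) (f' : 'rV[R]_m -> 'rV[R]_n),
    [/\ smooth f, smooth f', cancel f f', cancel f' f
      & forall p u v, gN (f p) ('d f p u) ('d f p v) = gM p u v].

(* The groups are determined up to isomorphism by their Lie algebras, hence
   the existential quantifiers range over isometric choices. *)
Definition isometric_solvmanifolds (R : realType) (n m : nat)
    (A : metric_algebra R n) (B : metric_algebra R m) : Prop :=
  exists (G : lie_group R n) (P : 'M[R]_n)
         (H : lie_group R m) (Q : 'M[R]_m),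
    [/\ lie_algebra_iso A G P, lie_algebra_iso B H Q
      & isometric (left_invariant_metric A G P)
                  (left_invariant_metric B H Q)].

(* Indices start from 1.  As the matrix of a bilinear form ot i j is
   e^i (x) e^j; as the matrix of an endomorphism it is e^i (x) e_j, sending
   e_i to e_j. *)
Definition ot (R : realType) (n i j : nat) : 'M[R]_n :=
  \matrix_(a, b) ((a.+1 == i) && (b.+1 == j))%:R.
Arguments ot {R n} (i j)%_N.

Definition wedge2 (R : realType) (n i j : nat) : 'M[R]_n := ot i j - ot j i.
Arguments wedge2 {R n} (i j)%_N.

Definition diag (R : realType) (n : nat) (v : seq R) : 'M[R]_n :=
  diag_mx (\row_a v`_a).
Arguments diag {R n} v.

(* The a-th coordinate of [x, y] is - de^a(x, y). *)
Definition bracket_of_diff (R : realType) (n : nat) (de : seq 'M[R]_n)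
    (x y : 'rV[R]_n) : 'rV[R]_n := \row_a (- bform de`_a x y).

Definition sign_metric (R : realType) (n : nat) (s : seq nat) : 'M[R]_n :=
  diag_mx (\row_a (if a.+1 \in s then -1 else 1)).

Record table_line (R : realType) := TableLine {
  tdim : nat;
  tdiff : seq 'M[R]_tdim;
  tder : 'M[R]_tdim;
  tsigns : seq (seq nat) }.

Definition entry_algebra (R : realType) (L : table_line R) (s : seq nat) :
    metric_algebra R (tdim L) :=
  MetricAlgebra (bracket_of_diff (tdiff L)) (sign_metric R (tdim L) s).

Definition table (R : realType) : seq (table_line R) :=
  let r (k : nat) : R := Num.sqrt k%:R in
  [:: @TableLine R 3
        [:: 0; 0; (4 / 7) *: wedge2 1 2]
        (diag [:: 6 / 7; - (2 / 7); 4 / 7] + (8 / 7) *: ot 1 2)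
        [:: [:: 1; 3]; [:: 2; 3]]%N;
      @TableLine R 3
        [:: 0; 0; 0]
        (diag [:: 1; - (1 / 5); 2 / 5] + (6 / 5) *: ot 1 2)
        [:: [:: 1]; [:: 1; 3]; [:: 2]; [:: 2; 3]]%N;
      @TableLine R 4
        [:: 0; 0; (14 / 51 * r 3) *: wedge2 1 2; (7 / 51 * r 34) *: wedge2 1 3]
        (diag [:: 28 / 51; - (7 / 17); 7 / 51; 35 / 51]
          + (7 / 51 * r 66) *: ot 1 2)
        [:: [:: 1; 3]; [:: 2; 3; 4]]%N;
      @TableLine R 4
        [:: 0; 0; 0; (2 / 17 * r 22) *: wedge2 1 2]
        (diag [:: 15 / 17; - (7 / 17); 6 / 17; 8 / 17] + (22 / 17) *: ot 1 2)
        [:: [:: 1; 3; 4]; [:: 1; 4]; [:: 2; 3; 4]; [:: 2; 4]]%N;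
      @TableLine R 4
        [:: 0; 0; 0; (1 / 3 * r 6) *: wedge2 1 2]
        (diag [:: 0; 0; 1; 0] + (2 / 3 * r 3) *: ot 3 4)
        [:: [:: 1; 2; 3]; [:: 1; 4]; [:: 3]]%N;
      @TableLine R 4
        [:: 0; 0; 0; (1 / 3 * r 6) *: wedge2 1 2]
        (diag [:: 2 / 3; 0; - (1 / 3); 2 / 3] + (2 / 3 * r 3) *: ot 1 3)
        [:: [:: 1; 2]; [:: 1; 4]; [:: 2; 3; 4]; [:: 3]]%N;
      @TableLine R 4
        [:: 0; 0; 0; (2 / 9 * r 6) *: wedge2 1 2]
        (diag [:: 1 / 3; - (1 / 3); 2 / 3; 0] + (2 / 3) *: ot 1 2
          + (4 / 9 * r 3) *: ot 3 4)
        [:: [:: 1; 4]; [:: 2; 4]]%N;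
      @TableLine R 4
        [:: 0; 0; 0; 0]
        (diag [:: 1; - (1 / 3); 1 / 3; 1 / 3] + (4 / 3) *: ot 1 2)
        [:: [:: 1]; [:: 1; 3]; [:: 1; 3; 4]; [:: 2]; [:: 2; 3];
            [:: 2; 3; 4]]%N;
      @TableLine R 4
        [:: 0; 0; 0; 0]
        (diag [:: 3 / 5; 3 / 5; - (1 / 5); - (1 / 5)]
          + (4 / 5) *: ot 1 3 + (4 / 5) *: ot 2 4)
        [:: [:: 1; 2]; [:: 1; 4]; [:: 3; 4]]%N ].

(* Main.v *)
(** An isometry identifies the tangent spaces at the identity by a linear
    isometry that intertwines the curvature tensors, as one sees by comparing
    left-invariant frames along it. So it suffices to tell the curvature
    tensors of the two metric Lie algebras apart.

    On an Einstein extension of pseudo-Iwasawa type of a nice nilsoliton of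
    dimension at most 4, distinct nonzero brackets [e_i, e_j] = c_ijk e_k have
    orthogonal root vectors e^k - e^i - e^j. The Einstein equation then makes
    the derivation diagonal and gives eps_i eps_j eps_k the sign of
    g(e_0, e_0) for every nonzero bracket. Hence there is an isometric
    involutive automorphism phi, diagonal in this basis, such that g(x, phi x)
    is definite. The curvature operator on bivectors is therefore self-adjoint
    for a positive definite form, and on an invariant subspace its matrix M
    satisfies tr ((M - mu)^2) <= 0 only if M = mu.

    For each entry of the table this fails for mu = (tr M) / k on an explicit
    k-dimensional invariant space of bivectors, which integer arithmetic in a
    rescaled basis decides. *)
Require Import Defs.
From Stdlib Require List.
From HB Require Import structures.
From mathcomp Require Import all_boot all_order all_algebra.
From mathcomp Require Import all_classical all_reals all_analysis.
From mathcomp Require Import ring lra.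

Set Implicit Arguments.
Unset Strict Implicit.
Unset Printing Implicit Defensive.

Import Order.TTheory GRing.Theory Num.Theory.
Import numFieldNormedType.Exports.

Local Open Scope ring_scope.

(** * Differential calculus in normed modules *)

(** Both spaces are Einstein, so their Ricci operators can differ at most by a constant, and
    isometric solvmanifolds may have non-isomorphic Lie algebras; the full curvature tensor is the
    invariant left to compare. In indefinite signature a self-adjoint curvature operator may fail to
    be diagonalizable. The involution [phi] restores diagonalizability on the pseudo-Iwasawa side. A
    non-scalar real matrix with tr ((M - mu)^2) <= 0 for mu = (tr M) / k is not diagonalizable over
    the reals, and this inequality is polynomial in the structure constants.

    The sign rule comes from pairing the diagonal of the Einstein equation with a root. A diagonal
    derivation is additive along brackets, so its terms cancel, and orthogonality of the roots
    leaves eps_i eps_j eps_k c_ijk^2 = - (2/3) lambda. This says nothing when lambda = 0, so a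
    nonzero Ricci curvature is computed on the table entry and carried across the isometry, as is
    the bound on the dimension. In the other direction the pair symmetry of the curvature is carried
    from the extension to the entry. *)

Section SmoothCalculus.
Variable R : realType.
Implicit Types U V W : normedModType R.

Lemma scale_bilinear W : bilinear_for
    (GRing.Scale.Law.clone _ _ *:%R _) (GRing.Scale.Law.clone _ _ *:%R _)
    (@GRing.scale R W).
Proof.
split=> [u'|u] a x y /=; first by rewrite scalerDl scalerA.
by rewrite scalerDr !scalerA mulrC.
Qed.

Lemma is_diff_scale V W (k dk : V -> R) (f df : V -> W) x :
  is_diff x k dk -> is_diff x f df ->
  is_diff x (fun y => k y *: f y) (fun v => k x *: df v + dk v *: f x).
Proof.
move=> hk hf.
pose scM := bilinear_isBilinear.Build R R W W _ _ (@GRing.scale R W)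
  (scale_bilinear W).
pose sc : {bilinear R -> W -> W} := HB.pack (@GRing.scale R W) scM.
have csc : continuous (fun p : R * W => sc p.1 p.2).
  by move=> p; apply: scale_continuous.
have hs : is_diff (k x, f x) (fun p : R * W => p.1 *: p.2)
    (fun q => k x *: q.2 + q.1 *: f x).
  apply: DiffDef; first exact: (@differentiable_bilin _ _ _ _ sc).
  exact: (@diff_bilin _ _ _ _ sc (k x, f x)).
have hp := is_diff_pair hk hf.
exact: (@is_diff_comp _ _ _ _ _ _ _ _ x hp hs).
Qed.

(** The index is off by one: [Ck k] asks for k + 1 successive derivatives. They are taken along
    fixed vectors, so the target space stays [W] and induction on k stays within maps [V -> W]. *)
Fixpoint Ck V W (k : nat) (f : V -> W) : Prop :=
  (forall x, differentiable f x) /\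
  (if k is k'.+1 then forall v, Ck k' (fun x => 'd f x v) else True).

Lemma Ck_diff V W k (f : V -> W) x : Ck k f -> differentiable f x.
Proof. by case: k => [|k] []. Qed.

Lemma Ck_dir V W k (f : V -> W) v : Ck k.+1 f -> Ck k (fun x => 'd f x v).
Proof. by case=> _; apply. Qed.

Lemma CkW V W k (f : V -> W) : Ck k.+1 f -> Ck k f.
Proof.
elim: k f => [|k IH] f [df Hf]; split=> // v.
exact: IH.
Qed.

Lemma smooth_Ck V W k (f : V -> W) : smooth f -> Ck k f.
Proof.
move=> sf; suff : forall vs, Ck k (foldr (fun v (h : V -> W) => 'D_v h) f vs).
  by move/(_ [::]).
elim: k => [|k IH] vs; (split; [by move=> x; exact: (sf vs x)|])=> // v.
have -> : (fun x => 'd (foldr (fun v (h : V -> W) => 'D_v h) f vs) x v) =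
   foldr (fun v (h : V -> W) => 'D_v h) f (v :: vs).
  by apply/funext => x /=; rewrite deriveE //; apply: sf.
exact: IH.
Qed.

Lemma Ck_cst V W k (w : W) : Ck k (fun _ : V => w).
Proof.
elim: k w => [|k IH] w; split=> // v.
have -> : (fun x : V => 'd (fun _ : V => w) x v) = (fun=> 0).
  by apply/funext => x; rewrite diff_cst.
exact: IH.
Qed.

Lemma Ck_lin V W k (f : {linear V -> W}) : continuous f -> Ck k f.
Proof.
move=> cf; case: k => [|k]; (split; [by move=> x; exact: linear_differentiable|])=> // v.
have -> : (fun x : V => 'd f x v) = (fun=> f v).
  by apply/funext => x; rewrite diff_lin.
exact: Ck_cst.
Qed.

Lemma Ck_lin_fun V W k (f : V -> W) : linear f -> continuous f -> Ck k f.
Proof.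
move=> lf cf; pose fM := GRing.isLinear.Build _ _ _ _ f lf.
by pose fL : {linear V -> W} := HB.pack f fM; apply: (@Ck_lin _ _ _ fL).
Qed.

Lemma diff_lin_fun V W (f : V -> W) x v : linear f -> continuous f ->
  'd f x v = f v.
Proof.
move=> lf cf; pose fM := GRing.isLinear.Build _ _ _ _ f lf.
pose fL : {linear V -> W} := HB.pack f fM.
by rewrite -[f]/(fL : V -> W) diff_lin.
Qed.

Lemma CkD V W k (f g : V -> W) : Ck k f -> Ck k g -> Ck k (fun x => f x + g x).
Proof.
elim: k f g => [|k IH] f g Hf Hg;
  (split; [by move=> x; apply: differentiableD; [exact: Ck_diff Hf|exact: Ck_diff Hg]|])=> // v.
have -> : (fun x : V => 'd (fun x => f x + g x) x v) =
    (fun x => 'd f x v + 'd g x v).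
  by apply/funext => x; rewrite (diffD (Ck_diff x Hf) (Ck_diff x Hg)).
by apply: IH; apply: Ck_dir.
Qed.

Lemma CkZ V W k (c : V -> R) (f : V -> W) :
  Ck k c -> Ck k f -> Ck k (fun x => c x *: f x).
Proof.
have H x (c' : V -> R) (f' : V -> W) : differentiable c' x ->
    differentiable f' x -> is_diff x (fun y => c' y *: f' y)
      (fun v => c' x *: 'd f' x v + 'd c' x v *: f' x).
  by move=> dc df; apply: is_diff_scale; apply: differentiableP.
elim: k c f => [|k IH] c f Hc Hf;
  (split; [by move=> x; have [] := H x _ _ (Ck_diff x Hc) (Ck_diff x Hf)|])=> // v.
have -> : (fun x : V => 'd (fun x => c x *: f x) x v) =
    (fun x => c x *: 'd f x v + 'd c x v *: f x).
  by apply/funext => x; have [_ ->] := H x _ _ (Ck_diff x Hc) (Ck_diff x Hf).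
by apply: CkD; apply: IH; [exact: CkW|exact: Ck_dir|exact: Ck_dir|exact: CkW].
Qed.

Lemma Ck_sum V W k (I : finType) (f : I -> V -> W) :
  (forall i, Ck k (f i)) -> Ck k (fun x => \sum_i f i x).
Proof.
move=> Hf; elim: (index_enum I) => [|i r IH].
  rewrite (_ : (fun x => _) = fun=> 0); first exact: Ck_cst.
  by apply/funext => x; rewrite big_nil.
rewrite (_ : (fun x => _) = fun x => f i x + \sum_(j <- r) f j x).
  exact: CkD.
by apply/funext => x; rewrite big_cons.
Qed.

Lemma diff_compv U V W (f : U -> V) (g : V -> W) x v :
  differentiable f x -> differentiable g (f x) ->
  'd (fun y => g (f y)) x v = 'd g (f x) ('d f x v).
Proof. by move=> df dg; have := diff_comp df dg => /funeqP /(_ v). Qed.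

Lemma Ck_linl U V W k (L : V -> W) (f : U -> V) : linear L -> continuous L ->
  Ck k f -> Ck k (fun x => L (f x)).
Proof.
move=> lL cL; have dL y := Ck_diff y (Ck_lin_fun 0 lL cL).
elim: k f => [|k IH] f Hf;
  (split; [by move=> x; apply: differentiable_comp => //; exact: (Ck_diff x Hf)|])=> // v.
have -> : (fun x => 'd (fun x => L (f x)) x v) = (fun x => L ('d f x v)).
  by apply/funext => x; rewrite (diff_compv _ (Ck_diff x Hf) (dL _)) (diff_lin_fun _ _ lL cL).
by apply: (IH (fun x => 'd f x v)); apply: Ck_dir.
Qed.

(** The differential of a composite is taken along a direction that moves with the point. Expanding
    that direction in a finite basis turns it into a sum of scalar functions times derivatives along
    fixed vectors, which [Ck] can handle. *)
Definition finite_frame (I : finType) U (e : I -> U) (c : I -> U -> R) :=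
  [/\ forall i, linear (c i), forall i, continuous (c i) &
      forall u, u = \sum_i c i u *: e i].

Lemma Ck_comp (I : finType) U V W (e : I -> V) (c : I -> V -> R) k
    (f : U -> V) (g : V -> W) :
  finite_frame e c -> Ck k f -> Ck k g -> Ck k (fun x => g (f x)).
Proof.
move=> [lc cc ec]; elim: k f g => [|k IH] f g Hf Hg;
  (split; [by move=> x; apply: differentiable_comp; [exact: (Ck_diff x Hf)|exact: (Ck_diff _ Hg)]|])=> // v.
have -> : (fun x => 'd (fun x => g (f x)) x v) =
   (fun x => \sum_i c i ('d f x v) *: 'd g (f x) (e i)).
  apply/funext => x; rewrite (diff_compv _ (Ck_diff x Hf) (Ck_diff _ Hg)).
  rewrite {1}[X in 'd g (f x) X](ec ('d f x v)) linear_sum.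
  by apply: eq_bigr => i _; rewrite linearZ.
apply: Ck_sum => i; apply: CkZ.
  by apply: (Ck_linl (f := fun x => 'd f x v)) => //; apply: Ck_dir.
by apply: (IH f (fun y => 'd g y (e i))); [apply: CkW|apply: Ck_dir].
Qed.

Lemma finite_frame_rV n :
  finite_frame (fun i : 'I_n => delta_mx 0 i : 'rV[R]_n) (fun i u => u 0 i).
Proof.
split=> [i a u v|i|u]; first by rewrite !mxE.
  exact: coord_continuous.
exact: row_sum_delta.
Qed.

Lemma finite_frame_prod (I J : finType) U V (e : I -> U) (c : I -> U -> R)
    (e' : J -> V) (c' : J -> V -> R) :
  finite_frame e c -> finite_frame e' c' ->
  finite_frame (fun i : I + J => match i with inl i => (e i, 0 : V)
                                 | inr j => (0 : U, e' j) end)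
    (fun i p => match i with inl i => c i p.1 | inr j => c' j p.2 end).
Proof.
move=> [lc cc ec] [lc' cc' ec']; split=> [[i|j] a u v|[i|j]|[u v]] /=.
- exact: lc.
- exact: lc'.
- by move=> p; apply: continuous_comp; [exact: cvg_fst|exact: cc].
- by move=> p; apply: continuous_comp; [exact: cvg_snd|exact: cc'].
rewrite big_sumType /= {1}(ec u) {1}(ec' v).
have -> : \sum_i c i u *: ((e i, 0) : U * V) = (\sum_i c i u *: e i, 0).
  elim: (index_enum I) => [|i r IH]; first by rewrite !big_nil.
  by rewrite !big_cons IH; congr pair; rewrite /= scaler0 addr0.
have -> : \sum_j c' j v *: ((0, e' j) : U * V) = (0, \sum_j c' j v *: e' j).
  elim: (index_enum J) => [|i r IH]; first by rewrite !big_nil.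
  by rewrite !big_cons IH; congr pair; rewrite /= scaler0 addr0.
by congr pair; rewrite /= ?addr0 ?add0r.
Qed.

Lemma Ck_pair U V W k (f : U -> V) (g : U -> W) :
  Ck k f -> Ck k g -> Ck k (fun x => (f x, g x)).
Proof.
elim: k f g => [|k IH] f g Hf Hg;
  (split; [by move=> x; apply: differentiable_pair; [exact: (Ck_diff x Hf)|exact: (Ck_diff x Hg)]|])=> // v.
have -> : (fun x => 'd (fun x => (f x, g x)) x v) =
   (fun x => ('d f x v, 'd g x v)).
  by apply/funext => x; rewrite (diff_pair (Ck_diff x Hf) (Ck_diff x Hg)).
by apply: IH; apply: Ck_dir.
Qed.

Lemma diff_expansion V W (f : V -> W) x (e : R) : differentiable f x -> 0 < e ->
  exists2 d, 0 < d & forall y, `|y| < d ->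
    `|f (x + y) - f x - 'd f x y| <= e * `|y|.
Proof.
move=> df e0; have /diff_locallyP [_ /eqaddoP /(_ e e0)] := df.
move=> /nbhs_ballP [d /= d0 Hd]; exists d => // y yd.
have := Hd y; rewrite -ball_normE /= sub0r normrN => /(_ yd).
by rewrite /= /shift /= !fctE /= (addrC y x) opprD addrA.
Qed.

Lemma is_derive_line V (f : V -> R) (x v : V) (t : R) :
  differentiable f (x + t *: v) ->
  is_derive t 1 (fun s : R => f (x + s *: v)) ('d f (x + t *: v) v).
Proof.
move=> df; have dl : is_diff t (fun s : R => x + s *: v) (fun s => s *: v).
  have := is_diffD (is_diff_cst x t) (is_diff_scalel t v).
  by move=> h; apply: (is_diff_eq h); rewrite funeqE => s; exact: add0r.
have dfl : is_diff t (fun s : R => f (x + s *: v))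
   ('d f (x + t *: v) \o (fun s => s *: v)).
  by apply: (@is_diff_comp _ _ _ _ _ _ _ _ t dl); exact: differentiableP.
have [d1 d2] := dfl.
apply: DeriveDef; first exact: diff_derivable.
by rewrite deriveE // d2 /= scale1r.
Qed.

(** The quantitative form of Young's theorem: the mixed second difference, divided by h^2, tends to
    the second derivative. Differentiability of the first derivative at the single point [x] is
    enough. *)
Lemma second_difference V (f : V -> R) (x u v : V) (e : R) :
  (forall y, differentiable f y) -> differentiable (fun y => 'd f y u) x ->
  0 < e -> exists2 d, 0 < d & forall h, 0 < h < d ->
  `|f (x + h *: v + h *: u) - f (x + h *: u) - (f (x + h *: v) - f x)
    - h ^+ 2 * 'd (fun y => 'd f y u) x v| <= e * h ^+ 2.
Proof.
move=> df dfu e0; pose K := `|u| + `|v| + 1.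
have K0 : 0 < K by rewrite /K ltr_wpDl // addr_ge0.
have e'0 : 0 < e / (2 * K) by rewrite divr_gt0 ?mulr_gt0.
have [d d0 Hd] := diff_expansion dfu e'0.
exists (d / K); first by rewrite divr_gt0.
move=> h /andP[h0 hd].
(* The second difference is [g h - g 0]. The mean value theorem replaces it by h times a difference
   of two first derivatives, and each of these is expanded to first order at [x]. *)
pose g (s : R) := f (x + h *: v + s *: u) - f (x + s *: u).
have dg (s : R) : is_derive s 1 g ('d f (x + h *: v + s *: u) u - 'd f (x + s *: u) u).
  by apply: is_deriveB; apply: is_derive_line.
have [|t] := @MVT R g _ 0 h h0 (fun s _ => dg s).
  apply: continuous_subspaceT => s.
  by have /derivable1_diffP/differentiable_continuous := @ex_derive _ _ _ _ _ _ _ (dg s).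
rewrite in_itv /= => /andP[t0 th].
rewrite {1 2}/g !scale0r !addr0 subr0 => ->.
have nK (s : R) w : 0 <= s <= h -> (w = v \/ w = 0) ->
    `|h *: w + s *: u| < d /\ `|h *: w + s *: u| <= K * h.
  move=> /andP[s0 sh] hw.
  have H : `|h *: w + s *: u| <= (`|u| + `|v|) * h.
    rewrite (le_trans (ler_normD _ _)) // !normrZ (ger0_norm s0) gtr0_norm //.
    rewrite mulrDl addrC [_ * h]mulrC [`|v| * h]mulrC lerD //.
      by rewrite ler_wpM2r.
    by rewrite ler_pM2l //; case: hw => ->; rewrite ?normr0.
  have H2 : `|h *: w + s *: u| <= K * h.
    by rewrite (le_trans H) // /K [leRHS]mulrDl lerDl mul1r ltW.
  split=> //; apply: (le_lt_trans H2).
  by rewrite mulrC -ltr_pdivlMr.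
have tI : 0 <= t <= h by rewrite !ltW.
have [b1 c1] := nK t v tI (or_introl erefl).
have [b2 c2] := nK t 0 tI (or_intror erefl).
have := Hd _ b1; have := Hd _ b2.
rewrite scaler0 add0r (addrA x) linearD !linearZ /=.
set A := 'd f (x + t *: u) u; set B := 'd f x u; set C := 'd f (x + h *: v + t *: u) u.
set X := 'd _ x v; set Y := 'd _ x u.
have c3 : e / (2 * K) * `|h *: v + t *: u| <= e * h / 2.
  rewrite (le_trans (ler_wpM2l (ltW e'0) c1)) // le_eqVlt; apply/orP; left.
  by apply/eqP; field; rewrite gt_eqF.
have c4 : e / (2 * K) * `|t *: u| <= e * h / 2.
  move: c2; rewrite scaler0 add0r => c2.
  rewrite (le_trans (ler_wpM2l (ltW e'0) c2)) // le_eqVlt; apply/orP; left.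
  by apply/eqP; field; rewrite gt_eqF.
move=> /le_trans/(_ c4) a1 /le_trans/(_ c3) a2.
have -> : (C - A) * h + h ^+ 2 *: - X =
   h * ((C - B - (h * X + t * Y)) - (A - B - t * Y)).
  by rewrite -[_ *: _]/(_ * _); ring.
rewrite normrM gtr0_norm // expr2 mulrA [leRHS]mulrC ler_pM2l //.
rewrite (le_trans (ler_normB _ _)) //.
have -> : e * h = e * h / 2 + e * h / 2 by field.
by rewrite scalerN in a1; exact: lerD.
Qed.

(** The second difference is symmetric in [u] and [v], so it approximates both mixed derivatives. *)
Lemma diff_sym V (f : V -> R) (x u v : V) :
  (forall y, differentiable f y) -> (forall w, differentiable (fun y => 'd f y w) x) ->
  'd (fun y => 'd f y u) x v = 'd (fun y => 'd f y v) x u.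
Proof.
move=> df d2f; apply/eqP; rewrite -subr_eq0 -normr_le0.
apply/ler_addgt0Pr => e e0; rewrite add0r.
have e20 : 0 < e / 2 by rewrite divr_gt0.
have [d1 d10 H1] := @second_difference V f x u v _ df (d2f u) e20.
have [d2 d20 H2] := @second_difference V f x v u _ df (d2f v) e20.
pose h := Num.min d1 d2 / 2.
have h0 : 0 < h by rewrite divr_gt0 // lt_min d10.
have hm : h < Num.min d1 d2 by rewrite /h; move: h0; rewrite /h; lra.
have := hm; rewrite lt_min => /andP[hd1 hd2].
have := H1 h; rewrite h0 hd1 => /(_ isT) {}H1.
have := H2 h; rewrite h0 hd2 => /(_ isT) {}H2.
rewrite (addrAC x (h *: u) (h *: v)) in H2.
move: H1 H2; set A := f _; set B := f _; set C := f _; set D := f _.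
set X := 'd _ x v; set Y := 'd _ x u => H1 H2.
have h20 : 0 < h ^+ 2 by rewrite exprn_gt0.
rewrite -(ler_pM2l h20) -[h ^+ 2 in leLHS]gtr0_norm // -normrM.
have -> : h ^+ 2 * (X - Y) = (A - C - (B - D) - h ^+ 2 * Y) -
   (A - B - (C - D) - h ^+ 2 * X) by ring.
rewrite (le_trans (ler_normB _ _)) //.
have -> : h ^+ 2 * e = e / 2 * h ^+ 2 + e / 2 * h ^+ 2 by field.
exact: lerD.
Qed.

End SmoothCalculus.

Section MoreCalculus.
Variable R : realType.
Implicit Types U V W : normedModType R.

Lemma linear_sumZ (V W : lmodType R) (I : finType) (f : V -> W)
    (a : I -> R) (x : I -> V) : linear f ->
  f (\sum_i a i *: x i) = \sum_i a i *: f (x i).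
Proof.
move=> lf; pose fM := GRing.isLinear.Build _ _ _ _ f lf.
pose fL : {linear V -> W} := HB.pack f fM.
by rewrite -[f]/(fL : V -> W) linear_sum; apply: eq_bigr => i _; rewrite linearZ.
Qed.

Lemma is_diff_eqfun V W (f df df' : V -> W) x :
  is_diff x f df -> df =1 df' -> is_diff x f df'.
Proof. by move=> h e; apply: (is_diff_eq h); apply/funext. Qed.

Lemma is_diff_sumf V W (I : finType) (f df : I -> V -> W) x :
  (forall i, is_diff x (f i) (df i)) ->
  is_diff x (fun y => \sum_i f i y) (fun v => \sum_i df i v).
Proof.
move=> H; elim: (index_enum I) => [|i r IH].
  rewrite (_ : (fun y => _) = cst 0).
    apply: (is_diff_eqfun (is_diff_cst 0 x)) => v.
    by rewrite big_nil.
  by apply/funext => y; rewrite big_nil.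
rewrite (_ : (fun y => _) = f i + (fun y => \sum_(j <- r) f j y)).
  apply: (is_diff_eqfun (is_diffD (H i) IH)) => v.
  by rewrite big_cons.
by apply/funext => y; rewrite big_cons.
Qed.

Lemma is_diff_coord V n (f df : V -> 'rV[R]_n) x j :
  is_diff x f df -> is_diff x (fun y => f y 0 j) (fun v => df v 0 j).
Proof.
move=> [d1 d2]; have cl : linear (fun u : 'rV[R]_n => u 0 j).
  by move=> a u v; rewrite !mxE.
have cc : continuous (fun u : 'rV[R]_n => u 0 j) by exact: coord_continuous.
apply: DiffDef; first exact: (differentiable_comp d1 (differentiable_coord _ _ _)).
apply/funext => v.
rewrite (diff_compv _ d1 (differentiable_coord _ _ _)).
by rewrite (diff_lin_fun _ _ cl cc) d2.
Qed.

Lemma diff_sym_rV V n (f : V -> 'rV[R]_n) (x u v : V) : Ck 1 f ->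
  'd (fun y => 'd f y u) x v = 'd (fun y => 'd f y v) x u.
Proof.
move=> Hf; apply/rowP => j.
have D y := is_diff_coord j (differentiableP (Ck_diff y Hf)).
have D2 w := is_diff_coord j (differentiableP (Ck_diff x (Ck_dir w Hf))).
have dE w : (fun y => ('d f y w) 0 j) = fun y => 'd (fun y => f y 0 j) y w.
  by apply/funext => y; case: (D y) => _ ->.
have [_ /funeqP/(_ v) <-] := D2 u; have [_ /funeqP/(_ u) <-] := D2 v.
rewrite !dE; apply: diff_sym => [y|w]; first by case: (D y).
by rewrite -dE; case: (D2 w).
Qed.

Lemma is_diff_bilinear V l n k (b : 'rV[R]_l -> 'rV[R]_n -> 'rV[R]_k)
    (f df : V -> 'rV[R]_l) (g dg : V -> 'rV[R]_n) x :
  (forall y, linear (b ^~ y)) -> (forall y, linear (b y)) ->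
  is_diff x f df -> is_diff x g dg ->
  is_diff x (fun y => b (f y) (g y)) (fun v => b (f x) (dg v) + b (df v) (g x)).
Proof.
move=> bl br hf hg.
have bE u v : b u v = \sum_i \sum_j u 0 i *: (v 0 j *: b (delta_mx 0 i) (delta_mx 0 j)).
  rewrite {1}[u]row_sum_delta (linear_sumZ _ _ (bl v)).
  apply: eq_bigr => i _; rewrite -scaler_sumr; congr (_ *: _).
  by rewrite {1}[v]row_sum_delta (linear_sumZ _ _ (br _)).
rewrite (_ : (fun y => _) = fun y => \sum_i \sum_j f y 0 i *:
    (g y 0 j *: b (delta_mx 0 i) (delta_mx 0 j))); last first.
  by apply/funext => y; exact: bE.
have H i j := is_diff_scale (is_diff_coord i hf) (is_diff_scale
  (is_diff_coord j hg) (is_diff_cst (b (delta_mx 0 i) (delta_mx 0 j)) x)).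
apply: (is_diff_eqfun (is_diff_sumf (fun i => is_diff_sumf (H i)))) => v.
rewrite !bE -big_split; apply: eq_bigr => i _; rewrite -big_split.
by apply: eq_bigr => j _ /=; rewrite [(0 : V -> _) v]/(0 : 'rV_k) scaler0 add0r.
Qed.

Section Framed.
Variables (I : finType) (U V W : normedModType R).
Variables (e : I -> U) (c : I -> U -> R).
Hypothesis fr : finite_frame e c.

Let dE (phi : U -> W) q u : 'd phi q u = \sum_i c i u *: 'd phi q (e i).
Proof.
have [_ _ ec] := fr; rewrite {1}[u]ec linear_sum.
by apply: eq_bigr => i _; rewrite linearZ.
Qed.

Lemma Ck_diff_app k (phi : U -> W) (b w : V -> U) :
  Ck k.+1 phi -> Ck k b -> Ck k w -> Ck k (fun p => 'd phi (b p) (w p)).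
Proof.
move=> Hp Hb Hw; rewrite (_ : (fun p => _) =
   (fun p => \sum_i c i (w p) *: 'd phi (b p) (e i))).
  have [lc cc _] := fr.
  apply: Ck_sum => i; apply: CkZ; first exact: Ck_linl.
  apply: (Ck_comp fr (g := fun q => 'd phi q (e i))) => //; exact: Ck_dir.
by apply/funext => p; exact: dE.
Qed.

(** The product rule when both base point and direction move: a second derivative of [phi] with the
    direction frozen, plus the differential applied to the derivative of the direction. *)
Lemma is_diff_diff (phi : U -> W) (b db w dw : V -> U) p :
  Ck 1 phi -> is_diff p b db -> is_diff p w dw ->
  is_diff p (fun p => 'd phi (b p) (w p))
   (fun v => 'd (fun q => 'd phi q (w p)) (b p) (db v) + 'd phi (b p) (dw v)).
Proof.
move=> Hp hb hw; have [lc cc ec] := fr.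
have hd i := differentiableP (Ck_diff (b p) (Ck_dir (e i) Hp)).
have hc i : is_diff p (fun y => c i (w y)) (fun v => c i (dw v)).
  case: hw => w1 w2; have dc y := Ck_diff y (Ck_lin_fun 0 (lc i) (cc i)).
  apply: DiffDef; first exact: differentiable_comp.
  apply/funext => v; rewrite (diff_compv _ w1 (dc _)).
  by rewrite (diff_lin_fun _ _ (lc i) (cc i)) w2.
rewrite (_ : (fun p => _) =
   (fun p => \sum_i c i (w p) *: 'd phi (b p) (e i))); last first.
  by apply/funext => y; exact: dE.
have H i := is_diff_scale (hc i) (@is_diff_comp _ _ _ _ _ _ _ _ p hb (hd i)).
apply: (is_diff_eqfun (is_diff_sumf H)) => v.
rewrite big_split /= -dE; congr (_ + _).
have H2 := is_diff_sumf (fun i => is_diffZ (c i (w p)) (hd i)).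
have E : (fun q => 'd phi q (w p)) = (fun y => \sum_i (c i (w p) \*: (fun x => 'd phi x (e i))) y).
  by apply/funext => q; rewrite dE.
by rewrite E; case: H2 => _ ->.
Qed.

End Framed.

(** Differentiating the relation between the fields produces, besides the bracket terms, second
    derivatives of [phi], which cancel by symmetry. *)
Lemma field_bracket_related n m (phi : 'rV[R]_n -> 'rV[R]_m)
    (X Y : 'rV[R]_n -> 'rV[R]_n) (X' Y' : 'rV[R]_m -> 'rV[R]_m) p :
  Ck 1 phi -> differentiable X p -> differentiable Y p ->
  differentiable X' (phi p) -> differentiable Y' (phi p) ->
  (forall q, 'd phi q (X q) = X' (phi q)) ->
  (forall q, 'd phi q (Y q) = Y' (phi q)) ->
  'd phi p (field_bracket X Y p) = field_bracket X' Y' (phi p).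
Proof.
move=> Hp dX dY dX' dY' eX eY.
have main (Z : 'rV[R]_n -> 'rV[R]_n) (Z' : 'rV[R]_m -> 'rV[R]_m) v w :
    'd phi p v = w ->
    differentiable Z p -> differentiable Z' (phi p) ->
    (forall q, 'd phi q (Z q) = Z' (phi q)) ->
    'd (fun q => 'd phi q (Z p)) p v + 'd phi p ('d Z p v) =
    'd Z' (phi p) w.
  move=> <- dZ dZ' eZ.
  have [_ /funeqP/(_ v) <-] := is_diff_diff (@finite_frame_rV R n) Hp (is_diff_id p) (differentiableP dZ).
  rewrite -(diff_compv _ (Ck_diff p Hp) dZ').
  by rewrite (_ : (fun p0 => 'd phi (id p0) (Z p0)) = fun y => Z' (phi y)); last exact/funext.
have mY := main Y Y' _ _ (eX p) dY dY' eY.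
have mX := main X X' _ _ (eY p) dX dX' eX.
have aux (a b c d x y : 'rV[R]_m) : a + b = x -> c + d = y -> a = c -> b - d = x - y.
  by move=> <- <- ->; rewrite opprD addrACA subrr add0r.
rewrite /field_bracket linearB.
exact: (aux _ _ _ _ _ _ mY mX (diff_sym_rV p (Y p) (X p) Hp)).
Qed.

End MoreCalculus.

(** * Left-invariant fields on Lie groups *)

#[local] Opaque diff.

Section LieGroups.
Variables (R : realType) (n : nat) (G : lie_group R n).
Notation V := 'rV[R]_n.
Local Notation VN := ('rV[R]_n : normedModType R).
Local Notation mu := (fun pq : V * V => gmul G pq.1 pq.2).
Local Notation fL := (left_invariant_field G).
Local Notation one := (gone G).
Local Notation inv := (ginv G).

Lemma gmulgV p : gmul G p (inv p) = one.
Proof.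
by rewrite -{1}(gmul1 G p) -{1}(gmulV G (inv p)) -!gmulA (gmulA G (inv p) p) gmulV gmul1 gmulV.
Qed.

Lemma gmulg1 p : gmul G p one = p.
Proof. by rewrite -(gmulV G p) gmulA gmulgV gmul1. Qed.

Lemma Ck_id k (U : normedModType R) : Ck k (@id U).
Proof. by apply: Ck_lin_fun => // x; exact: cvg_id. Qed.

Definition pair_frame := finite_frame_prod (@finite_frame_rV R n) (@finite_frame_rV R n).

Lemma Ck_mu k : Ck k mu.
Proof. exact: smooth_Ck (gmul_smooth G). Qed.

Lemma Ck_gmull k p : Ck k (gmul G p).
Proof.
have H := Ck_pair (Ck_cst VN k p) (Ck_id k VN).
exact: (@Ck_comp _ _ _ _ _ _ _ _ (fun q => (p, q)) mu pair_frame H (Ck_mu k)).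
Qed.

Lemma Ck_inv k : Ck k inv.
Proof. exact: smooth_Ck (ginv_smooth G). Qed.

Lemma diff_gmull p q v : 'd (gmul G p) q v = 'd mu (p, q) (0, v).
Proof.
have H := is_diff_pair (is_diff_cst p q) (is_diff_id q).
by have [_ /funeqP/(_ v)] := @is_diff_comp _ _ _ _ _ _ _ _ q H
  (differentiableP (Ck_diff (p, q) (Ck_mu 0))).
Qed.

(** As a partial differential of the multiplication, the field depends smoothly on [p] by the joint
    smoothness of [mu]. *)
Lemma fieldE u p : fL u p = 'd mu (p, one) (0, u).
Proof. exact: diff_gmull. Qed.

Lemma Ck_field_app k (w : V -> V) : Ck k w -> Ck k (fun p => fL (w p) p).
Proof.
move=> Hw; rewrite (_ : (fun p => _) = fun p => 'd mu (p, one) (0, w p)).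
  exact: (Ck_diff_app pair_frame (Ck_mu k.+1) (Ck_pair (Ck_id k VN) (Ck_cst VN k one))
    (Ck_pair (Ck_cst VN k 0) Hw)).
by apply/funext => p; exact: fieldE.
Qed.

Lemma Ck_field k u : Ck k (fL u).
Proof. exact: (Ck_field_app (Ck_cst VN k u)). Qed.

Lemma field_gmul q p u : 'd (gmul G q) p (fL u p) = fL u (gmul G q p).
Proof.
have D r s := Ck_diff r (Ck_gmull 0 s).
have D' : differentiable (gmul G q) (gmul G p one) by exact: D.
have E := diff_compv u (D one p) D'.
rewrite gmulg1 (_ : (fun r => _) = gmul G (gmul G q p)) in E; first exact: esym E.
by apply/funext => r; rewrite gmulA.
Qed.

(** Left translations relate every left-invariant field to itself, so the bracket of two such fields
    is determined by its value at the identity. *)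
Lemma field_bracket_left u v p :
  field_bracket (fL u) (fL v) p = fL (group_bracket G u v) p.
Proof.
have H := @field_bracket_related _ _ _ (gmul G p) (fL u) (fL v) (fL u) (fL v)
  one (Ck_gmull 1 p) (Ck_diff _ (Ck_field 0 u)) (Ck_diff _ (Ck_field 0 v))
  (Ck_diff _ (Ck_field 0 u)) (Ck_diff _ (Ck_field 0 v))
  (fun q => field_gmul p q u) (fun q => field_gmul p q v).
by rewrite gmulg1 in H; rewrite -H.
Qed.

Lemma field1 u : fL u one = u.
Proof.
rewrite /left_invariant_field (_ : gmul G one = id).
  by have [_ ->] := is_diff_id one.
by apply/funext => q; rewrite gmul1.
Qed.

Lemma field_invK u p : 'd (gmul G (inv p)) p (fL u p) = u.
Proof. by rewrite field_gmul gmulV field1. Qed.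

Lemma field_inv_coframe p w : fL ('d (gmul G (inv p)) p w) p = w.
Proof.
have D r s := Ck_diff r (Ck_gmull 0 s).
have D' : differentiable (gmul G p) (gmul G (inv p) p) by exact: D.
have -> : fL ('d (gmul G (inv p)) p w) p = 'd (gmul G p) (gmul G (inv p) p) ('d (gmul G (inv p)) p w).
  by rewrite gmulV.
rewrite -(diff_compv _ (D _ _) D') (_ : (fun y => _) = id).
  by have [_ ->] := is_diff_id p.
by apply/funext => r; rewrite gmulA gmulgV gmul1.
Qed.

Lemma Ck_coframe_app k (w : V -> V) : Ck k w ->
  Ck k (fun p => 'd (gmul G (inv p)) p (w p)).
Proof.
move=> Hw; rewrite (_ : (fun p => _) = fun p => 'd mu (inv p, p) (0, w p)).
  exact: (Ck_diff_app pair_frame (Ck_mu k.+1) (Ck_pair (Ck_inv k) (Ck_id k VN))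
    (Ck_pair (Ck_cst VN k 0) Hw)).
by apply/funext => p; exact: diff_gmull.
Qed.

Lemma left_invariant_fieldP a u v p : fL (a *: u + v) p = a *: fL u p + fL v p.
Proof. exact: linearP. Qed.

(** The Leibniz rule for a field with variable components in the left-invariant frame: one term
    freezes the components at [p], the other differentiates them. *)
Lemma diff_field_app (w dw : V -> V) p : is_diff p w dw ->
  is_diff p (fun p => fL (w p) p) (fun v => 'd (fL (w p)) p v + fL (dw v) p).
Proof.
move=> hw; have hb := is_diff_pair (is_diff_id p) (is_diff_cst one p).
have hw' := is_diff_pair (is_diff_cst (0 : V) p) hw.
have H := is_diff_diff pair_frame (Ck_mu 1) hb hw'.
rewrite (_ : (fun p => _) = fun p => 'd mu (p, one) (0, w p)); last first.
  by apply/funext => q; exact: fieldE.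
apply: (is_diff_eqfun H) => v; rewrite (fieldE (dw v)); congr (_ + _).
have hw0 := is_diff_pair (is_diff_cst (0 : V) p) (is_diff_cst (w p) p).
have H0 := is_diff_diff pair_frame (Ck_mu 1) hb hw0.
have -> : fL (w p) = fun q => 'd mu (q, one) (0, w p).
  by apply/funext => q; exact: fieldE.
have [_ ->] := H0.
have aux (x y : V) : y = 0 -> x = x + y by move=> ->; rewrite addr0.
apply: aux; exact: linear0.
Qed.

End LieGroups.

(** * The Levi-Civita connection of a metric Lie algebra *)

Section Bilinear.
Variables (R : realType) (n : nat) (G : 'M[R]_n).
Implicit Types x y z : 'rV[R]_n.

Lemma bformDl x y z : bform G (x + y) z = bform G x z + bform G y z.
Proof. by rewrite /bform !mulmxDl mxE. Qed.
Lemma bformDr x y z : bform G z (x + y) = bform G z x + bform G z y.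
Proof. by rewrite /bform linearD /= !mulmxDr mxE. Qed.
Lemma bformZl a x z : bform G (a *: x) z = a * bform G x z.
Proof. by rewrite /bform -!scalemxAl mxE. Qed.
Lemma bformZr a x z : bform G z (a *: x) = a * bform G z x.
Proof. by rewrite /bform linearZ /= -!scalemxAr mxE. Qed.
Lemma bformNl x z : bform G (- x) z = - bform G x z.
Proof. by rewrite -scaleN1r bformZl mulN1r. Qed.
Lemma bformNr x z : bform G z (- x) = - bform G z x.
Proof. by rewrite -scaleN1r bformZr mulN1r. Qed.
Lemma bform0l z : bform G 0 z = 0.
Proof. by rewrite -(scale0r 0) bformZl mul0r. Qed.
Lemma bform0r z : bform G z 0 = 0.
Proof. by rewrite -(scale0r 0) bformZr mul0r. Qed.
Definition bformE := (bformDl, bformDr, bformZl, bformZr, bformNl, bformNr).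

Lemma bform_suml (I : finType) (f : I -> 'rV[R]_n) z :
  bform G (\sum_i f i) z = \sum_i bform G (f i) z.
Proof.
elim: (index_enum I) => [|i r IH]; first by rewrite !big_nil bform0l.
by rewrite !big_cons bformDl IH.
Qed.
Lemma bform_sumr (I : finType) (f : I -> 'rV[R]_n) z :
  bform G z (\sum_i f i) = \sum_i bform G z (f i).
Proof.
elim: (index_enum I) => [|i r IH]; first by rewrite !big_nil bform0r.
by rewrite !big_cons bformDr IH.
Qed.

Hypothesis mG : is_metric G.

Lemma bformC x y : bform G x y = bform G y x.
Proof.
have [_ sG] := mG; rewrite /bform.
have -> : y *m G *m x^T = (x *m G *m y^T)^T.
  by rewrite !trmx_mul trmxK sG mulmxA.
by rewrite [RHS]mxE.
Qed.

Lemma bform_nondeg x : (forall z, bform G x z = 0) -> x = 0.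
Proof.
move=> H; have [uG _] := mG.
suff: x *m G = 0 by move=> e; rewrite -[x](mulmxK uG) e mul0mx.
apply/rowP => j; have := H (delta_mx 0 j).
by rewrite /bform trmx_delta -colE mxE => ->; rewrite mxE.
Qed.

Lemma bform_inj x y : (forall z, bform G x z = bform G y z) -> x = y.
Proof.
move=> H; apply/eqP; rewrite -subr_eq0; apply/eqP/bform_nondeg => z.
by rewrite bformDl bformNl H subrr.
Qed.
End Bilinear.

(** These axioms determine the Levi-Civita connection. The Jacobi identity is added separately where
    the first Bianchi identity calls for it, so that a frame with integer structure constants only
    has to be tested for antisymmetry. *)
Definition metric_alg (R : realType) n (A : metric_algebra R n) :=
  [/\ forall a x y z, br A (a *: x + y) z = a *: br A x z + br A y z,
      forall a x y z, br A z (a *: x + y) = a *: br A z x + br A z y,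
      forall x, br A x x = 0 & is_metric (gram A)].

Section LeviCivita.
Variables (R : realType) (n : nat) (A : metric_algebra R n).
Hypothesis okA : metric_alg A.
Implicit Types x y z w : 'rV[R]_n.
Local Notation g := (bform (gram A)).

Let mG : is_metric (gram A). Proof. by case: okA. Qed.

Lemma brPl a x y z : br A (a *: x + y) z = a *: br A x z + br A y z.
Proof. by case: okA. Qed.
Lemma brPr a x y z : br A z (a *: x + y) = a *: br A z x + br A z y.
Proof. by case: okA. Qed.
Lemma brxx x : br A x x = 0. Proof. by case: okA. Qed.
Lemma brDl x y z : br A (x + y) z = br A x z + br A y z.
Proof. by rewrite -[x in LHS]scale1r brPl scale1r. Qed.
Lemma brDr x y z : br A z (x + y) = br A z x + br A z y.
Proof. by rewrite -[x in LHS]scale1r brPr scale1r. Qed.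
Lemma br0l z : br A 0 z = 0.
Proof. by apply: (addrI (br A 0 z)); rewrite -brDl !addr0. Qed.
Lemma br0r z : br A z 0 = 0.
Proof. by apply: (addrI (br A z 0)); rewrite -brDr !addr0. Qed.
Lemma brZl a x z : br A (a *: x) z = a *: br A x z.
Proof. by rewrite -[a *: x]addr0 brPl br0l addr0. Qed.
Lemma brZr a x z : br A z (a *: x) = a *: br A z x.
Proof. by rewrite -[a *: x]addr0 brPr br0r addr0. Qed.
Lemma brNr x z : br A z (- x) = - br A z x.
Proof. by rewrite -scaleN1r brZr scaleN1r. Qed.
Lemma brC x y : br A x y = - br A y x.
Proof.
have := brxx (x + y); rewrite brDl !brDr !brxx addr0 add0r => /eqP.
by rewrite addr_eq0 => /eqP.
Qed.
Lemma br_sumr (I : finType) (f : I -> 'rV[R]_n) z :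
  br A z (\sum_i f i) = \sum_i br A z (f i).
Proof.
elim: (index_enum I) => [|i r IH]; first by rewrite !big_nil br0r.
by rewrite !big_cons brDr IH.
Qed.
Lemma br_suml (I : finType) (f : I -> 'rV[R]_n) z :
  br A (\sum_i f i) z = \sum_i br A (f i) z.
Proof.
elim: (index_enum I) => [|i r IH]; first by rewrite !big_nil br0l.
by rewrite !big_cons brDl IH.
Qed.

Lemma koszulPz a x y z w : koszul A x y (a *: z + w) = a * koszul A x y z + koszul A x y w.
Proof. rewrite /koszul brPl brPr !bformE; ring. Qed.

Lemma koszul_nabla x y z : g (nabla A x y) z = koszul A x y z.
Proof.
have [uG _] := mG.
rewrite /nabla /bform mulmxKV // mxE.
have kD u v : koszul A x y (u + v) = koszul A x y u + koszul A x y v.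
  by rewrite -[u in LHS]scale1r koszulPz mul1r.
have k0 : koszul A x y 0 = 0.
  by apply: (addrI (koszul A x y 0)); rewrite -kD !addr0.
rewrite {2}[z]row_sum_delta.
elim: (index_enum _) => [|i r IH]; first by rewrite !big_nil k0.
by rewrite !big_cons koszulPz -IH !mxE mulrC.
Qed.

Lemma nablaP a x y z : nabla A (a *: x + y) z = a *: nabla A x z + nabla A y z.
Proof.
apply: (bform_inj mG) => w; rewrite !bformE !koszul_nabla /koszul brPl brPr !bformE; ring.
Qed.
Lemma nablaPr a x y z : nabla A z (a *: x + y) = a *: nabla A z x + nabla A z y.
Proof.
apply: (bform_inj mG) => w; rewrite !bformE !koszul_nabla /koszul brPl brPr !bformE; ring.
Qed.
Lemma nablaDl x y z : nabla A (x + y) z = nabla A x z + nabla A y z.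
Proof. by rewrite -[x in LHS]scale1r nablaP scale1r. Qed.
Lemma nablaDr x y z : nabla A z (x + y) = nabla A z x + nabla A z y.
Proof. by rewrite -[x in LHS]scale1r nablaPr scale1r. Qed.
Lemma nabla0l z : nabla A 0 z = 0.
Proof. by apply: (addrI (nabla A 0 z)); rewrite -nablaDl !addr0. Qed.
Lemma nabla0r z : nabla A z 0 = 0.
Proof. by apply: (addrI (nabla A z 0)); rewrite -nablaDr !addr0. Qed.
Lemma nablaZl a x z : nabla A (a *: x) z = a *: nabla A x z.
Proof. by rewrite -[a *: x]addr0 nablaP nabla0l addr0. Qed.
Lemma nablaZr a x z : nabla A z (a *: x) = a *: nabla A z x.
Proof. by rewrite -[a *: x]addr0 nablaPr nabla0r addr0. Qed.
Lemma nablaNl x z : nabla A (- x) z = - nabla A x z.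
Proof. by rewrite -scaleN1r nablaZl scaleN1r. Qed.
Lemma nablaNr x z : nabla A z (- x) = - nabla A z x.
Proof. by rewrite -scaleN1r nablaZr scaleN1r. Qed.

Lemma nabla_torsion x y : nabla A x y - nabla A y x = br A x y.
Proof.
apply: (bform_inj mG) => w; rewrite !bformE !koszul_nabla /koszul.
rewrite (brC y x) (brC w y) (brC x w) !bformE.
lra.
Qed.

Lemma nabla_metric x y z : g (nabla A x y) z + g y (nabla A x z) = 0.
Proof.
rewrite (bformC mG y) !koszul_nabla /koszul.
rewrite (brC z y) (brC x z) (brC y x) !bformE; lra.
Qed.

Lemma curvatureP a x y z w :
  curvature A (a *: x + y) z w = a *: curvature A x z w + curvature A y z w.
Proof.
rewrite /curvature !(brPl, nablaP, nablaPr) !scalerBr.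
set u1 := a *: nabla _ _ _; set u2 := a *: nabla _ _ _; set u3 := a *: nabla _ _ _.
set v1 := nabla _ _ _; set v2 := nabla _ _ _; set v3 := nabla _ _ _.
by rewrite !opprD (addrACA u1) (addrACA (u1 - u2)).
Qed.

Lemma curvatureP3 a x y z w :
  curvature A x y (a *: z + w) = a *: curvature A x y z + curvature A x y w.
Proof.
rewrite /curvature !(nablaP, nablaPr) !scalerBr.
set u1 := a *: nabla _ _ _; set u2 := a *: nabla _ _ _; set u3 := a *: nabla _ _ _.
set v1 := nabla _ _ _; set v2 := nabla _ _ _; set v3 := nabla _ _ _.
by rewrite !opprD (addrACA u1) (addrACA (u1 - u2)).
Qed.

Lemma curvatureC x y z : curvature A x y z = - curvature A y x z.
Proof. by rewrite /curvature (brC x y) nablaNl !opprB !opprK addrC addrA addrAC. Qed.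

Lemma curvatureP2 a x y z w :
  curvature A z (a *: x + y) w = a *: curvature A z x w + curvature A z y w.
Proof.
by rewrite curvatureC curvatureP opprD -scalerN -!(curvatureC z).
Qed.

Lemma curvature_skew x y z w : g (curvature A x y z) w = - g z (curvature A x y w).
Proof.
have M u v t : g (nabla A u v) t = - g v (nabla A u t).
  by apply/eqP; rewrite -addr_eq0 nabla_metric.
rewrite /curvature !bformE !M !opprK; ring.
Qed.

Hypothesis jac : forall x y z, br A x (br A y z) + br A y (br A z x) + br A z (br A x y) = 0.

Lemma bianchi x y z : curvature A x y z + curvature A y z x + curvature A z x y = 0.
Proof.
rewrite -(jac x y z) /curvature.
have T u v : nabla A u v = nabla A v u + br A u v by rewrite -nabla_torsion addrC subrK.
rewrite (T y z) (T x y) (T z x) !nablaDr.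
rewrite (T x (br A y z)) (T y (br A z x)) (T z (br A x y)).
apply/rowP => j; rewrite !mxE; ring.
Qed.

(** The classical octahedron argument: four instances of the first Bianchi identity, reduced by the
    two skew symmetries, combine linearly. *)
Lemma curvature_pair x y z w :
  g (curvature A x y z) w = g (curvature A z w x) y.
Proof.
pose F a b c d := g (curvature A a b c) d.
have C a b c d : F a b c d = - F b a c d by rewrite /F curvatureC bformNl.
have K a b c d : F a b c d = - F a b d c.
  by rewrite /F curvature_skew (bformC mG).
have B a b c d : F a b c d + F b c a d + F c a b d = 0.
  by rewrite /F -!bformDl bianchi bform0l.
rewrite -/(F x y z w) -/(F z w x y).
have h1 := B x y z w; rewrite (C z x) in h1.
have h2 := B y z w x; rewrite (K y z w) (K z w y) (C w y) (K y w z) in h2.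
have h3 := B z w x y; rewrite (C w x) (K x w z) (K x z w) in h3.
have h4 := B w x y z; rewrite (C w x) (K x y w) in h4.
lra.
Qed.

End LeviCivita.

(** * Linear isometries that intertwine curvature tensors *)

Section Transport.
Variable R : realType.

(** Vectors are rows, so [a] maps the space of [B] to that of [A]. The dimensions are kept distinct
    and the inverse [b] is explicit, since [m = n] is a consequence. *)
Definition curv_iso n m (A : metric_algebra R n) (B : metric_algebra R m)
    (a : 'M[R]_(m, n)) (b : 'M[R]_(n, m)) :=
  [/\ a *m b = 1%:M, b *m a = 1%:M,
      gram B = a *m gram A *m a^T &
      forall x y z, curvature A (x *m a) (y *m a) (z *m a) = curvature B x y z *m a].

Lemma curv_iso_dim n m (A : metric_algebra R n) (B : metric_algebra R m) a b :
  curv_iso A B a b -> m = n.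
Proof.
by move=> [/mulmx1_min h1 /mulmx1_min h2 _ _]; apply/eqP; rewrite eqn_leq h1 h2.
Qed.

Lemma curv_iso_sym n m (A : metric_algebra R n) (B : metric_algebra R m) a b :
  curv_iso A B a b -> curv_iso B A b a.
Proof.
move=> [ab ba gB cv]; split=> // [|x y z].
  by rewrite gB !mulmxA ba mul1mx -mulmxA -trmx_mul ba trmx1 mulmx1.
have := cv (x *m b) (y *m b) (z *m b).
by rewrite -!mulmxA ba !mulmx1 => ->; rewrite -mulmxA ab mulmx1.
Qed.

Lemma bform_mul n m (G : 'M[R]_n) (a : 'M[R]_(m, n)) x y :
  bform (a *m G *m a^T) x y = bform G (x *m a) (y *m a).
Proof. by rewrite /bform trmx_mul !mulmxA. Qed.

Lemma curv_iso_ricci n m (A : metric_algebra R n) (B : metric_algebra R m) a b y z :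
  metric_alg A -> metric_alg B ->
  curv_iso A B a b -> ricci A (y *m a) (z *m a) = ricci B y z.
Proof.
move=> okA okB iso; have [ab ba _ cv] := iso.
have lin k (C : metric_algebra R k) (okC : metric_alg C) u v x :
    x *m lin1_mx (fun x => curvature C x u v) = curvature C x u v.
  pose fM := GRing.isLinear.Build _ _ _ _ (fun x => curvature C x u v)
    (fun a x y => curvatureP okC a x y u v).
  pose fL : {linear _ -> _} := HB.pack (fun x => curvature C x u v) fM.
  exact: (mul_rV_lin1 fL).
rewrite /ricci; set LA := lin1_mx _; set LB := lin1_mx _.
have E : a *m LA = LB *m a.
  apply/row_matrixP => i; rewrite !rowE !mulmxA /LA /LB (lin _ _ okA) (lin _ _ okB).
  exact: cv.
by rewrite -[LA]mul1mx -ba -mulmxA E mulmxA mxtrace_mulC mulmxA ab mul1mx.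
Qed.

(** The Koszul formula expresses the connection, hence the curvature, through bracket and metric
    only. *)
Lemma alg_iso_curv n (A B : metric_algebra R n) P :
  metric_alg A -> metric_alg B -> P \in unitmx ->
  gram B = P *m gram A *m P^T ->
  (forall x y, br A (x *m P) (y *m P) = br B x y *m P) ->
  curv_iso A B P (invmx P).
Proof.
move=> okA okB uP gB brE.
have mA : is_metric (gram A) by case: okA.
have nE x y : nabla A (x *m P) (y *m P) = nabla B x y *m P.
  apply: (bform_inj mA) => w; rewrite -[w](mulmxKV uP) -bform_mul -gB.
  by rewrite !koszul_nabla // /koszul !brE -!bform_mul -gB.
split=> [|||x y z]; rewrite ?mulmxV ?mulVmx //.
by rewrite /curvature !(brE, nE) !mulmxBl.
Qed.

End Transport.

(** * Isometries preserve the curvature tensor *)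

Section Isometry.
Variables (R : realType) (n m : nat).
Variables (A : metric_algebra R n) (B : metric_algebra R m).
Variables (G : lie_group R n) (P : 'M[R]_n) (H : lie_group R m) (Q : 'M[R]_m).
Variables (f : 'rV[R]_n -> 'rV[R]_m) (f' : 'rV[R]_m -> 'rV[R]_n).
Hypotheses (okA : metric_alg A) (okB : metric_alg B).
Hypotheses (isoA : lie_algebra_iso A G P) (isoB : lie_algebra_iso B H Q).
Hypotheses (sf : smooth f) (sf' : smooth f') (fK : cancel f f') (f'K : cancel f' f).
Hypothesis isom : forall p u v,
  left_invariant_metric B H Q (f p) ('d f p u) ('d f p v) =
  left_invariant_metric A G P p u v.

Local Notation LG := (left_invariant_field G).
Local Notation LH := (left_invariant_field H).

Let Cf k : Ck k f. Proof. exact: smooth_Ck. Qed.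
Let Cf' k : Ck k f'. Proof. exact: smooth_Ck. Qed.

(* The pullback along f of a left-invariant frame of H, and its components
   [ac] in the left-invariant frame of G. *)
Let Fd (u : 'rV[R]_m) (p : 'rV[R]_n) : 'rV[R]_n := 'd f' (f p) (LH (u *m Q) (f p)).
Let ac p u : 'rV[R]_n := 'd (gmul G (ginv G p)) p (Fd u p) *m invmx P.

Let uP : P \in unitmx. Proof. by case: isoA. Qed.
Let uQ : Q \in unitmx. Proof. by case: isoB. Qed.

Let Ck_mulr k l (U : normedModType R) (w : U -> 'rV[R]_k) (M : 'M[R]_(k, l)) :
  Ck 2 w -> Ck 2 (fun p => w p *m M).
Proof.
move=> Hw; rewrite (_ : (fun p => _) = fun p => \sum_i w p 0 i *: row i M).
  apply: Ck_sum => i; apply: CkZ; last exact: Ck_cst.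
  apply: (@Ck_linl _ _ _ _ _ (fun u : 'rV_k => u 0 i)) => //.
    by move=> a u v; rewrite !mxE.
  exact: coord_continuous.
by apply/funext => p; rewrite mulmx_sum_row.
Qed.

Let Ck_Fd u : Ck 2 (Fd u).
Proof.
have C : Ck 2 (fun q => 'd f' q (LH (u *m Q) q)).
  exact: (Ck_diff_app (@finite_frame_rV R m) (Cf' 3) (Ck_id 2 _) (Ck_field H 2 (u *m Q))).
exact: (Ck_comp (@finite_frame_rV R m) (Cf 2) C).
Qed.

Let Ck_ac u : Ck 2 (fun p => ac p u).
Proof. by apply: Ck_mulr; exact: Ck_coframe_app. Qed.

Let field_ac u p : LG (ac p u *m P) p = Fd u p.
Proof. by rewrite /ac mulmxKV // field_inv_coframe. Qed.

Let FdP a u v p : Fd (a *: u + v) p = a *: Fd u p + Fd v p.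
Proof. by rewrite /Fd mulmxDl -scalemxAl left_invariant_fieldP; exact: linearP. Qed.

Let acP p a u v : ac p (a *: u + v) = a *: ac p u + ac p v.
Proof.
rewrite /ac FdP.
by rewrite (linearP ('d (gmul G (ginv G p)) p)) mulmxDl -scalemxAl.
Qed.

Let Fd_bracket u v p : field_bracket (Fd u) (Fd v) p = Fd (br B u v) p.
Proof.
have rel w q : 'd f' q (LH (w *m Q) q) = Fd w (f' q) by rewrite /Fd f'K.
have D w q : differentiable (Fd w) q := Ck_diff q (Ck_Fd w).
have DL w q : differentiable (LH w) q := Ck_diff q (Ck_field H 0 w).
have := @field_bracket_related _ _ _ f' (LH (u *m Q)) (LH (v *m Q)) (Fd u) (Fd v)
  (f p) (Cf' 1) (DL _ _) (DL _ _) (D _ _) (D _ _) (rel u) (rel v).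
rewrite fK => <-.
have [_ brE] := isoB; rewrite /Fd -brE.
by rewrite (field_bracket_left H (u *m Q) (v *m Q) (f p)).
Qed.

Let dd u (k : nat) (phi : 'rV[R]_n -> 'rV[R]_k) p := 'd phi p (Fd u p).

Let dd_comm k u v (phi : 'rV[R]_n -> 'rV[R]_k) p : Ck 1 phi ->
  dd u (dd v phi) p - dd v (dd u phi) p = dd (br B u v) phi p.
Proof.
move=> Hp.
have E a b : dd a (dd b phi) p = 'd (fun q => 'd phi q (Fd b p)) p (Fd a p) +
    'd phi p ('d (Fd b) p (Fd a p)).
  have [_ /funeqP/(_ (Fd a p))] := is_diff_diff (@finite_frame_rV R n) Hp
    (is_diff_id p) (differentiableP (Ck_diff p (Ck_Fd b))).
  exact.
have S := diff_sym_rV p (Fd v p) (Fd u p) Hp.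
have aux (a b c d x : 'rV[R]_k) : a = c -> b - d = x -> a + b - (c + d) = x.
  by move=> -> <-; rewrite opprD addrACA subrr add0r.
rewrite !E; apply: (aux _ _ _ _ _ S).
apply: etrans (esym (linearB _ _ _)) _.
by rewrite /dd -Fd_bracket.
Qed.

(** The structure equation of the pulled-back frame: the bracket of two fields with variable
    components in a left-invariant frame is the algebraic bracket of the components plus the
    derivatives of the components along each other. *)
Let ac_bracket u v p :
  ac p (br B u v) = br A (ac p u) (ac p v) + dd u (ac ^~ v) p - dd v (ac ^~ u) p.
Proof.
have LI (x y : 'rV[R]_n) : LG (x *m P) p = LG (y *m P) p -> x = y.
  move=> e; apply: (can_inj (mulmxK uP)).
  by rewrite -(field_invK G (x *m P) p) e field_invK.
apply: LI; rewrite field_ac.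
have lm : linear (fun x : 'rV[R]_n => x *m P).
  by move=> a x y; rewrite mulmxDl scalemxAl.
have cm : continuous (fun x : 'rV[R]_n => x *m P).
  have := Ck_diff _ (Ck_mulr P (Ck_id 2 ('rV[R]_n : normedModType R))) => D x.
  exact: (differentiable_continuous (D x)).
have Dac w := differentiableP (Ck_diff p (Ck_ac w)).
have DacP w : is_diff p (fun q => ac q w *m P) (fun v => 'd (ac ^~ w) p v *m P).
  have D0 y := Ck_diff y (Ck_lin_fun 0 lm cm).
  apply: DiffDef; first exact: (differentiable_comp (Ck_diff p (Ck_ac w)) (D0 _)).
  apply/funext => t.
  exact: etrans (diff_compv t (Ck_diff p (Ck_ac w)) (D0 _)) (diff_lin_fun _ _ lm cm).
have dF w t : 'd (Fd w) p t = 'd (LG (ac p w *m P)) p t + LG (('d (ac ^~ w) p t) *m P) p.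
  have [_ /funeqP/(_ t) E] := diff_field_app G (DacP w).
  rewrite (_ : (fun q => _) = Fd w) in E; first exact: E.
  by apply/funext => q; exact: field_ac.
have LB x y : LG (x + y) p = LG x p + LG y p.
  by rewrite -[x in LHS]scale1r left_invariant_fieldP scale1r.
have LN x : LG (- x) p = - LG x p.
  by apply: (addrI (LG x p)); rewrite -LB !subrr; exact: linear0.
have [_ brE] := isoA.
rewrite !mulmxDl mulNmx LB LB LN -brE.
have e := field_bracket_left G (ac p u *m P) (ac p v *m P) p.
rewrite /field_bracket !field_ac in e.
have aux (x1 x2 x3 x4 a : 'rV[R]_n) : x1 - x3 = a -> x1 + x2 - (x3 + x4) = a + x2 - x4.
  by move=> <-; rewrite opprD addrACA addrA.
apply: etrans (esym (Fd_bracket u v p)) _.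
apply: etrans (congr2 (fun x y => x - y) (dF v (Fd u p)) (dF u (Fd v p))) _.
exact: (aux _ _ _ _ _ e).
Qed.

Let diff_fK p w : 'd f' (f p) ('d f p w) = w.
Proof.
have E := diff_compv w (Ck_diff p (Cf 0)) (Ck_diff _ (Cf' 0)).
apply: etrans (esym E) _.
rewrite (_ : (fun y => _) = id); last exact/funext.
by have [_ ->] := is_diff_id p.
Qed.

Let diff_f'K p w : 'd f p ('d f' (f p) w) = w.
Proof.
have Hf : differentiable f (f' (f p)) := Ck_diff _ (Cf 0).
have E := diff_compv w (Ck_diff (f p) (Cf' 0)) Hf.
rewrite fK in E; apply: etrans (esym E) _.
rewrite (_ : (fun y => _) = id); last exact/funext.
by have [_ ->] := is_diff_id (f p).
Qed.

Let bc p w : 'rV[R]_m :=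
  'd (gmul H (ginv H (f p))) (f p) ('d f p (LG (w *m P) p)) *m invmx Q.

Let acK p u : bc p (ac p u) = u.
Proof. by rewrite /bc field_ac /Fd diff_f'K field_invK mulmxK. Qed.

Let bcK p w : ac p (bc p w) = w.
Proof.
by rewrite /ac /Fd /bc mulmxKV // field_inv_coframe diff_fK field_invK mulmxK.
Qed.

Let ac_metric p u v : bform (gram A) (ac p u) (ac p v) = bform (gram B) u v.
Proof.
have := isom p (Fd u p) (Fd v p).
rewrite /left_invariant_metric -/(ac p u) -/(ac p v) => <-.
by rewrite /Fd !diff_f'K !field_invK !mulmxK.
Qed.

Local Notation gA := (bform (gram A)).
Local Notation gB := (bform (gram B)).
Let mA : is_metric (gram A). Proof. by case: okA. Qed.

Let dd_metric p w u v :
  gA (dd w (ac ^~ u) p) (ac p v) + gA (ac p u) (dd w (ac ^~ v) p) = 0.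
Proof.
have Dac x := differentiableP (Ck_diff p (Ck_ac x)).
(* The scalar product is read as a row vector of length 1 to fit [is_diff_bilinear]; its derivative
   vanishes because [ac_metric] makes it constant in the point. *)
have l1 y : linear ((fun a b => (gA a b)%:M : 'rV[R]_1) ^~ y).
  by move=> a x z; rewrite bformDl bformZl; apply/rowP => j; rewrite ord1 !mxE /= !mulr1n.
have l2 y : linear ((fun a b => (gA a b)%:M : 'rV[R]_1) y).
  by move=> a x z; rewrite bformDr bformZr; apply/rowP => j; rewrite ord1 !mxE /= !mulr1n.
have [_ /funeqP/(_ (Fd w p))] := is_diff_bilinear l1 l2 (Dac u) (Dac v).
rewrite (_ : (fun y => _) = cst (gB u v)%:M); last first.
  by apply/funext => q; rewrite /= ac_metric.
have [_ ->] := is_diff_cst ((gB u v)%:M : 'rV[R]_1) p.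
by move=> /rowP/(_ 0); rewrite !mxE /= !mulr1n addrC => <-.
Qed.

(** An isometry preserves the Levi-Civita connection, written in components: the covariant
    derivative on G of one pulled-back field along another has the components predicted by
    [nabla B]. *)
Let dd_ac p u v :
  dd u (ac ^~ v) p = ac p (nabla B u v) - nabla A (ac p u) (ac p v).
Proof.
pose S x y := dd x (ac ^~ y) p + nabla A (ac p x) (ac p y) - ac p (nabla B x y).
have acD x y : ac p (x + y) = ac p x + ac p y by rewrite -[x in LHS]scale1r acP scale1r.
have acN x : ac p (- x) = - ac p x.
  apply: (addrI (ac p x)); rewrite -acD !subrr.
  by apply: (addrI (ac p 0)); rewrite -acD !addr0.
have Ssym x y : S x y = S y x.
  apply/eqP; rewrite -subr_eq0 /S.
  have e1 := ac_bracket x y p.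
  rewrite -(nabla_torsion okB) -(nabla_torsion okA) acD acN in e1.
  move: e1.
  move: (ac p (nabla B x y)) (ac p (nabla B y x)) (dd _ _ _) (dd _ _ _).
  move: (nabla A _ _) (nabla A _ _) => a1 a2 a3 a4 a5 a6 /rowP e.
  apply/eqP/rowP => j; have := e j; rewrite !mxE => ej; lra.
have Sskew x y z : gA (S x y) (ac p z) + gA (ac p y) (S x z) = 0.
  rewrite /S !bformE.
  have := dd_metric p x y z; have := nabla_metric okA (ac p x) (ac p y) (ac p z).
  have := nabla_metric okB x y z; rewrite -!(ac_metric p); lra.
have S0 x y : S x y = 0.
  apply: (bform_nondeg mA) => w; rewrite -(bcK p w).
  move: (bc p w) => {w} z.
  have T1 a b c : gA (S a b) (ac p c) = - gA (S a c) (ac p b).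
    by apply/eqP; rewrite -addr_eq0 (bformC mA (S a c)) Sskew.
  have e1 := T1 x y z; rewrite (Ssym x z) (T1 z x y) (Ssym z y) (T1 y z x) (Ssym y x) in e1.
  lra.
apply/eqP; rewrite -subr_eq0 opprB addrA.
by rewrite -(S0 u v) /S addrAC.
Qed.

(** The commutator of the derivatives along two pulled-back fields is the derivative along their
    bracket; applied to the components of a third field and rewritten with [dd_ac], this becomes the
    equality of the two curvatures. *)
Let curvature_ac p u v w :
  curvature A (ac p u) (ac p v) (ac p w) = ac p (curvature B u v w).
Proof.
have acD x y : ac p (x + y) = ac p x + ac p y by rewrite -[x in LHS]scale1r acP scale1r.
have acN x : ac p (- x) = - ac p x.
  apply: (addrI (ac p x)); rewrite -acD !subrr.
  by apply: (addrI (ac p 0)); rewrite -acD !addr0.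
have Dac q x := differentiableP (Ck_diff q (Ck_ac x)).
have l1 y : linear (nabla A ^~ y) by move=> a x z; rewrite nablaP.
have l2 y : linear (nabla A y) by move=> a x z; rewrite nablaPr.
have second x y : dd x (dd y (ac ^~ w)) p =
    dd x (ac ^~ (nabla B y w)) p -
    (nabla A (ac p y) (dd x (ac ^~ w) p) + nabla A (dd x (ac ^~ y) p) (ac p w)).
  rewrite {1}/dd (_ : dd y (ac ^~ w) =
    (fun q => ac q (nabla B y w)) - (fun q => nabla A (ac q y) (ac q w))).
    have H2 := is_diff_bilinear l1 l2 (Dac p y) (Dac p w).
    have [_ /funeqP/(_ (Fd x p)) E] := is_diffB (Dac p (nabla B y w)) H2.
    exact: E.
  by apply/funext => q; rewrite dd_ac.
have C := dd_comm u v p (CkW (Ck_ac w)).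
rewrite !second !dd_ac in C.
rewrite /curvature !acD !acN.
move: C; rewrite -(nabla_torsion okB u v) -!(nabla_torsion okA (ac p u)).
have bC : nabla B (nabla B u v - nabla B v u) w = nabla B (nabla B u v) w - nabla B (nabla B v u) w.
  by rewrite nablaDl // nablaNl.
rewrite !acD !acN ?bC ?acD ?acN ?(nablaDl okA) ?(nablaDr okA) ?(nablaNl okA) ?(nablaNr okA).
rewrite ?acD ?acN => C.
apply/rowP => j; move/rowP/(_ j): C; rewrite !mxE => C; lra.
Qed.

(** The components at the identity of G are used, while the frame on H is taken at [f (gone G)].
    Left invariance makes this as good as the identity of H, so [f] does not have to be
    normalized. *)
Lemma isometry_curv_iso : exists a b, curv_iso A B a b.
Proof.
have la : linear (ac (gone G)) by move=> c x y; exact: acP.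
pose laM := GRing.isLinear.Build _ _ _ _ (ac (gone G)) la.
pose laL : {linear _ -> _} := HB.pack (ac (gone G)) laM.
have lb : linear (bc (gone G)).
  move=> c x y; rewrite /bc mulmxDl -scalemxAl left_invariant_fieldP.
  rewrite (linearP ('d f (gone G))).
  by rewrite (linearP ('d (gmul H (ginv H (f (gone G)))) (f (gone G)))) mulmxDl -scalemxAl.
pose lbM := GRing.isLinear.Build _ _ _ _ (bc (gone G)) lb.
pose lbL : {linear _ -> _} := HB.pack (bc (gone G)) lbM.
have aE x : x *m lin1_mx (ac (gone G)) = ac (gone G) x by exact: (mul_rV_lin1 laL).
have bE x : x *m lin1_mx (bc (gone G)) = bc (gone G) x by exact: (mul_rV_lin1 lbL).
exists (lin1_mx (ac (gone G))), (lin1_mx (bc (gone G))); split.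
- by apply/row_matrixP => i; rewrite !rowE mulmxA aE bE acK mulmx1.
- by apply/row_matrixP => i; rewrite !rowE mulmxA bE aE bcK mulmx1.
- have bfE k (M N : 'M[R]_k) : (forall x y, bform M x y = bform N x y) -> M = N.
    move=> E; apply/matrixP => i j; have := E (delta_mx 0 i) (delta_mx 0 j).
    by rewrite /bform !trmx_delta -!rowE -!colE !mxE.
  by apply: bfE => x y; rewrite bform_mul !aE ac_metric.
- by move=> x y z; rewrite !aE curvature_ac.
Qed.

End Isometry.

Lemma isometric_curv_iso (R : realType) n m (A : metric_algebra R n) (B : metric_algebra R m) :
  metric_alg A -> metric_alg B -> isometric_solvmanifolds A B ->
  exists a b, curv_iso A B a b.
Proof.
move=> okA okB [G [P [H [Q [isoA isoB [f [f' [sf sf' fK f'K isom]]]]]]]].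
exact: (isometry_curv_iso okA okB isoA isoB sf sf' fK f'K isom).
Qed.

(** * Positive definite forms and the curvature operator *)

Section PositiveDefinite.
Variable R : realType.

Definition posdef n (S : 'M[R]_n) :=
  S^T = S /\ forall x : 'rV[R]_n, x != 0 -> 0 < bform S x x.

(** By induction on the size, splitting off the first row and column; the remaining block is the
    Schur complement [D']. *)
Lemma cholesky n (S : 'M[R]_n) : posdef S ->
  exists2 T : 'M[R]_n, T \in unitmx & S = T *m T^T.
Proof.
elim: n S => [|n IH] S [symS posS].
  by exists 1%:M; [exact: unitmx1|apply/matrixP => -[]].
move: S symS posS; rewrite -[n.+1]/(1 + n)%N => S symS posS.
set a := S 0 0; pose c : 'cV[R]_n := dlsubmx S; pose D := drsubmx S.
have ulE : ulsubmx S = a%:M.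
  by rewrite [ulsubmx S]mx11_scalar !mxE; congr (S _ _)%:M; exact: val_inj.
have urE : ursubmx S = c^T by rewrite /c trmx_dlsub symS.
have DT : D^T = D by rewrite /D trmx_drsub symS.
have SE : S = block_mx a%:M c^T c D by rewrite -[LHS]submxK ulE urE.
have bf t (y : 'rV_n) : bform S (row_mx t%:M y) (row_mx t%:M y) =
   a * t ^+ 2 + 2 * t * (y *m c) 0 0 + bform D y y.
  rewrite /bform {1}SE mul_row_block tr_row_mx mul_row_col tr_scalar_mx.
  rewrite mul_scalar_mx mul_scalar_mx !mulmxDl -!scalemxAl !mul_mx_scalar.
  rewrite -[c^T *m y^T]trmx_mul !mxE eqxx !mulr1n; ring.
have a0 : 0 < a.
  have := posS (row_mx 1%:M 0).
  rewrite bf /bform !mul0mx !mxE expr1n !mulr1 mulr0 !addr0; apply.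
  by apply/eqP => /rowP/(_ (lshift n 0)); rewrite row_mxEl !mxE => /eqP; rewrite oner_eq0.
have an0 : a != 0 by rewrite gt_eqF.
pose D' := D - a^-1 *: (c *m c^T).
have posD' : posdef D'.
  split=> [|y y0]; first by rewrite /D' linearB linearZ /= trmx_mul trmxK DT.
  (* This first coordinate minimizes the form for given [y]; the minimum is the value of the Schur
     complement at [y]. *)
  have := posS (row_mx (- (a^-1 * (y *m c) 0 0))%:M y).
  rewrite bf (_ : bform D' y y = bform D y y - a^-1 * (y *m c) 0 0 ^+ 2); last first.
    have e : (y *m (c *m c^T) *m y^T) 0 0 = (y *m c) 0 0 ^+ 2.
      by rewrite mulmxA -mulmxA -trmx_mul mxE big_ord1 [X in _ * X]mxE expr2.
    rewrite /bform /D' mulmxBr mulmxBl -scalemxAr -scalemxAl -e.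
    by rewrite mxE [X in _ + X]mxE [X in - X]mxE.
  have nz : row_mx (- (a^-1 * (y *m c) 0 0))%:M y != 0.
    by apply: contraNneq y0 => e; rewrite -(row_mxKr (- (a^-1 * (y *m c) 0 0))%:M y) e linear0.
  move=> /(_ nz); set lhs := (X in 0 < X -> _).
  rewrite (_ : lhs = bform D y y - a^-1 * (y *m c) 0 0 ^+ 2) // /lhs.
  by field.
have [T uT D'E] := IH _ posD'.
have s0 : Num.sqrt a != 0 by rewrite gt_eqF ?sqrtr_gt0.
have ss : Num.sqrt a * Num.sqrt a = a by rewrite -expr2 sqr_sqrtr ?ltW.
exists (block_mx (Num.sqrt a)%:M 0 ((Num.sqrt a)^-1 *: c) T).
  by rewrite unitmxE det_lblock det_scalar1 unitrM -unitmxE uT unitfE s0.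
rewrite {1}SE tr_block_mx mulmx_block tr_scalar_mx trmx0 !mul0mx !mulmx0 !addr0.
rewrite -scalar_mxM ss linearZ /= mul_scalar_mx mul_mx_scalar !scalerA divff // !scale1r.
rewrite -D'E -scalemxAl -scalemxAr scalerA -invfM ss /D'.
by congr block_mx; rewrite addrC subrK.
Qed.

Lemma trace_sq_sym n (M : 'M[R]_n) : M^T = M -> \tr (M *m M) = \sum_i \sum_j M i j ^+ 2.
Proof.
move=> sM; apply: eq_bigr => i _; rewrite mxE; apply: eq_bigr => j _.
by rewrite -{2}sM mxE expr2.
Qed.

(* M is self-adjoint for a positive definite form, hence conjugate to a
   symmetric matrix, whose square has the sum of its squared entries as trace. *)
Lemma trace_sq_selfadjoint n (S M : 'M[R]_n) mu :
  posdef S -> (M *m S)^T = M *m S ->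
  \tr ((M - mu%:M) *m (M - mu%:M)) <= 0 -> M = mu%:M.
Proof.
move=> /cholesky [T uT SE] sMS tr0.
pose M' := invmx T *m (M - mu%:M) *m T.
have sM' : M'^T = M'.
  have sNS : ((M - mu%:M) *m S)^T = (M - mu%:M) *m S.
    rewrite mulmxBl linearB /= sMS; congr (_ - _).
    by rewrite mul_scalar_mx linearZ /= SE trmx_mul trmxK.
  move: (M - mu%:M) sNS @M' => N; rewrite SE => sNS M'.
  have e : T *m T^T *m N^T = N *m T *m T^T.
    by rewrite -[RHS]mulmxA -sNS !trmx_mul trmxK.
  have uTT : T^T \in unitmx by rewrite unitmx_tr.
  have e2 : T^T *m N^T = invmx T *m N *m T *m T^T.
    by rewrite -[LHS](mulKmx uT) (mulmxA T) e !mulmxA.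
  by rewrite /M' !trmx_mul trmx_inv mulmxA e2 mulmxK.
have trE : \tr (M' *m M') = \tr ((M - mu%:M) *m (M - mu%:M)).
  by rewrite /M' -!mulmxA mxtrace_mulC !mulmxA !(mulmxK uT).
have M'0 : M' = 0.
  apply/matrixP => i j; rewrite [RHS]mxE.
  have H : \sum_i \sum_j M' i j ^+ 2 = 0.
    apply/eqP; rewrite eq_le -{1}trace_sq_sym // trE tr0.
    by apply: sumr_ge0 => k _; apply: sumr_ge0 => l _; exact: sqr_ge0.
  have Hi : \sum_j M' i j ^+ 2 = 0.
    apply: (psumr_eq0P _ H) => // k _; apply: sumr_ge0 => l _; exact: sqr_ge0.
  have : M' i j ^+ 2 = 0 by apply: (psumr_eq0P _ Hi) => // k _; exact: sqr_ge0.
  by move/eqP; rewrite sqrf_eq0 => /eqP.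
apply/eqP; rewrite -subr_eq0.
have -> : M - mu%:M = T *m M' *m invmx T.
  by rewrite /M' !mulmxA mulmxV // mul1mx mulmxK.
by rewrite M'0 mulmx0 mul0mx.
Qed.

(** A matrix stands for a tensor in V (x) V, and this is the form induced there by [P]. Bivectors
    are the antisymmetric tensors. *)
Definition bv_form n (P w w' : 'M[R]_n) := \sum_p \sum_q \sum_k \sum_l
  w p q * w' k l * P p k * P q l.

(** A factorization of [P] as [T *m T^T] turns the form into the sum of squares of the entries of
    [T^T *m w *m T]. *)
Lemma bv_form_pos n (P w : 'M[R]_n) : posdef P -> w != 0 -> 0 < bv_form P w w.
Proof.
move=> /cholesky [T uT ->] w0.
pose v := T^T *m w *m T.
have v0 : v != 0.
  apply: contraNneq w0 => e; have uTT : T^T \in unitmx by rewrite unitmx_tr.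
  by rewrite -[w](mulKmx uTT) -[_ *m w](mulmxK uT) -/v e mul0mx mulmx0.
have -> : bv_form (T *m T^T) w w = \sum_a \sum_b v a b ^+ 2.
  have vE a b : v a b = \sum_p \sum_q T p a * w p q * T q b.
    rewrite /v -mulmxA mxE; apply: eq_bigr => p _; rewrite !mxE mulr_sumr.
    by apply: eq_bigr => q _; rewrite mulrA.
  rewrite /bv_form.
  transitivity (\sum_p \sum_q \sum_k \sum_l \sum_a \sum_b
     (T p a * w p q * T q b) * (T k a * w k l * T l b)).
    apply: eq_bigr => p _; apply: eq_bigr => q _; apply: eq_bigr => k _; apply: eq_bigr => l _.
    rewrite [(T *m T^T) p k]mxE [(T *m T^T) q l]mxE -mulrA mulr_suml mulr_sumr.
    apply: eq_bigr => a _; rewrite !mulr_sumr; apply: eq_bigr => b _; rewrite !mxE; ring.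
  under eq_bigr do under eq_bigr do under eq_bigr do rewrite exchange_big.
  under eq_bigr do under eq_bigr do rewrite exchange_big.
  under eq_bigr do rewrite exchange_big.
  rewrite exchange_big; apply: eq_bigr => a _ /=.
  under eq_bigr do under eq_bigr do under eq_bigr do rewrite exchange_big.
  under eq_bigr do under eq_bigr do rewrite exchange_big.
  under eq_bigr do rewrite exchange_big.
  rewrite exchange_big; apply: eq_bigr => b _ /=.
  rewrite vE expr2 mulr_suml; apply: eq_bigr => p _.
  rewrite mulr_suml; apply: eq_bigr => q _.
  rewrite mulr_sumr; apply: eq_bigr => k _.
  by rewrite mulr_sumr.
rewrite lt_neqAle eq_sym; apply/andP; split.
  apply: contraNneq v0 => e; apply/eqP/matrixP => a b; rewrite [RHS]mxE.
  have e1 : \sum_b v a b ^+ 2 = 0.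
    apply: (psumr_eq0P _ e) => // k _; apply: sumr_ge0 => l _; exact: sqr_ge0.
  have : v a b ^+ 2 = 0 by apply: (psumr_eq0P _ e1) => // k _; exact: sqr_ge0.
  by move/eqP; rewrite sqrf_eq0 => /eqP.
by apply: sumr_ge0 => k _; apply: sumr_ge0 => l _; exact: sqr_ge0.
Qed.

End PositiveDefinite.

Section CartanInvolution.
Variable R : realType.

(** Only the curvature is required to be invariant, not the bracket, so that the notion can be
    carried along a [curv_iso]. The sign [s] allows g(x, phi x) to be positive or negative
    definite. *)
Definition cartan_involution n (A : metric_algebra R n) (phi : 'M[R]_n) (s : R) :=
  [/\ phi *m phi = 1%:M, phi *m gram A *m phi^T = gram A,
      forall x y z, curvature A (x *m phi) (y *m phi) (z *m phi) = curvature A x y z *m phi,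
      s * s = 1 &
      forall x, x != 0 -> 0 < s * bform (gram A) x (x *m phi)].

Definition pair_symmetric n (A : metric_algebra R n) := forall x y z w,
  bform (gram A) (curvature A x y z) w = bform (gram A) (curvature A z w x) y.

Lemma cartan_curv_iso n m (A : metric_algebra R n) (B : metric_algebra R m) a b phi s :
  curv_iso A B a b -> cartan_involution B phi s ->
  cartan_involution A (b *m phi *m a) s.
Proof.
move=> iso [pp gp cp ss pos].
have [_ _ gA cv'] := curv_iso_sym iso; have [ab ba gB cv] := iso; split=> //.
- by rewrite !mulmxA -(mulmxA (b *m phi)) ab mulmx1 -(mulmxA b) pp mulmx1.
- rewrite !trmx_mul !mulmxA.
  have -> : b *m phi *m a *m gram A *m a^T = b *m phi *m gram B by rewrite gB !mulmxA.
  by rewrite -(mulmxA b) -(mulmxA b) gp -gA.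
- by move=> x y z; rewrite !mulmxA cv cp cv'.
- move=> x x0; rewrite gA bform_mul !mulmxA -(mulmxA _ a) ab mulmx1; apply: pos.
  by apply: contraNneq x0 => e; rewrite -[x]mulmx1 -ba mulmxA e mul0mx.
Qed.

Lemma pair_curv_iso n m (A : metric_algebra R n) (B : metric_algebra R m) a b :
  curv_iso A B a b -> pair_symmetric B -> pair_symmetric A.
Proof.
move=> /curv_iso_sym [_ _ gA cv] sB x y z w.
by rewrite gA !bform_mul -!cv sB.
Qed.

Lemma bform_delta n (N : 'M[R]_n) p q : bform N (delta_mx 0 p) (delta_mx 0 q) = N p q.
Proof. by rewrite /bform trmx_delta -rowE -colE !mxE. Qed.

Lemma bform_sumE n (N : 'M[R]_n) x y :
  bform N x y = \sum_p \sum_q x 0 p * y 0 q * N p q.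
Proof.
rewrite {1}[x]row_sum_delta bform_suml; apply: eq_bigr => p _.
rewrite {1}[y]row_sum_delta bform_sumr; apply: eq_bigr => q _.
by rewrite bformZl bformZr bform_delta mulrA.
Qed.

Lemma bv_form_suml n k (P : 'M[R]_n) (w : 'I_k -> 'M[R]_n) (x : 'I_k -> R) w' :
  bv_form P (\sum_i x i *: w i) w' = \sum_i x i * bv_form P (w i) w'.
Proof.
rewrite /bv_form.
under [RHS]eq_bigr => i _.
  rewrite mulr_sumr; under eq_bigr do (rewrite mulr_sumr; under eq_bigr do
   (rewrite mulr_sumr; under eq_bigr do rewrite mulr_sumr)).
  over.
rewrite [RHS]exchange_big; apply: eq_bigr => p _.
rewrite [RHS]exchange_big; apply: eq_bigr => q _.
rewrite [RHS]exchange_big; apply: eq_bigr => r _.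
rewrite [RHS]exchange_big; apply: eq_bigr => l _.
rewrite summxE !mulr_suml; apply: eq_bigr => i _; rewrite mxE; ring.
Qed.

Lemma bv_formC n (P : 'M[R]_n) w w' : P^T = P -> bv_form P w w' = bv_form P w' w.
Proof.
move=> PT; have PC p q : P p q = P q p by rewrite -{1}PT mxE.
rewrite /bv_form.
under eq_bigr do rewrite exchange_big.
rewrite exchange_big; apply: eq_bigr => k _ /=.
under eq_bigr do rewrite exchange_big.
rewrite exchange_big; apply: eq_bigr => l _ /=.
apply: eq_bigr => p _; apply: eq_bigr => q _.
rewrite (PC p) (PC q); ring.
Qed.

(** The second condition on [w] says, with indices lowered, that the curvature operator maps the
    span of the [w i] to itself with matrix [M]. The Gram matrix [S] of these bivectors for the
    definite form makes [M] self-adjoint, and [trace_sq_selfadjoint] applies. *)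
Lemma cartan_curvature_eigen n (A : metric_algebra R n) phi s k
    (w : 'I_k -> 'M[R]_n) (M : 'M[R]_k) mu :
  metric_alg A -> pair_symmetric A -> cartan_involution A phi s ->
  (forall x : 'I_k -> R, \sum_i x i *: w i = 0 -> forall i, x i = 0) ->
  (forall i c d, \sum_p \sum_q w i p q *
      bform (gram A) (curvature A (delta_mx 0 p) (delta_mx 0 q) (delta_mx 0 c)) (delta_mx 0 d) =
    \sum_j M i j * \sum_p \sum_q w j p q * gram A p c * gram A q d) ->
  \tr ((M - mu%:M) *m (M - mu%:M)) <= 0 -> M = mu%:M.
Proof.
move=> okA sA [pp gp cp ss pos] free eigen.
have mG : is_metric (gram A) by case: okA.
have [uG GT] := mG.
set g := bform (gram A) in eigen *.
(* The Gram matrix of s g(x, phi y), positive definite by the choice of [s]. *)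
pose P := s *: (gram A *m phi^T).
have gd p c : g (delta_mx 0 p) (delta_mx 0 c) = gram A p c by exact: bform_delta.
have PE p q : P p q = s * g (delta_mx 0 p) (delta_mx 0 q *m phi).
  by rewrite mxE -bform_delta /g /bform trmx_mul !mulmxA.
have phiG : phi *m gram A = gram A *m phi^T.
  by rewrite -{2}gp -!mulmxA -trmx_mul pp trmx1 mulmx1.
have PT : P^T = P by rewrite /P linearZ /= trmx_mul trmxK GT phiG.
have posP : posdef P.
  split=> // x x0; have := pos x x0.
  suff -> : bform P x x = s * g x (x *m phi) by [].
  by rewrite /g /P /bform -scalemxAr -scalemxAl [LHS]mxE trmx_mul !mulmxA.
pose S := \matrix_(i, j) bv_form P (w i) (w j).
have bvr u (x : 'I_k -> R) : bv_form P u (\sum_i x i *: w i) = \sum_i x i * bv_form P u (w i).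
  by rewrite bv_formC // bv_form_suml; apply: eq_bigr => i _; rewrite bv_formC.
have posS : posdef S.
  split=> [|x x0]; first by apply/matrixP => i j; rewrite !mxE bv_formC.
  have -> : bform S x x = bv_form P (\sum_i x 0 i *: w i) (\sum_i x 0 i *: w i).
    rewrite bform_sumE bv_form_suml; apply: eq_bigr => i _.
    by rewrite bvr mulr_sumr; apply: eq_bigr => j _; rewrite mxE mulrA.
  apply: bv_form_pos => //; apply: contraNneq x0 => e; apply/eqP/rowP => i.
  by rewrite mxE (free _ e).
have cv0 a b x y : g (curvature A a b (\sum_c x c *: delta_mx 0 c)) (\sum_d y d *: delta_mx 0 d) =
    \sum_c \sum_d x c * y d * g (curvature A a b (delta_mx 0 c)) (delta_mx 0 d).
  rewrite (linear_sumZ _ _ (fun t u v => curvatureP3 okA t a b u v)).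
  rewrite /g bform_suml; apply: eq_bigr => c _.
  by rewrite bform_sumr; apply: eq_bigr => d _; rewrite bformZl bformZr mulrA.
have eigen' i x y : \sum_p \sum_q w i p q * g (curvature A (delta_mx 0 p) (delta_mx 0 q) x) y =
    \sum_j M i j * \sum_p \sum_q w j p q * g (delta_mx 0 p) x * g (delta_mx 0 q) y.
  rewrite [x]row_sum_delta [y]row_sum_delta.
  transitivity (\sum_c \sum_d x 0 c * y 0 d * \sum_p \sum_q w i p q *
      g (curvature A (delta_mx 0 p) (delta_mx 0 q) (delta_mx 0 c)) (delta_mx 0 d)).
    under eq_bigr do under eq_bigr do (rewrite cv0 mulr_sumr; under eq_bigr do rewrite mulr_sumr).
    under eq_bigr do rewrite exchange_big.
    rewrite exchange_big; apply: eq_bigr => c _ /=.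
    under eq_bigr do rewrite exchange_big.
    rewrite exchange_big; apply: eq_bigr => d _ /=.
    rewrite mulr_sumr; apply: eq_bigr => p _; rewrite mulr_sumr; apply: eq_bigr => q _; ring.
  under eq_bigr do under eq_bigr do (rewrite eigen mulr_sumr).
  under eq_bigr do rewrite exchange_big.
  rewrite exchange_big; apply: eq_bigr => j _ /=.
  transitivity (\sum_c \sum_d \sum_p \sum_q
      M i j * (w j p q * (x 0 c * gram A p c) * (y 0 d * gram A q d))).
    apply: eq_bigr => c _; apply: eq_bigr => d _.
    rewrite !mulr_sumr; apply: eq_bigr => p _; rewrite !mulr_sumr; apply: eq_bigr => q _; ring.
  under [LHS]eq_bigr do rewrite exchange_big.
  rewrite exchange_big mulr_sumr; apply: eq_bigr => p _ /=.
  under [LHS]eq_bigr do rewrite exchange_big.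
  rewrite exchange_big mulr_sumr; apply: eq_bigr => q _ /=.
  rewrite /g !bform_sumr -[w j p q * _ * _]mulrA mulr_suml !mulr_sumr.
  apply: eq_bigr => c _; rewrite !mulr_sumr; apply: eq_bigr => d _.
  rewrite !bformZr -/g !gd; ring.
(* Up to normalization by [s], this pairs the curvature operator applied to [u] with [v] in the
   definite form. It is symmetric because pair symmetry exchanges the two bivectors and the
   invariance of the curvature, together with [phi *m phi = 1], moves [phi] back. *)
pose Q (u v : 'M[R]_n) := \sum_k \sum_l v k l * \sum_p \sum_q u p q *
  g (curvature A (delta_mx 0 p) (delta_mx 0 q) (delta_mx 0 k *m phi)) (delta_mx 0 l *m phi).
have QC u v : Q u v = Q v u.
  rewrite /Q.
  transitivity (\sum_k \sum_l \sum_p \sum_q v k l * u p q *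
    g (curvature A (delta_mx 0 p) (delta_mx 0 q) (delta_mx 0 k *m phi)) (delta_mx 0 l *m phi)).
    apply: eq_bigr => a _; apply: eq_bigr => b _; rewrite mulr_sumr; apply: eq_bigr => p _.
    by rewrite mulr_sumr; apply: eq_bigr => q _; rewrite mulrA.
  under eq_bigr do rewrite exchange_big.
  rewrite exchange_big; apply: eq_bigr => p _ /=.
  under eq_bigr do rewrite exchange_big.
  rewrite exchange_big; apply: eq_bigr => q _ /=.
  rewrite mulr_sumr; apply: eq_bigr => a _; rewrite mulr_sumr; apply: eq_bigr => b _.
  rewrite mulrCA mulrA; congr (_ * _ * _).
  rewrite /g sA -[X in curvature A _ _ X]mulmx1 -pp mulmxA cp.
  by rewrite -{1}[delta_mx 0 q]mulmx1 -pp mulmxA -bform_mul gp.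
have QE i j : Q (w i) (w j) = (M *m S) i j.
  rewrite /Q; under eq_bigr do under eq_bigr do rewrite eigen' mulr_sumr.
  under eq_bigr do rewrite exchange_big.
  rewrite exchange_big mxE; apply: eq_bigr => t _ /=.
  rewrite mxE bv_formC // /bv_form mulr_sumr; apply: eq_bigr => a _.
  rewrite mulr_sumr; apply: eq_bigr => b _; rewrite mulrCA; congr (_ * _).
  rewrite mulr_sumr; apply: eq_bigr => p _; rewrite mulr_sumr; apply: eq_bigr => q _.
  have PC c d : P c d = P d c by rewrite -{1}PT mxE.
  rewrite (PC a) (PC b) !PE -[LHS]mul1r -ss; ring.
apply: (trace_sq_selfadjoint posS).
by apply/matrixP => i j; rewrite mxE -!QE QC.
Qed.

End CartanInvolution.

(** * Curvature in an orthogonal frame *)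

Section FrameAlgebra.
Variables (R : realType) (n : nat).
Implicit Types (C : 'I_n -> 'I_n -> 'I_n -> R) (g : 'I_n -> R).

Definition frame_alg C g : metric_algebra R n :=
  MetricAlgebra (fun x y : 'rV[R]_n => \row_k \sum_i \sum_j x 0 i * y 0 j * C i j k)
    (diag_mx (\row_i g i)).

Variables (C : 'I_n -> 'I_n -> 'I_n -> R) (g : 'I_n -> R).
Hypothesis C_alt : forall i j k, C i j k = - C j i k.
Hypothesis g_neq0 : forall i, g i != 0.
Local Notation F := (frame_alg C g).
Local Notation e i := (delta_mx 0 i : 'rV[R]_n).

Lemma frame_alg_metric : metric_alg F.
Proof.
split=> /= [a x y z|a x y z|x|].
- apply/rowP => k; rewrite !mxE mulr_sumr -big_split; apply: eq_bigr => i _ /=.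
  rewrite mulr_sumr -big_split; apply: eq_bigr => j _ /=; rewrite !mxE; ring.
- apply/rowP => k; rewrite !mxE mulr_sumr -big_split; apply: eq_bigr => i _ /=.
  rewrite mulr_sumr -big_split; apply: eq_bigr => j _ /=; rewrite !mxE; ring.
- apply/rowP => k; rewrite !mxE; set s := \sum_i _.
  suff : s = - s by lra.
  rewrite {1}/s exchange_big -sumrN; apply: eq_bigr => i _; rewrite -sumrN.
  by apply: eq_bigr => j _; rewrite C_alt; ring.
split; last by rewrite tr_diag_mx.
rewrite unitmxE det_diag unitfE prodf_seq_neq0; apply/allP => i _.
by rewrite mxE g_neq0.
Qed.

Lemma frame_br i j k : br F (e i) (e j) 0 k = C i j k.
Proof.
rewrite mxE (bigD1 i) //= (bigD1 j) //= !mxE !eqxx !mul1r !big1 ?addr0 //.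
  move=> i' ne; rewrite big1 // => j' _; rewrite !mxE /= (negbTE ne) !mul0r.
  by [].
by move=> j' ne; rewrite !mxE /= (negbTE ne) mulr0 mul0r.
Qed.

Lemma frame_form x y : bform (gram F) x y = \sum_i x 0 i * y 0 i * g i.
Proof.
rewrite /bform mxE; apply: eq_bigr => i _.
by rewrite mul_mx_diag !mxE mulrAC.
Qed.

Lemma frame_form_er x i : bform (gram F) x (e i) = x 0 i * g i.
Proof.
rewrite frame_form (bigD1 i) //= !mxE !eqxx mulr1 big1 ?addr0 // => j ne.
by rewrite mxE /= (negbTE ne) mulr0 mul0r.
Qed.

(** This is 2 g(nabla_{e_i} e_j, e_k), twice the Christoffel symbol with lowered index. *)
Definition chr2 i j k := C i j k * g k - C j k i * g i + C k i j * g j.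

Lemma frame_nabla i j k : nabla F (e i) (e j) 0 k = chr2 i j k / (2 * g k).
Proof.
have := koszul_nabla frame_alg_metric (e i) (e j) (e k).
rewrite frame_form_er /koszul !frame_form_er !frame_br -/(chr2 i j k) => E.
apply: (mulIf (g_neq0 k)); rewrite E /chr2.
by field; rewrite g_neq0.
Qed.

Lemma frame_nabla_sum i y k :
  nabla F (e i) y 0 k = \sum_m y 0 m * (chr2 i m k / (2 * g k)).
Proof.
rewrite {1}[y]row_sum_delta (linear_sumZ _ _ (fun a u v => nablaPr frame_alg_metric a u v (e i))).
by rewrite summxE; apply: eq_bigr => m _; rewrite mxE frame_nabla.
Qed.

Lemma frame_nabla_suml x i k :
  nabla F x (e i) 0 k = \sum_m x 0 m * (chr2 m i k / (2 * g k)).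
Proof.
rewrite {1}[x]row_sum_delta (linear_sumZ (f := fun x => nabla F x (e i)) _ _
  (fun a u v => nablaP frame_alg_metric a u v (e i))).
by rewrite summxE; apply: eq_bigr => m _; rewrite mxE frame_nabla.
Qed.

Lemma frame_curvature i j k l :
  bform (gram F) (curvature F (e i) (e j) (e k)) (e l) =
  \sum_m ((chr2 j k m * chr2 i m l - chr2 i k m * chr2 j m l) / (4 * g m)
          - C i j m * chr2 m k l / 2).
Proof.
have rowB (a b c : 'rV[R]_n) : (a - b - c) 0 l = a 0 l - b 0 l - c 0 l by rewrite !mxE.
have NN i' j' : nabla F (e i') (nabla F (e j') (e k)) 0 l =
    \sum_m chr2 j' k m / (2 * g m) * (chr2 i' m l / (2 * g l)).
  by rewrite frame_nabla_sum; apply: eq_bigr => m _; rewrite frame_nabla.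
have NB : nabla F (br F (e i) (e j)) (e k) 0 l =
    \sum_m C i j m * (chr2 m k l / (2 * g l)).
  by rewrite frame_nabla_suml; apply: eq_bigr => m _; rewrite frame_br.
have aux (a b c a' b' c' : R) : a = a' -> b = b' -> c = c' ->
    (a - b - c) * g l = (a' - b' - c') * g l by move=> -> -> ->.
rewrite frame_form_er /curvature rowB.
apply: etrans (aux _ _ _ _ _ _ (NN i j) (NN j i) NB) _.
rewrite -!sumrB mulr_suml; apply: eq_bigr => m _.
by field; rewrite !g_neq0.
Qed.

Lemma frame_ricci j k : ricci F (e j) (e k) =
  \sum_i bform (gram F) (curvature F (e i) (e j) (e k)) (e i) / g i.
Proof.
rewrite /ricci; apply: eq_bigr => i _.
by rewrite frame_form_er mulfK // !mxE.
Qed.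

End FrameAlgebra.

(** * Einstein extensions of nice nilsolitons *)

Section NiceRoots.
Variables (R : realType) (m : nat).
Variables (C : 'I_m -> 'I_m -> 'I_m -> R) (D : 'I_m -> 'I_m -> R).
Variables (eps : 'I_m -> R) (w : 'I_m -> nat) (c lambda : R).
Hypothesis m4 : (m <= 4)%N.
Hypothesis C_alt : forall i j k, C i j k = - C j i k.
Hypothesis nice_target : forall i j k k', C i j k != 0 -> C i j k' != 0 -> k = k'.
Hypothesis nice_source : forall i j j' k, C i j k != 0 -> C i j' k != 0 -> j = j'.
Hypothesis depth : forall i j k, C i j k != 0 -> (w j < w k)%N.
Hypothesis eps1 : forall i, eps i * eps i = 1.
Hypothesis D_sym : forall i j, D i j * eps j = D j i * eps i.
Hypothesis D_der : forall i j k, \sum_l C i j l * D l k =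
  \sum_l D i l * C l j k + \sum_l D j l * C i l k.
Hypothesis c0 : c != 0.
Hypothesis lambda0 : lambda != 0.
Hypothesis ric : forall j k, lambda * eps j *+ (j == k) =
  \sum_a \sum_b (4^-1 * (C a b j * eps j) * (C a b k * eps k)
     - 2^-1 * (C j a b * eps b) * (C k a b * eps b)) * (eps a * eps b)
  - (\sum_l D l l) * D j k * eps k / c.
Hypothesis ric0 : lambda * c = - \sum_a \sum_b D a b * D b a.

Let C_flip i j k : C i j k != 0 -> C j i k != 0.
Proof. by rewrite C_alt oppr_eq0. Qed.

Let depthl i j k : C i j k != 0 -> (w i < w k)%N.
Proof. by move/C_flip/depth. Qed.

Let Cii i k : C i i k = 0.
Proof. have := C_alt i i k; lra. Qed.

Let bracket_neq i j k : C i j k != 0 -> [/\ i != j, i != k & j != k].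
Proof.
move=> h; split.
- by apply: contraNneq h => ->; rewrite Cii.
- by apply: contraTneq (depthl h) => ->; rewrite ltnn.
- by apply: contraTneq (depth h) => ->; rewrite ltnn.
Qed.

(** The pigeonhole form in which the bound on the dimension enters. *)
Let five (a b d i j : 'I_m) : ~~ uniq [:: a; b; d; i; j].
Proof.
apply/negP => u; have := max_card [in [:: a; b; d; i; j]].
by rewrite (card_uniqP u) card_ord leqNgt ltnS m4.
Qed.

(** The Euclidean inner product of the root vectors e^d - e^a - e^b and e^k - e^i - e^j. *)
Let chi (i j k a b d : 'I_m) : R :=
  ((d == k)%:R - (a == k)%:R - (b == k)%:R) - ((d == i)%:R - (a == i)%:R - (b == i)%:R)
  - ((d == j)%:R - (a == j)%:R - (b == j)%:R).

(** The common argument [i] contributes 1. Among the five indices only j = d and k = b can coincide: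
    one of them must, contributing -1, and both together would make the depth [w] increase around a
    cycle. *)
Let chi_share i j k b d : C i j k != 0 -> C i b d != 0 -> b != j -> chi i j k i b d = 0.
Proof.
move=> h h' bj; have [ij ik jk] := bracket_neq h; have [ib id bd] := bracket_neq h'.
have dk : d != k.
  by apply: contraNneq bj => e; apply/eqP; rewrite e in h'; exact: (nice_source h' h).
rewrite /chi eqxx (negbTE dk) (negbTE ik) (negbTE ij) (negbTE bj).
rewrite [d == i]eq_sym (negbTE id) [b == i]eq_sym (negbTE ib).
have := five i j k b d; rewrite /= !inE !negb_or ij ik ib id jk bd /=.
rewrite [j == b]eq_sym bj [k == d]eq_sym dk /= andbT.
case: (eqVneq j d) => [e1|_]; case: (eqVneq k b) => [e2|_] //= _; try ring.
by have := depth h; have := depth h'; rewrite -e1 -e2 => x /(ltn_trans x); rewrite ltnn.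
Qed.

(** The situation is impossible: i, j, a, b exhaust the indices, so each bracket takes its value
    among the arguments of the other, against the growth of the depth. *)
Let chi_disjoint i j k a b d : C i j k != 0 -> C a b d != 0 ->
  [/\ a != i, a != j, b != i & b != j] -> chi i j k a b d = 0.
Proof.
move=> h h' [ai aj bi bj]; have [ij ik jk] := bracket_neq h; have [ab ad bd] := bracket_neq h'.
exfalso.
have kab : (k == a) || (k == b).
  have := five i j a b k; rewrite /= !inE !negb_or ij ik jk ab.
  rewrite ![i == _]eq_sym ![j == _]eq_sym ai aj bi bj /= andbT.
  by rewrite -negb_or negbK [a == k]eq_sym [b == k]eq_sym.
have dij : (d == i) || (d == j).
  have := five a b i j d; rewrite /= !inE !negb_or ij ad bd ab ai aj bi bj /= andbT.
  by rewrite -negb_or negbK [i == d]eq_sym [j == d]eq_sym.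
have wk : (w d < w k)%N.
  by case/orP: dij => /eqP ->; [exact: (depthl h)|exact: (depth h)].
have wd : (w k < w d)%N.
  by case/orP: kab => /eqP ->; [exact: (depthl h')|exact: (depth h')].
by have := ltn_trans wk wd; rewrite ltnn.
Qed.

Let chiC i j k a b d : chi i j k a b d = chi i j k b a d.
Proof. rewrite /chi; ring. Qed.

Let chiC' i j k a b d : chi i j k a b d = chi j i k a b d.
Proof. rewrite /chi; ring. Qed.

Let mu i j k := eps i * eps j * eps k * C i j k ^+ 2.

Let muC i j k : mu i j k = mu j i k.
Proof. rewrite /mu C_alt; ring. Qed.

(* Distinct roots of a nice nilpotent algebra of dimension at most 4 are
   orthogonal, and a root has squared length 3. *)
Let mu_chi i j k a b d : C i j k != 0 ->
  mu a b d * chi i j k a b d =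
  3 * mu i j k * (((a == i) && (b == j) && (d == k))%:R + ((a == j) && (b == i) && (d == k))%:R).
Proof.
move=> h; have [ij ik jk] := bracket_neq h.
have diag : chi i j k i j k = 3.
  rewrite /chi !eqxx (negbTE ik) (negbTE jk) (negbTE ij) [k == i]eq_sym (negbTE ik).
  by rewrite [k == j]eq_sym (negbTE jk) [j == i]eq_sym (negbTE ij) /=; ring.
case: (eqVneq (C a b d) 0) => [e|h'].
  have mu0 : mu a b d = 0 by rewrite /mu e expr0n mulr0.
  rewrite mu0 mul0r; apply/esym/eqP; rewrite mulf_eq0 orbC -implyNb; apply/implyP.
  rewrite -natrD pnatr_eq0 addn_eq0 !eqb0 negb_and !negbK => /orP[] /andP[/andP[/eqP ea /eqP eb] /eqP ed].
    by rewrite ea eb ed in mu0; rewrite mu0 mulr0.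
  by rewrite ea eb ed muC in mu0; rewrite mu0 mulr0.
case: (eqVneq a i) => [ea|ai].
  case: (eqVneq b j) => [eb|bj].
    have dk : d = k by rewrite ea eb in h'; exact: (nice_target h' h).
    by rewrite ea eb dk diag !eqxx (negbTE ij) /=; ring.
  by rewrite ea (negbTE ij) (chi_share h _ bj) ?mulr0 /= ?mulr0n ?addr0 ?mulr0 // -ea.
case: (eqVneq a j) => [ea|aj].
  case: (eqVneq b i) => [eb|bi].
    have dk : d = k by rewrite ea eb in h'; exact: (nice_target (C_flip h') h).
    by rewrite ea eb dk chiC diag muC !eqxx /=; ring.
  by rewrite ea chiC' (chi_share (C_flip h) _ bi) /= ?mulr0n ?addr0 ?mulr0 // -ea.
rewrite /= addr0 mulr0.
case: (eqVneq b i) => [eb|bi].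
  by rewrite chiC eb (chi_share h _ aj) ?mulr0 // -eb C_flip.
case: (eqVneq b j) => [eb|bj].
  by rewrite chiC chiC' eb (chi_share (C_flip h) _ ai) ?mulr0 // -eb C_flip.
by rewrite chi_disjoint ?mulr0.
Qed.

Let sum_delta (f : 'I_m -> R) k : \sum_d f d * (d == k)%:R = f k.
Proof.
rewrite (bigD1 k) //= eqxx mulr1 big1 ?addr0 // => d /negbTE ->.
by rewrite mulr0.
Qed.

Let rho i := \sum_a \sum_b (4^-1 * mu a b i - 2^-1 * mu i a b).

(** [rho] is the diagonal of the Ricci operator of the nilpotent algebra. In this form it is a
    combination of root vectors with weights [mu] / 4, as in the moment map description. *)
Let rhoE k : rho k = \sum_a \sum_b \sum_d
  4^-1 * mu a b d * ((d == k)%:R - (a == k)%:R - (b == k)%:R).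
Proof.
have e1 : \sum_a \sum_b \sum_d 4^-1 * mu a b d * (d == k)%:R = \sum_a \sum_b 4^-1 * mu a b k.
  by apply: eq_bigr => a _; apply: eq_bigr => b _; rewrite sum_delta.
have e2 : \sum_a \sum_b \sum_d 4^-1 * mu a b d * (a == k)%:R = \sum_a \sum_b 4^-1 * mu k a b.
  under eq_bigr do under eq_bigr do rewrite -mulr_suml.
  under eq_bigr do rewrite -mulr_suml.
  by rewrite sum_delta; apply: eq_bigr => a _; apply: eq_bigr => b _.
have e3 : \sum_a \sum_b \sum_d 4^-1 * mu a b d * (b == k)%:R = \sum_a \sum_b 4^-1 * mu k a b.
  apply: eq_bigr => a _; under eq_bigr do rewrite -mulr_suml.
  by rewrite sum_delta; apply: eq_bigr => b _; rewrite muC.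
transitivity (\sum_a \sum_b 4^-1 * mu a b k - \sum_a \sum_b 4^-1 * mu k a b
   - \sum_a \sum_b 4^-1 * mu k a b).
  rewrite -!sumrB; apply: eq_bigr => a _; rewrite -!sumrB; apply: eq_bigr => b _.
  by field.
rewrite -{1}e2 -e3 -e1 -!sumrB; apply: eq_bigr => a _; rewrite -!sumrB; apply: eq_bigr => b _.
by rewrite -!sumrB; apply: eq_bigr => d _; ring.
Qed.

(** By orthogonality only the root itself survives the pairing. It has squared length 3 and occurs
    twice, for (i, j) and (j, i), with weight 1/4. *)
Let rho_root i j k : C i j k != 0 -> rho k - rho i - rho j = 3 / 2 * mu i j k.
Proof.
move=> h; rewrite !rhoE -!sumrB.
transitivity (\sum_a \sum_b \sum_d 4^-1 * (mu a b d * chi i j k a b d)).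
  apply: eq_bigr => a _; rewrite -!sumrB; apply: eq_bigr => b _.
  by rewrite -!sumrB; apply: eq_bigr => d _; rewrite /chi; ring.
have dlt (x y z : 'I_m) : \sum_a \sum_b \sum_d ((a == x) && (b == y) && (d == z))%:R = 1 :> R.
  transitivity (\sum_a 1 * (a == x)%:R : R); last by rewrite sum_delta.
  apply: eq_bigr => a _; rewrite mul1r.
  transitivity (\sum_b (a == x)%:R * (b == y)%:R : R); last by rewrite sum_delta.
  apply: eq_bigr => b _; rewrite -natrM mulnb.
  transitivity (\sum_d ((a == x) && (b == y))%:R * (d == z)%:R : R); last by rewrite sum_delta.
  by apply: eq_bigr => d _; rewrite -natrM mulnb.
transitivity (4^-1 * 3 * mu i j k *
   ((\sum_a \sum_b \sum_d ((a == i) && (b == j) && (d == k))%:R) +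
    (\sum_a \sum_b \sum_d ((a == j) && (b == i) && (d == k))%:R))); last first.
  by rewrite !dlt; field.
rewrite -big_split mulr_sumr; apply: eq_bigr => a _.
rewrite -big_split mulr_sumr; apply: eq_bigr => b _ /=.
rewrite -big_split mulr_sumr; apply: eq_bigr => d _ /=.
by rewrite mu_chi // !mulrA.
Qed.

Let ric_diag j : lambda = rho j - (\sum_l D l l) * D j j / c.
Proof.
have := ric j j; rewrite eqxx mulr1n => /(congr1 (fun x => x * eps j)).
rewrite -mulrA eps1 mulr1 => ->; rewrite mulrBl; congr (_ - _); last first.
  by rewrite mulrAC -[_ * eps j * eps j]mulrA eps1 mulr1.
rewrite mulr_suml; apply: eq_bigr => a _; rewrite mulr_suml; apply: eq_bigr => b _.
transitivity (4^-1 * mu a b j * (eps j * eps j) - 2^-1 * mu j a b * (eps b * eps b)).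
  by rewrite /mu; ring.
by rewrite !eps1 !mulr1.
Qed.

(** In a nice basis the Ricci tensor of the nilpotent part has no off-diagonal terms, so off the
    diagonal the Einstein equation contains only tr D times [D]. *)
Let D_offdiag j k : \sum_l D l l != 0 -> j != k -> D j k = 0.
Proof.
move=> tr0 jk; have := ric j k; rewrite (negbTE jk) mulr0n big1 => [|a _].
  rewrite sub0r => /esym/eqP; rewrite oppr_eq0 !mulf_eq0 invr_eq0 (negbTE c0) (negbTE tr0) /= orbF.
  case/orP => [/eqP //|/eqP e]; have := eps1 k; rewrite e mul0r => /esym/eqP.
  by rewrite oner_eq0.
rewrite big1 // => b _.
have h1 : C a b j * C a b k = 0.
  apply/eqP; rewrite mulf_eq0; case: eqVneq => //= h1; case: eqVneq => //= h2.
  by move: jk; rewrite (nice_target h1 h2) eqxx.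
have h2 : C j a b * C k a b = 0.
  apply/eqP; rewrite mulf_eq0; case: eqVneq => //= h2; case: eqVneq => //= h3.
  by move: jk; rewrite (nice_source (C_flip h2) (C_flip h3)) eqxx.
transitivity ((4^-1 * (C a b j * C a b k) * eps j * eps k
   - 2^-1 * (C j a b * C k a b) * eps b * eps b) * (eps a * eps b)); first by ring.
by rewrite h1 h2; ring.
Qed.

(** Pairing [ric_diag] with the root gives - lambda on the left. The terms in [D] cancel, either
    because tr D = 0 or because [D] is then a diagonal derivation. *)
Let mu_lambda i j k : C i j k != 0 -> mu i j k = - (2 / 3) * lambda.
Proof.
move=> h; have e : (\sum_l D l l) * (D k k - D i i - D j j) = 0.
  case: (eqVneq (\sum_l D l l) 0) => [->|tr0]; first by rewrite mul0r.
  have := D_der i j k; rewrite (bigD1 k) //= big1 => [|l lk]; last first.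
    by rewrite (D_offdiag tr0 lk) mulr0.
  rewrite (bigD1 i) //= [\sum_(l | l != i) _]big1 => [|l li]; last first.
    by rewrite (D_offdiag tr0) ?mul0r // eq_sym.
  rewrite (bigD1 j) //= [\sum_(l | l != j) _]big1 => [|l lj]; last first.
    by rewrite (D_offdiag tr0) ?mul0r // eq_sym.
  rewrite !addr0 => E; apply/eqP; rewrite mulf_eq0; apply/orP; right.
  apply/eqP; apply: (mulfI h); rewrite mulr0; lra.
have := rho_root h; have := ric_diag i; have := ric_diag j; have := ric_diag k.
move=> e1 e2 e3 e4.
have E : (\sum_l D l l) * D k k / c - (\sum_l D l l) * D i i / c - (\sum_l D l l) * D j j / c = 0.
  by rewrite -!mulrBl -!mulrBr e mul0r.
lra.
Qed.

(** With tr D = 0 the constant equals [rho i] for every i. At a central basis vector [rho i] is a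
    sum of [mu] terms, each zero or a negative multiple of lambda, so lambda^2 <= 0. *)
Let trace_neq0 : \sum_l D l l != 0.
Proof.
apply/eqP => tr0.
have [i0|no] := pickP (fun _ : 'I_m => true); last first.
  have := ric0; rewrite big1 => [|a _]; last by have := no a.
  by move/eqP; rewrite oppr0 mulf_eq0 (negbTE lambda0) (negbTE c0).
move=> _.
(* A basis vector of maximal depth is central, since a nonzero bracket would lie deeper. *)
have [i _ wmax] := @arg_maxnP _ i0 xpredT w isT.
have Ci a b : C i a b = 0.
  apply/eqP; apply: contraT => h; have /= := wmax b isT.
  by rewrite leqNgt (depthl h).
have := ric_diag i; rewrite tr0 !mul0r subr0 => e.
have : 0 < lambda * lambda by rewrite -expr2 exprn_even_gt0.
rewrite {2}e /rho mulr_sumr ltNge; apply/negP/negPn.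
apply: sumr_le0 => a _; rewrite mulr_sumr; apply: sumr_le0 => b _.
rewrite {2}/mu Ci expr0n mulr0 mulr0 subr0.
case: (eqVneq (C a b i) 0) => [h|h]; first by rewrite /mu h expr0n !mulr0.
rewrite (mu_lambda h).
have : 0 <= lambda * lambda by rewrite -expr2 sqr_ge0.
lra.
Qed.

Lemma nice_derivation_diag j k : j != k -> D j k = 0.
Proof. exact: D_offdiag. Qed.

(** With [D] diagonal, the equation in the direction e_0 gives lambda c = - tr (D^2) < 0, and [mu]
    has the sign opposite to lambda. *)
Lemma nice_root_sign i j k : C i j k != 0 -> 0 < c * (eps i * eps j * eps k).
Proof.
move=> h; have lc : lambda * c < 0.
  rewrite lt_neqAle mulf_neq0 //= ric0 oppr_le0; apply: sumr_ge0 => a _.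
  apply: sumr_ge0 => b _; case: (eqVneq a b) => [->|ab]; first by rewrite -expr2 sqr_ge0.
  by rewrite (D_offdiag trace_neq0 ab) mul0r.
have : 0 < c * mu i j k by rewrite (mu_lambda h); lra.
rewrite /mu mulrA pmulr_lgt0 // exprn_even_gt0 //.
Qed.

End NiceRoots.

(** * Ricci tensor of a frame algebra and of the extension *)

Section FrameRicci.
Variables (R : realType) (n : nat).
Variables (C : 'I_n -> 'I_n -> 'I_n -> R) (g : 'I_n -> R).
Hypothesis C_alt : forall i j k, C i j k = - C j i k.
Hypothesis g_neq0 : forall i, g i != 0.
Local Notation F := (frame_alg C g).
Local Notation e i := (delta_mx 0 i : 'rV[R]_n).
Local Notation cl i j k := (C i j k * g k).

Lemma frame_ricciE j k : ricci F (e j) (e k) =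
  \sum_i \sum_m ((4^-1 * cl i m j * cl i m k - 2^-1 * cl j i m * cl k i m
     - 2^-1 * cl j i m * cl k m i) / (g i * g m)
   + chr2 C g j k m * C i m i / (2 * g m)).
Proof.
(* The summands on the two sides agree only after symmetrization in the two summation indices. *)
have sym (S T : 'I_n -> 'I_n -> R) : (forall i m, S i m + S m i = T i m + T m i) ->
    \sum_i \sum_m S i m = \sum_i \sum_m T i m.
  have ex (U : 'I_n -> 'I_n -> R) : \sum_i \sum_m U i m = \sum_i \sum_m U m i by rewrite exchange_big.
  move=> ST; have : \sum_i \sum_m S i m + \sum_i \sum_m S i m =
      \sum_i \sum_m T i m + \sum_i \sum_m T i m.
    rewrite {2}(ex S) {2}(ex T) -!big_split.
    by apply: eq_bigr => i _; rewrite -!big_split; apply: eq_bigr => m _; exact: ST.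
  lra.
rewrite frame_ricci //.
under eq_bigr do rewrite frame_curvature // mulr_suml.
apply: sym => i m.
have Cii x y : C x x y = 0 by have := C_alt x x y; lra.
rewrite /chr2 !Cii !(C_alt m i) !(C_alt i j) !(C_alt m j) !(C_alt i k) !(C_alt m k).
by field; rewrite !g_neq0.
Qed.

End FrameRicci.

Section ExtensionFrame.
Variables (R : realType) (m : nat).
Variables (C : 'I_m -> 'I_m -> 'I_m -> R) (D : 'I_m -> 'I_m -> R) (eps : 'I_m -> R) (c : R).

(* Index 0 is e_0. *)
Definition ext_struct (i j k : 'I_(1 + m)) : R :=
  match fintype.split i, fintype.split j, fintype.split k with
  | inl _, inr j, inr k => D j k
  | inr i, inl _, inr k => - D i k
  | inr i, inr j, inr k => C i j k
  | _, _, _ => 0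
  end.

Definition ext_gram (i : 'I_(1 + m)) : R :=
  match fintype.split i with inl _ => c | inr i => eps i end.

Local Notation l0 := (lshift m (0 : 'I_1)).
Local Notation r i := (rshift 1 i).

Let spl : fintype.split l0 = inl 0. Proof. exact: (unsplitK (inl 0)). Qed.
Let spr i : fintype.split (r i) = inr i :> 'I_1 + 'I_m. Proof. exact: (unsplitK (inr i)). Qed.

Lemma ext_structE :
  (forall j k, ext_struct l0 (r j) (r k) = D j k) *
  (forall j k, ext_struct (r j) l0 (r k) = - D j k) *
  (forall i j k, ext_struct (r i) (r j) (r k) = C i j k) *
  (forall i j, ext_struct i j l0 = 0) * (forall k, ext_struct l0 l0 k = 0).
Proof.
rewrite /ext_struct; do !split => *; rewrite ?spl ?spr //.
by case: (fintype.split _) => ?; case: (fintype.split _).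
Qed.

Lemma ext_gramE : (ext_gram l0 = c) * (forall i, ext_gram (r i) = eps i).
Proof. by rewrite /ext_gram; split => *; rewrite ?spl ?spr. Qed.

Lemma big_ext (f : 'I_(1 + m) -> R) : \sum_i f i = f l0 + \sum_i f (r i).
Proof. by rewrite big_split_ord big_ord1. Qed.

Hypothesis C_alt : forall i j k, C i j k = - C j i k.
Hypothesis eps1 : forall i, eps i * eps i = 1.
Hypothesis c0 : c != 0.

Let eps0 i : eps i != 0.
Proof. by apply: contra_eq_neq (eps1 i) => ->; rewrite mul0r eq_sym oner_eq0. Qed.

Let epsV i : (eps i)^-1 = eps i.
Proof. by apply: (mulfI (eps0 i)); rewrite mulfV // eps1. Qed.

Lemma ext_struct_alt i j k : ext_struct i j k = - ext_struct j i k.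
Proof.
case: (split_ordP i) => i' ->; case: (split_ordP j) => j' ->; case: (split_ordP k) => k' ->;
  rewrite ?(ord1 i') ?(ord1 j') ?(ord1 k') !ext_structE ?oppr0 ?opprK //.
Qed.

Lemma ext_gram_neq0 i : ext_gram i != 0.
Proof. by case: (split_ordP i) => i' ->; rewrite ?(ord1 i') !ext_gramE. Qed.

Local Notation F := (frame_alg ext_struct ext_gram).

Variable w : 'I_m -> nat.
Hypothesis depth : forall i j k, C i j k != 0 -> (w j < w k)%N.
Hypothesis D_sym : forall i j, D i j * eps j = D j i * eps i.

Let Ciji i j : C i j i = 0.
Proof.
apply: contraTeq isT => h; have h' : C j i i != 0 by rewrite C_alt oppr_eq0.
by have := depth h'; rewrite ltnn.
Qed.

(** The Killing form of the nilpotent part vanishes term by term, as the depth cannot increase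
    around a loop. *)
Let CC j k a b : C j a b * C k b a = 0.
Proof.
apply/eqP; rewrite mulf_eq0; case: eqVneq => //= h1; case: eqVneq => //= h2.
by have := ltn_trans (depth h1) (depth h2); rewrite ltnn.
Qed.

(** Symmetry of [D] makes the quadratic terms [Q] from the pairs (e_0, e_i) and (e_i, e_0) cancel,
    leaving the Ricci tensor of the nilpotent part and the term in tr D. *)
Lemma ext_ricci j k : ricci F (delta_mx 0 (r j)) (delta_mx 0 (r k)) =
  \sum_a \sum_b (4^-1 * (C a b j * eps j) * (C a b k * eps k)
     - 2^-1 * (C j a b * eps b) * (C k a b * eps b)) * (eps a * eps b)
  - (\sum_l D l l) * D j k * eps k / c.
Proof.
rewrite (frame_ricciE ext_struct_alt ext_gram_neq0).
pose cl a b d := ext_struct a b d * ext_gram d.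
pose S a b := (4^-1 * cl a b (r j) * cl a b (r k) - 2^-1 * cl (r j) a b * cl (r k) a b
     - 2^-1 * cl (r j) a b * cl (r k) b a) / (ext_gram a * ext_gram b)
   + chr2 ext_struct ext_gram (r j) (r k) b * ext_struct a b a / (2 * ext_gram b).
rewrite -[LHS]/(\sum_a \sum_b S a b).
pose Q i := (D i j * eps j) * (D i k * eps k) * eps i / c.
pose T a b := (4^-1 * (C a b j * eps j) * (C a b k * eps k)
     - 2^-1 * (C j a b * eps b) * (C k a b * eps b)) * (eps a * eps b).
have S00 : S l0 l0 = 0 by rewrite /S /cl /chr2 !ext_structE; ring.
have S0r i : S l0 (r i) = - (4^-1 * Q i).
  rewrite /S /cl /chr2 !ext_structE !ext_gramE /Q mulr0 mul0r addr0 mul0r mulr0 subr0.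
  transitivity ((4^-1 * (D i j * eps j) * (D i k * eps k) -
    2^-1 * (D j i * eps i) * (D k i * eps i)) / (c * eps i)).
    by congr (_ / _); ring.
  by rewrite -(D_sym i j) -(D_sym i k) invfM epsV; field.
have Sr0 i : S (r i) l0 = 4^-1 * Q i - D j k * eps k * D i i / c.
  rewrite /S /cl /chr2 !ext_structE !ext_gramE /Q !(mul0r, mulr0, subr0, add0r) [- D k j * eps j]mulNr (D_sym k j) invfM epsV.
  by field.
have Srr a b : S (r a) (r b) = T a b.
  rewrite /S /cl /chr2 !ext_structE !ext_gramE /T Ciji mulr0 mul0r addr0 invfM !epsV.
  rewrite [X in _ - X](_ : _ = 2^-1 * (C j a b * C k b a) * eps a * eps b); last by ring.
  by rewrite CC mulr0 !mul0r subr0.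
rewrite big_ext (big_ext (S l0)) S00 add0r.
under eq_bigr do rewrite S0r.
under [X in _ + X]eq_bigr do (rewrite big_ext Sr0; under eq_bigr do rewrite Srr).
rewrite [X in _ + X]big_split /= addrA sumrB sumrN addKr addrC; congr (_ + _).
rewrite -sumrN !mulr_suml -sumrN; apply: eq_bigr => l _; ring.
Qed.

Lemma ext_ricci0 : ricci F (delta_mx 0 l0) (delta_mx 0 l0) = - \sum_a \sum_b D a b * D b a.
Proof.
rewrite (frame_ricciE ext_struct_alt ext_gram_neq0).
pose cl a b d := ext_struct a b d * ext_gram d.
pose S a b := (4^-1 * cl a b l0 * cl a b l0 - 2^-1 * cl l0 a b * cl l0 a b
     - 2^-1 * cl l0 a b * cl l0 b a) / (ext_gram a * ext_gram b)
   + chr2 ext_struct ext_gram l0 l0 b * ext_struct a b a / (2 * ext_gram b).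
rewrite -[LHS]/(\sum_a \sum_b S a b).
have chr0 b : chr2 ext_struct ext_gram l0 l0 b = 0.
  case: (split_ordP b) => b' ->; rewrite ?(ord1 b') /chr2 !ext_structE; ring.
have S00 : S l0 l0 = 0 by rewrite /S /cl chr0 !ext_structE; ring.
have S0r i : S l0 (r i) = 0 by rewrite /S /cl chr0 !ext_structE; ring.
have Sr0 i : S (r i) l0 = 0 by rewrite /S /cl chr0 !ext_structE; ring.
have Srr a b : S (r a) (r b) = - (D a b * D b a).
  rewrite /S /cl chr0 !ext_structE !ext_gramE !(mul0r, mulr0, addr0, sub0r).
  have -> : D b a * eps a = D a b * eps b by rewrite D_sym.
  have -> : D b a = D a b * eps b / eps a by rewrite D_sym mulfK.
  by field; rewrite !eps0.
rewrite big_ext (big_ext (S l0)) S00 add0r big1 // add0r -sumrN; apply: eq_bigr => a _.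
by rewrite big_ext Sr0 add0r -sumrN; apply: eq_bigr => b _.
Qed.

End ExtensionFrame.

Section ExtensionCartan.
Variables (R : realType) (m : nat).
Variables (C : 'I_m -> 'I_m -> 'I_m -> R) (D : 'I_m -> 'I_m -> R) (eps : 'I_m -> R) (c : R).
Hypothesis C_alt : forall i j k, C i j k = - C j i k.
Hypothesis eps1 : forall i, eps i * eps i = 1.
Hypothesis c0 : c != 0.
Hypothesis D_diag : forall i j, i != j -> D i j = 0.
Hypothesis root_sign : forall i j k, C i j k != 0 -> 0 < c * (eps i * eps j * eps k).

Local Notation F := (frame_alg (ext_struct C D) (ext_gram eps c)).
Local Notation l0 := (lshift m (0 : 'I_1)).
Local Notation r i := (rshift 1 i).

Let s := Num.sg c.
(** The signs are forced: g(e_0, e_0) = c already has sign [s], and the factor [s * eps i] turns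
    g(e_i, e_i) = eps_i into [s]. The rule eps_i eps_j eps_k = [s] is then exactly compatibility
    with the brackets. *)
Let phi : 'rV[R]_(1 + m) := row_mx 1%:M (\row_i (s * eps i)).

Let phil : phi 0 l0 = 1. Proof. by rewrite row_mxEl mxE eqxx mulr1n. Qed.
Let phir i : phi 0 (r i) = s * eps i. Proof. by rewrite row_mxEr mxE. Qed.

Let ss : s * s = 1.
Proof. by rewrite /s -expr2 sqr_sg c0. Qed.

Let phi2 i : phi 0 i * phi 0 i = 1.
Proof.
case: (split_ordP i) => i' ->; first by rewrite (ord1 i') phil mulr1.
by rewrite phir mulrACA ss eps1 mulr1.
Qed.

Let root1 i j k : C i j k != 0 -> eps i * eps j * eps k = s.
Proof.
move=> /root_sign; set x := _ * eps k => h.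
have x2 : x * x = 1.
  transitivity ((eps i * eps i) * (eps j * eps j) * (eps k * eps k)); first by rewrite /x; ring.
  by rewrite !eps1 !mulr1.
have : s * Num.sg x = 1 by rewrite -sgrM gtr0_sg.
have : x = 1 \/ x = -1.
  have /eqP : (x - 1) * (x + 1) = 0 by rewrite mulrDr mulr1 mulrBl x2 mul1r; ring.
  rewrite mulf_eq0 subr_eq0 addr_eq0 => /orP[] /eqP; by [left|right].
by case=> ->; rewrite ?sgrN1 ?sgr1; lra.
Qed.

Let auto a b d : ext_struct C D a b d * phi 0 d = phi 0 a * phi 0 b * ext_struct C D a b d.
Proof.
have DD i k : D i k * (s * eps k) = s * eps i * D i k.
  by case: (eqVneq i k) => [->|ik]; [rewrite mulrC|rewrite (D_diag ik) mulr0 mul0r].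
case: (split_ordP a) => i ->; case: (split_ordP b) => j ->; case: (split_ordP d) => k ->;
  rewrite ?(ord1 i) ?(ord1 j) ?(ord1 k) !ext_structE ?mulr0 ?mul0r // ?phil ?phir.
- by rewrite mul1r DD.
- by rewrite mulr1 mulNr mulrN DD.
case: (eqVneq (C i j k) 0) => [->|/root1 h]; first by rewrite mulr0 mul0r.
have -> : s * eps k = eps i * eps j.
  by have /= := congr1 (fun x => x * eps k) h; rewrite -[LHS]mulrA eps1 mulr1.
by rewrite (mulrACA s) ss mul1r mulrC.
Qed.

Lemma ext_cartan : cartan_involution F (diag_mx phi) s.
Proof.
have okF : metric_alg F.
  by apply: frame_alg_metric => *; [exact: ext_struct_alt|exact: ext_gram_neq0].
have pp : diag_mx phi *m diag_mx phi = 1%:M.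
  rewrite mulmx_diag -diag_const_mx; congr diag_mx; apply/rowP => i; rewrite [LHS]mxE [RHS]mxE.
  exact: phi2.
have u : diag_mx phi \in unitmx by case/mulmx1_unit: pp.
have gF : gram F = diag_mx phi *m gram F *m (diag_mx phi)^T.
  rewrite tr_diag_mx !mulmx_diag; congr diag_mx; apply/rowP => i; rewrite [RHS]mxE.
  by rewrite [X in _ = X * _]mxE mulrAC phi2 mul1r.
have brF x y : br F (x *m diag_mx phi) (y *m diag_mx phi) = br F x y *m diag_mx phi.
  have dE (z : 'rV_(1 + m)) i : (z *m diag_mx phi) 0 i = z 0 i * phi 0 i.
    by rewrite mul_mx_diag mxE.
  apply/rowP => k; rewrite [RHS]dE [LHS]mxE [X in _ = X * _]mxE mulr_suml.
  apply: eq_bigr => i _; rewrite mulr_suml; apply: eq_bigr => j _.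
  by rewrite !dE -[RHS]mulrA auto; ring.
have [_ _ _ cvF] := alg_iso_curv okF okF u gF brF.
split=> // x x0; rewrite frame_form mulr_sumr.
have term i : s * (x 0 i * (x *m diag_mx phi) 0 i * ext_gram eps c i) =
    x 0 i ^+ 2 * (s * phi 0 i * ext_gram eps c i).
  by rewrite mul_mx_diag mxE; ring.
have pos i : 0 < s * phi 0 i * ext_gram eps c i.
  case: (split_ordP i) => i' ->; rewrite ?(ord1 i') ?ext_gramE ?phil ?phir.
    by rewrite mulr1 /s -normrEsg normr_gt0.
  by rewrite mulrA ss mul1r eps1 ltr01.
under eq_bigr do rewrite term.
have [i xi] : exists i, x 0 i != 0.
  apply/existsP; apply: contraNT x0; rewrite negb_exists => /forallP h.
  by apply/eqP/rowP => i; rewrite mxE; apply/eqP; have := h i; rewrite negbK.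
have t0 : 0 < x 0 i ^+ 2 * (s * phi 0 i * ext_gram eps c i).
  by rewrite mulr_gt0 // exprn_even_gt0.
rewrite (bigD1 i) //=; apply: ltr_pwDl => //.
by apply: sumr_ge0 => j _; rewrite mulr_ge0 ?sqr_ge0 // ltW.
Qed.

End ExtensionCartan.

Section Semidirect.
Variables (R : realType) (m : nat) (h : metric_algebra R m) (D : 'M[R]_m) (c : R).
Hypothesis okh : metric_alg h.
Hypothesis c0 : c != 0.
Local Notation E := (semidirect h D c).

Lemma semidirect_metric : metric_alg E.
Proof.
have r0P a (x y : 'rV[R]_m) : row_mx (0 : 'rV[R]_1) (a *: x + y) =
    a *: row_mx 0 x + row_mx 0 y.
  by rewrite scale_row_mx add_row_mx scaler0 addr0.
have lP a (x y : 'rV[R]_(1 + m)) : lsubmx (a *: x + y) 0 0 = a * lsubmx x 0 0 + lsubmx y 0 0.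
  by rewrite !mxE.
split=> [a x y z|a x y z|x|].
- rewrite /= -r0P lP linearP /= (brPl okh) mulmxDl -scalemxAl; congr row_mx.
  move: (rsubmx z *m D) (rsubmx x *m D) (rsubmx y *m D) (br _ _ _) (br _ _ _) => v1 v2 v3 v4 v5.
  apply/rowP => k; rewrite !mxE; ring.
- rewrite /= -r0P lP linearP /= (brPr okh) mulmxDl -scalemxAl; congr row_mx.
  move: (rsubmx z *m D) (rsubmx x *m D) (rsubmx y *m D) (br _ _ _) (br _ _ _) => v1 v2 v3 v4 v5.
  apply/rowP => k; rewrite !mxE; ring.
- by rewrite /= (brxx okh) add0r subrr row_mx0.
have [_ _ _ [uG sG]] := okh; split; last by rewrite /= tr_block_mx !trmx0 tr_scalar_mx sG.
by rewrite unitmxE /= det_ublock det_scalar1 unitrM -unitmxE uG unitfE c0.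
Qed.

Hypothesis jac : forall x y z, br h x (br h y z) + br h y (br h z x) + br h z (br h x y) = 0.
Hypothesis der : derivation h D.

Lemma semidirect_jacobi x y z : br E x (br E y z) + br E y (br E z x) + br E z (br E x y) = 0.
Proof.
rewrite /= !row_mxKl !row_mxKr !add_row_mx !addr0 !mxE -[RHS]row_mx0; congr row_mx.
move: (x 0 _) (y 0 _) (z 0 _) (rsubmx x) (rsubmx y) (rsubmx z) => {x y z} x0 y0 z0 x y z.
rewrite !scale0r !subr0.
rewrite !(brDr okh) !(brNr okh) !(brZr okh) !mulmxDl !mulNmx -!scalemxAl !der.
have := jac x y z.
rewrite (brC okh z (y *m D)) (brC okh y (x *m D)) (brC okh x (z *m D)).
move: (br h x (br h y z)) (br h y (br h z x)) (br h z (br h x y)) => a1 a2 a3.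
move: (br h (y *m D) z) (br h y (z *m D)) (br h (x *m D) y) (br h x (y *m D))
  (br h (z *m D) x) (br h z (x *m D)) => b1 b2 b3 b4 b5 b6.
move: (x *m D *m D) (y *m D *m D) (z *m D *m D) => d1 d2 d3 /rowP J.
apply/rowP => k; have := J k; rewrite !mxE; lra.
Qed.

End Semidirect.

Section RicciForm.
Variables (R : realType) (n : nat) (A : metric_algebra R n).
Hypothesis okA : metric_alg A.

Lemma ricciE y z : ricci A y z = \sum_i curvature A (delta_mx 0 i) y z 0 i.
Proof. by apply: eq_bigr => i _; rewrite !mxE. Qed.

Lemma einstein_ricci lambda y z : ricci_op A = lambda%:M ->
  ricci A y z = lambda * bform (gram A) y z.
Proof.
move=> ro; have [_ _ _ [uG _]] := okA.
have RG : \matrix_(i, j) ricci A (delta_mx 0 i) (delta_mx 0 j) = lambda *: gram A.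
  by rewrite -mul_scalar_mx -ro /ricci_op mulmxKV.
have rG i j : ricci A (delta_mx 0 i) (delta_mx 0 j) = lambda * gram A i j.
  by have /matrixP/(_ i j) := RG; rewrite !mxE.
rewrite bform_sumE mulr_sumr.
have rl t u v w : ricci A (t *: u + v) w = t * ricci A u w + ricci A v w.
  rewrite !ricciE mulr_sumr -big_split; apply: eq_bigr => i _.
  by rewrite (curvatureP2 okA) mxE [X in X + _]mxE.
have rr t u v w : ricci A w (t *: u + v) = t * ricci A w u + ricci A w v.
  rewrite !ricciE mulr_sumr -big_split; apply: eq_bigr => i _.
  by rewrite (curvatureP3 okA) mxE [X in X + _]mxE.
have l1 w : linear ((fun u => ricci A u w) : 'rV[R]_n -> R^o) by move=> t u v; exact: rl.
have l2 w : linear ((fun u => ricci A w u) : 'rV[R]_n -> R^o) by move=> t u v; exact: rr.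
rewrite {1}[y]row_sum_delta (linear_sumZ _ _ (l1 z)); apply: eq_bigr => i _.
rewrite {1}[z]row_sum_delta (linear_sumZ _ _ (l2 _)) mulr_sumr scaler_sumr.
by apply: eq_bigr => j _; rewrite rG -[LHS]/(_ * (_ * _)); ring.
Qed.

End RicciForm.

Section Depth.
Variables (R : realType) (m : nat) (h : metric_algebra R m).
Hypothesis okh : metric_alg h.

Lemma bracket_lower_central k x y :
  y \in lower_central h fullv k -> br h x y \in lower_central h fullv k.+1.
Proof.
move=> hy; rewrite /lower_central iterS -/(lower_central h fullv k) /bracket_space.
rewrite (coord_vbasis (memvf x)) (coord_vbasis hy) (br_suml okh).
apply: memv_suml => i _; rewrite (br_sumr okh); apply: memv_suml => j _.
rewrite (brZl okh) (brZr okh) !memvZ // memv_span //.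
by apply: allpairs_f; apply: mem_nth; rewrite size_tuple.
Qed.

(** The depth of a basis vector is the index of the last term of the lower central series that
    contains it; bracketing moves one term further down. *)
Lemma nilpotent_depth (B : 'M[R]_m) : B \in unitmx -> nilpotent_alg h fullv ->
  exists w : 'I_m -> nat, forall i j k a,
    br h (row i B) (row j B) = a *: row k B -> a != 0 -> (w j < w k)%N.
Proof.
move=> uB [N LN].
have row0 i : row i B != 0.
  apply/eqP => e; have /row_freeP [B' BB] : row_free B by rewrite row_free_unit.
  have := congr1 (row i) BB; rewrite row_mul e mul0mx => /rowP/(_ i); rewrite !mxE eqxx.
  by move/eqP; rewrite eq_sym oner_eq0.
have ltN i t : row i B \in lower_central h fullv t -> (t < N)%N.
  move=> hi; rewrite ltnNge; apply: contra (row0 i) => Nt.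
  have lc0 s : lower_central h fullv (N + s) = 0%VS.
    elim: s => [|s IH]; first by rewrite addn0.
    rewrite addnS /lower_central iterS -/(lower_central h fullv (N + s)) IH /bracket_space.
    apply/eqP; rewrite -subv0; apply/span_subvP => v /allpairsP[[u z] [_ hz ->]] /=.
    have : z \in (0 : {vspace 'rV[R]_m})%VS by exact: vbasis_mem.
    by rewrite memv0 => /eqP ->; rewrite (br0r okh) mem0v.
  by move: hi; rewrite -(subnKC Nt) lc0 memv0.
have ex i : exists t, row i B \in lower_central h fullv t.
  by exists 0%N; rewrite /lower_central memvf.
have ub i t : row i B \in lower_central h fullv t -> (t <= N)%N by move/ltN/ltnW.
exists (fun i => ex_maxn (ex i) (ub i)) => i j k a e a0.
case: ex_maxnP => t ht _; case: ex_maxnP => t' _; apply.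
rewrite -[row k B](scalerK a0) -e memvZ //; exact: bracket_lower_central.
Qed.

End Depth.

Section PseudoIwasawa.
Variables (R : realType) (m : nat) (h : metric_algebra R m) (D : 'M[R]_m) (c : R).
Local Notation E := (semidirect h D c).

Lemma pseudo_iwasawa_metric : pseudo_iwasawa_einstein_extension h D c ->
  metric_alg E /\ pair_symmetric E.
Proof.
case=> [[[[bl br' bxx jac] mh] _ _] [der _] c0 _ _].
have okh : metric_alg h by [].
have okE := semidirect_metric D okh c0.
split=> // x y z w; apply: curvature_pair => //.
exact: semidirect_jacobi.
Qed.

Variable B : 'M[R]_m.
Let C i j k := (br h (row i B) (row j B) *m invmx B) 0 k.
Let Dm i k := (B *m D *m invmx B) i k.
Let eps i := bform (gram h) (row i B) (row i B).
Local Notation F := (frame_alg (ext_struct C Dm) (ext_gram eps c)).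
Local Notation P := (block_mx (1%:M : 'M[R]_1) 0 0 B).

Hypothesis ext : pseudo_iwasawa_einstein_extension h D c.
Hypothesis nice : nice_basis h B.
Hypothesis onb : orthonormal_basis h B.
Hypothesis m4 : (m <= 4)%N.

Let okh : metric_alg h.
Proof. by case: ext => [[[[bl br' bxx jac] mh] _ _] _ _ _ _]. Qed.

Let c0 : c != 0. Proof. by case: ext. Qed.
Let uB : B \in unitmx. Proof. by case: nice. Qed.
Let okE : metric_alg E. Proof. by case: (pseudo_iwasawa_metric ext). Qed.

Let eps1 i : eps i * eps i = 1.
Proof. by rewrite /eps; case: onb => _ _ /(_ i) [] ->; rewrite ?mulr1 ?mulrNN ?mulr1. Qed.

Let gramB i j : bform (gram h) (row i B) (row j B) = eps i *+ (i == j).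
Proof.
case: eqVneq => [->|ij]; first by rewrite mulr1n.
by case: onb => _ /(_ i j ij) ->.
Qed.

Let rowV k : row k B *m invmx B = delta_mx 0 k.
Proof. by rewrite -row_mul mulmxV // rowE mulmx1. Qed.

Let C_alt i j k : C i j k = - C j i k.
Proof. by rewrite /C (brC okh) mulNmx mxE. Qed.

Let C_target i j : exists k a, br h (row i B) (row j B) = a *: row k B /\
  forall l, C i j l = a *+ (l == k).
Proof.
case: nice => _ /(_ i j) [k [a e]] _; exists k, a; split=> // l.
by rewrite /C e -scalemxAl rowV !mxE eqxx /= mulr_natr.
Qed.

Let nice_target i j k k' : C i j k != 0 -> C i j k' != 0 -> k = k'.
Proof.
have [l [a [_ e]]] := C_target i j.
have tl t : C i j t != 0 -> t = l.
  by rewrite e; case: (eqVneq t l) => // _; rewrite mulr0n eqxx.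
by move=> /tl -> /tl ->.
Qed.

Let nice_source i j j' k : C i j k != 0 -> C i j' k != 0 -> j = j'.
Proof.
case: nice => _ _ /(_ i k) [l [a e]].
have Ce t : C i t k = - (a *+ (t == l)).
  have := e (row t B); rewrite /ce_diff /dual_coord rowV => /(congr1 -%R).
  by rewrite opprK -/(C i t k) => ->; rewrite mxE eqxx /= eq_sym mulr_natr.
have tl t : C i t k != 0 -> t = l.
  by rewrite Ce; case: (eqVneq t l) => // _; rewrite mulr0n oppr0 eqxx.
by move=> /tl -> /tl ->.
Qed.

Let rowD i : row i B *m D = \sum_l Dm i l *: row l B.
Proof.
rewrite -row_mul -[B *m D](mulmxKV uB) row_mul mulmx_sum_row.
by apply: eq_bigr => l _; rewrite mxE.
Qed.

Let D_sym i j : Dm i j * eps j = Dm j i * eps i.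
Proof.
have [_ [_ sD] _ _ _] := ext.
have := sD (row i B) (row j B); rewrite !rowD bform_suml bform_sumr.
rewrite (bigD1 j) //= big1 => [|l lj]; last by rewrite bformZl gramB (negbTE lj) mulr0n mulr0.
rewrite (bigD1 i) //= [\sum_(_ | _) _]big1 => [|l li]; last first.
  by rewrite bformZr gramB [i == l]eq_sym (negbTE li) mulr0n mulr0.
by rewrite !addr0 bformZl bformZr !gramB !eqxx !mulr1n.
Qed.

Let brB x y k : (br h (x *m B) (y *m B) *m invmx B) 0 k =
  \sum_i \sum_j x 0 i * y 0 j * C i j k.
Proof.
rewrite (mulmx_sum_row x B) (mulmx_sum_row y B) (br_suml okh) mulmx_suml summxE; apply: eq_bigr => i _.
rewrite (br_sumr okh) mulmx_suml summxE; apply: eq_bigr => j _.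
by rewrite (brZl okh) (brZr okh) -!scalemxAl mxE [X in _ * X]mxE mulrA.
Qed.

Let D_der i j k : \sum_l C i j l * Dm l k =
  \sum_l Dm i l * C l j k + \sum_l Dm j l * C i l k.
Proof.
have [_ [der _] _ _ _] := ext.
have /= := congr1 (fun v => (v *m invmx B) 0 k) (der (row i B) (row j B)).
rewrite mulmxDl [X in _ = X -> _]mxE.
have -> : br h (row i B) (row j B) *m D *m invmx B =
    br h (row i B) (row j B) *m invmx B *m (B *m D *m invmx B).
  by rewrite !mulmxA mulmxKV.
rewrite [X in X = _ -> _]mxE => ->; congr (_ + _).
  rewrite rowD (br_suml okh) mulmx_suml summxE; apply: eq_bigr => l _.
  by rewrite (brZl okh) -scalemxAl mxE.
rewrite rowD (br_sumr okh) mulmx_suml summxE; apply: eq_bigr => l _.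
by rewrite (brZr okh) -scalemxAl mxE.
Qed.

Let okF : metric_alg F.
Proof. by apply: frame_alg_metric => *; [exact: ext_struct_alt|exact: ext_gram_neq0]. Qed.

Let uP : P \in unitmx.
Proof. by rewrite unitmxE det_ublock det1 mul1r -unitmxE. Qed.

Let gramP : gram F = P *m gram E *m P^T.
Proof.
rewrite /= tr_block_mx !trmx0 trmx1 !mulmx_block !(mul0mx, mulmx0, addr0, add0r).
rewrite mul1mx mulmx1; apply/matrixP => i j; rewrite mxE [(\row_a _) 0 i]mxE.
case: (@split_ordP 1 m i) => i' ->; case: (@split_ordP 1 m j) => j' ->.
- by rewrite block_mxEul (ord1 i') (ord1 j') ext_gramE mxE !eqxx.
- by rewrite block_mxEur mxE (@eq_lrshift 1 m).
- by rewrite block_mxEdl mxE (@eq_rlshift 1 m).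
rewrite block_mxEdr ext_gramE (@eq_rshift 1 m) -gramB.
by rewrite !rowE -bform_mul bform_delta.
Qed.

Let brP x y : br E (x *m P) (y *m P) = br F x y *m P.
Proof.
have xP (z : 'rV[R]_(1 + m)) : z *m P = row_mx (lsubmx z) (rsubmx z *m B).
  by rewrite -{1}[z]hsubmxK mul_row_block !mulmx0 addr0 add0r mulmx1.
rewrite [RHS]xP !xP /= !row_mxKl !row_mxKr; congr row_mx.
  apply/rowP => k; rewrite (ord1 k) !mxE big1 // => i _; rewrite big1 // => j _.
  by rewrite ext_structE mulr0.
rewrite -[LHS](mulmxKV uB); congr (_ *m B).
apply/rowP => k; rewrite !mulmxDl mulNmx -!scalemxAl.
have e (a b d : 'rV[R]_m) : (a + b - d) 0 k = a 0 k + b 0 k - d 0 k by rewrite !mxE.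
have sE (a : R) (v : 'rV[R]_m) : (a *: v) 0 k = a * v 0 k by rewrite mxE.
have DE (z : 'rV[R]_m) : (z *m B *m D *m invmx B) 0 k = \sum_j z 0 j * Dm j k.
  by rewrite -!mulmxA mxE; apply: eq_bigr => j _; rewrite /Dm mulmxA.
rewrite e !sE brB !DE [RHS]mxE [RHS]mxE big_ext.
rewrite (big_ext (fun j => x 0 (lshift m 0) * y 0 j * _)) ext_structE mulr0 add0r.
have lE (z : 'rV[R]_(1 + m)) : lsubmx z 0 0 = z 0 (lshift m 0) by rewrite mxE.
have rE (z : 'rV[R]_(1 + m)) i : rsubmx z 0 i = z 0 (rshift 1 i) by rewrite mxE.
under [X in _ = _ + X]eq_bigr => i _.
  rewrite (big_ext (fun j => x 0 (rshift 1 i) * y 0 j * _)) ext_structE.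
  under eq_bigr do rewrite ext_structE.
  over.
under [X in _ = X + _]eq_bigr do rewrite ext_structE.
rewrite big_split /= !lE.
have -> : \sum_i x 0 (rshift 1 i) * y 0 (lshift m 0) * - Dm i k =
   - (y 0 (lshift m 0) * \sum_j rsubmx x 0 j * Dm j k).
  by rewrite mulr_sumr -sumrN; apply: eq_bigr => i _; rewrite rE; ring.
have -> : \sum_i x 0 (lshift m 0) * y 0 (rshift 1 i) * Dm i k =
   x 0 (lshift m 0) * \sum_j rsubmx y 0 j * Dm j k.
  by rewrite mulr_sumr; apply: eq_bigr => i _; rewrite rE; ring.
have -> : \sum_i \sum_j x 0 (rshift 1 i) * y 0 (rshift 1 j) * C i j k =
   \sum_i \sum_j rsubmx x 0 i * rsubmx y 0 j * C i j k.
  by apply: eq_bigr => i _; apply: eq_bigr => j _; rewrite !rE.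
ring.
Qed.

Let iso : curv_iso E F P (invmx P).
Proof. exact: alg_iso_curv. Qed.

(** The condition on [ricci] makes the Einstein constant nonzero, which the notion of Einstein
    extension alone does not provide. *)
Lemma pseudo_iwasawa_cartan : (exists y, ricci E y y != 0) ->
  exists phi s, cartan_involution E phi s.
Proof.
move=> [y0 ry0]; have [[_ nil _] _ _ _ [lambda ro]] := ext.
have lambda0 : lambda != 0.
  by apply: contraNneq ry0 => l0; rewrite (einstein_ricci okE _ _ ro) l0 mul0r.
have ricF u v : ricci F u v = lambda * bform (gram F) u v.
  by rewrite -(curv_iso_ricci u v okE okF iso) (einstein_ricci okE _ _ ro) gramP bform_mul.
have [w dep] := nilpotent_depth okh uB nil.
have depth i j k : C i j k != 0 -> (w j < w k)%N.
  have [l [a [e Ce]]] := C_target i j; rewrite Ce.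
  case: (eqVneq k l) => [->|_]; last by rewrite mulr0n eqxx.
  by rewrite mulr1n; exact: (dep _ _ _ _ e).
have ric j k : lambda * eps j *+ (j == k) =
  \sum_a \sum_b (4^-1 * (C a b j * eps j) * (C a b k * eps k)
     - 2^-1 * (C j a b * eps b) * (C k a b * eps b)) * (eps a * eps b)
  - (\sum_l Dm l l) * Dm j k * eps k / c.
  rewrite -(ext_ricci C_alt eps1 c0 depth D_sym) ricF bform_delta mxE.
  by rewrite (@eq_rshift 1 m) [(\row_a _) 0 _]mxE ext_gramE mulrnAr.
have ric0 : lambda * c = - \sum_a \sum_b Dm a b * Dm b a.
  rewrite -(ext_ricci0 C_alt eps1 c0 D_sym) ricF bform_delta mxE eqxx mulr1n.
  by rewrite mxE ext_gramE.
have dd j k : j != k -> Dm j k = 0.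
  exact: (nice_derivation_diag m4 C_alt nice_target nice_source depth eps1 D_der c0 lambda0 ric ric0).
have rs i j k : C i j k != 0 -> 0 < c * (eps i * eps j * eps k).
  exact: (nice_root_sign m4 C_alt nice_target nice_source depth eps1 D_der c0 lambda0 ric ric0).
have ci := ext_cartan C_alt eps1 c0 dd rs.
by do 2!eexists; exact: (cartan_curv_iso iso ci).
Qed.

End PseudoIwasawa.

Lemma table_dim (R : realType) (L : table_line R) : List.In L (table R) -> (tdim L <= 4)%N.
Proof. by case=> [<-|[<-|[<-|[<-|[<-|[<-|[<-|[<-|[<-|[]]]]]]]]]]. Qed.

(** * Integer certificates for the entries of the table *)

From Stdlib Require Import ZArith.
From mathcomp Require Import ssrZ ring lra.

Section IntegerCoefficients.
Variable R : realType.

Definition zr (z : Z) : R := (int_of_Z z)%:~R.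

Lemma zrD x y : zr (Z.add x y) = zr x + zr y.
Proof. exact: (rmorphD [the {rmorphism Z -> R} of intr \o int_of_Z]). Qed.
Lemma zrM x y : zr (Z.mul x y) = zr x * zr y.
Proof. exact: (rmorphM [the {rmorphism Z -> R} of intr \o int_of_Z]). Qed.
Lemma zrN x : zr (Z.opp x) = - zr x.
Proof. exact: (rmorphN [the {rmorphism Z -> R} of intr \o int_of_Z]). Qed.
Lemma zrB x y : zr (Z.sub x y) = zr x - zr y.
Proof. by rewrite -Z.add_opp_r zrD zrN. Qed.

Lemma zr1 : zr (Zpos xH) = 1. Proof. by []. Qed.
Lemma zr2 : zr (Zpos (xO xH)) = 2. Proof. by []. Qed.

Lemma zr_nat k : zr (Z.of_nat k) = k%:R.
Proof. by elim: k => // k IH; rewrite Nat2Z.inj_succ zrD IH natr1. Qed.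

Lemma zr_eq0 x : zr x = 0 -> x = Z0.
Proof.
move/eqP; rewrite /zr intr_eq0 => /eqP e.
by rewrite -(int_of_ZK x) e.
Qed.

Lemma zr_le0 x : Z.le x Z0 -> zr x <= 0.
Proof.
rewrite /zr lerz0; case: x => // p /=; by case: (Pos.to_nat p).
Qed.

Definition zsum n (f : nat -> Z) : Z := foldr (fun i a => Z.add (f i) a) Z0 (iota 0 n).

Lemma zr_sum n f : zr (zsum n f) = \sum_(i < n) zr (f i).
Proof.
rewrite -(big_mkord xpredT (fun i => zr (f i))) /index_iota subn0 /zsum.
elim: (iota 0 n) => [|i r IH]; first by rewrite big_nil.
by rewrite big_cons -IH /= zrD.
Qed.

Definition zprod n (f : nat -> Z) : Z := foldr (fun i a => Z.mul (f i) a) 1%Z (iota 0 n).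

Lemma zr_prod n f : zr (zprod n f) = \prod_(i < n) zr (f i).
Proof.
rewrite -(big_mkord xpredT (fun i => zr (f i))) /index_iota subn0 /zprod.
elim: (iota 0 n) => [|i r IH]; first by rewrite big_nil.
by rewrite big_cons -IH /= zrM.
Qed.

End IntegerCoefficients.

Arguments zr R z : simpl never.

(* Structure constants and squared norms of an orthogonal frame, given by
   integers so that curvature conditions can be decided by computation. *)
Section Certificate.
Open Scope Z_scope.
Variables (n : nat) (C : nat -> nat -> nat -> Z) (g : nat -> Z).

Definition zchr i j k := C i j k * g k - C j k i * g i + C k i j * g j.
(** Replaces 1 / g_m once all terms are multiplied by the product of the norms. [zcurv] is thus 4
    times that product times the curvature component, and [zricci0] is 4 times its square times
    Ric(e_0, e_0). *)
Definition cofactor_g m := zprod n (fun i => if i == m then 1 else g i).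
Definition zcurv i j k l :=
  zsum n (fun m => (zchr j k m * zchr i m l - zchr i k m * zchr j m l) * cofactor_g m
                   - 2 * zprod n g * (C i j m * zchr m k l)).
Definition zricci0 := zsum n (fun i => zcurv i 0 0 i * cofactor_g i).

Variables (k : nat) (w : nat -> nat -> nat -> Z) (piv : nat -> nat * nat).
(* The test for zero only spares the evaluation of most curvature terms. *)
Definition zimg i c d := zprod n g * zsum n (fun p => zsum n (fun q =>
  if w i p q == 0 then 0 else w i p q * zcurv p q c d)).
(** A coefficient is read off at the pivot, where only [w j] is nonzero. The factor [zprod n g] in
    [zimg] makes the integer division exact for c != d, and [certificate] verifies the resulting
    matrix. *)
Definition zmat i j := let: (c, d) := piv j in zimg i c d / (g c * g d).
Variable M : nat -> nat -> Z.

Definition all_below m (P : nat -> bool) := all P (iota 0 m).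

(* The bivectors w i span a space invariant under the curvature operator, whose
   matrix on it is M up to a scalar factor. The trace inequality
   k tr (M^2) <= (tr M)^2 says that tr ((M - mu)^2) <= 0 for mu = (tr M) / k,
   while the entry M 0 1 shows that M is not scalar. *)
Definition certificate : bool :=
  [&& all_below n (fun i => all_below n (fun j => all_below n (fun l =>
         C i j l == - C j i l))),
      all_below n (fun i => g i != 0), zricci0 != 0,
      all_below k (fun j => let: (c, d) := piv j in
         [&& leq c.+1 n, leq d.+1 n & all_below k (fun i => w i c d == (if i == j then 1 else 0))]),
      all_below k (fun i => all_below n (fun c => all_below n (fun d =>
         zimg i c d == zsum k (fun j => M i j * (w j c d * (g c * g d)))))),
      Z.leb (Z.of_nat k * zsum k (fun i => zsum k (fun j => M i j * M j i)))
        (zsum k (fun i => M i i) * zsum k (fun i => M i i)),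
      leq 2 k & M 0 1 != 0].

End Certificate.

Lemma all_belowP m (P : nat -> bool) :
  reflect (forall i : 'I_m, P i) (all_below m P).
Proof.
apply: (iffP allP) => [H i|H i]; first by apply: H; rewrite mem_iota /=.
by rewrite mem_iota /= add0n => lt; exact: (H (Ordinal lt)).
Qed.

Section Soundness.
Variables (R : realType) (n : nat) (C : nat -> nat -> nat -> Z) (g : nat -> Z).
Variables (k : nat) (w : nat -> nat -> nat -> Z) (piv : nat -> nat * nat)
  (Mz : nat -> nat -> Z).
Hypothesis cert : certificate n C g k w piv Mz.

Local Notation zr := (zr R).
Let CR (i j l : 'I_n) : R := zr (C i j l).
Let gR (i : 'I_n) : R := zr (g i).
Local Notation F := (frame_alg CR gR).

Let C_alt i j l : CR i j l = - CR j i l.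
Proof.
move: cert => /and5P[/all_belowP/(_ i)/all_belowP/(_ j)/all_belowP/(_ l)/eqP h _ _ _ _].
by rewrite /CR h zrN.
Qed.

Let g_neq0 i : gR i != 0.
Proof.
move: cert => /and5P[_ /all_belowP/(_ i) h _ _ _].
by apply: contra_neq h => /zr_eq0.
Qed.

Lemma certificate_metric : metric_alg F.
Proof. exact: frame_alg_metric. Qed.

Let Gm : R := \prod_i gR i.
Let Gm0 : Gm != 0.
Proof. by rewrite prodf_seq_neq0; apply/allP => i _; rewrite g_neq0. Qed.

Let zr_cof (m : 'I_n) : zr (cofactor_g n g m) = Gm / gR m.
Proof.
rewrite /cofactor_g zr_prod /Gm (bigD1 m) //= [in RHS](bigD1 m) //= eqxx.
rewrite mulrAC divff // !mul1r.
by apply: eq_bigr => i ne; rewrite ifN.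
Qed.

Let zr_chr (i j l : 'I_n) : zr (zchr C g i j l) = chr2 CR gR i j l.
Proof. by rewrite /zchr zrD zrB !zrM. Qed.

Let zr_curv (i j l m : 'I_n) : zr (zcurv n C g i j l m) =
  4 * Gm * bform (gram F) (curvature F (delta_mx 0 i) (delta_mx 0 j) (delta_mx 0 l)) (delta_mx 0 m).
Proof.
rewrite frame_curvature // zr_sum mulr_sumr; apply: eq_bigr => t _.
rewrite zrB !zrM zrB !zrM !zr_chr zr_cof zr_prod -/Gm zr2.
by field; rewrite g_neq0.
Qed.

Lemma certificate_ricci : exists y, ricci F y y != 0.
Proof.
move: cert => /and5P[_ _ r0 _ _].
have n0 : leq 1 n by case: (n) r0 => //; rewrite /zricci0 /zsum /=.
pose i0 := Ordinal n0; exists (delta_mx 0 i0).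
apply: contra_neq r0 => e; apply: (@zr_eq0 R); rewrite /zricci0 zr_sum.
transitivity (4 * (Gm * Gm) * ricci F (delta_mx 0 i0) (delta_mx 0 i0)); last by rewrite e mulr0.
rewrite frame_ricci // mulr_sumr; apply: eq_bigr => i _.
rewrite zrM (zr_curv i i0 i0 i) zr_cof; field.
exact: g_neq0.
Qed.

Lemma certificate_sound phi s : pair_symmetric F -> ~ cartan_involution F phi s.
Proof.
move=> sF ci; move: cert => /and5P[_ _ _ hp /and4P[he ht hk h01]].
pose W (i : 'I_k) : 'M[R]_n := \matrix_(c, d) zr (w i c d).
pose mz (i j : 'I_k) : R := zr (Mz i j).
(* The integer matrix is scaled by 4 [Gm] from [zcurv] and by another [Gm] from [zimg]. *)
pose M : 'M[R]_k := \matrix_(i, j) (mz i j / (4 * (Gm * Gm))).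
have k0 : (k%:R : R) != 0 by rewrite pnatr_eq0 -lt0n (ltn_trans _ hk).
pose mu := \tr M / k%:R.
have free (x : 'I_k -> R) : \sum_i x i *: W i = 0 -> forall i, x i = 0.
  move=> e j; have := all_belowP _ _ hp j; case: (piv j) => c d /and3P[hc hd /all_belowP h].
  have := congr1 (fun X : 'M[R]_n => X (Ordinal hc) (Ordinal hd)) e.
  rewrite summxE (bigD1 j) //= big1 => [|i ne].
    by rewrite !mxE /= (eqP (h j)) eqxx zr1 mulr1 addr0.
  by rewrite !mxE /= (eqP (h i)) ifN // mulr0.
have eigen (i : 'I_k) (c d : 'I_n) : \sum_p \sum_q W i p q *
    bform (gram F) (curvature F (delta_mx 0 p) (delta_mx 0 q) (delta_mx 0 c)) (delta_mx 0 d) =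
  \sum_j M i j * \sum_p \sum_q W j p q * gram F p c * gram F q d.
  have /all_belowP/(_ i)/all_belowP/(_ c)/all_belowP/(_ d)/eqP/(congr1 zr) := he.
  rewrite /zimg zrM zr_prod -/Gm !zr_sum => E.
  have aux (x y z : R) : x * (y * (4 * x * z)) = 4 * (x * x) * (y * z) :> R by ring.
  have lhsE : Gm * \sum_(p < n) zr (zsum n (fun q =>
        if w i p q == Z0 then Z0 else Z.mul (w i p q) (zcurv n C g p q c d))) =
      4 * (Gm * Gm) * \sum_p \sum_q W i p q *
       bform (gram F) (curvature F (delta_mx 0 p) (delta_mx 0 q) (delta_mx 0 c)) (delta_mx 0 d).
    rewrite !mulr_sumr; apply: eq_bigr => p _; rewrite zr_sum !mulr_sumr.
    apply: eq_bigr => q _; rewrite mxE -aux -(zr_curv p q c d).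
    by case: eqP => [->|_]; [rewrite [zr 0]/(0) mul0r | rewrite zrM].
  have G0 : 4 * (Gm * Gm) != 0 by rewrite mulf_neq0 ?mulf_neq0 ?pnatr_eq0.
  apply: (mulfI G0); rewrite -lhsE E mulr_sumr; apply: eq_bigr => j _.
  rewrite !zrM mxE -/(mz i j) (bigD1 c) //= (bigD1 d) //= !mxE !eqxx !mulr1n.
  rewrite !big1 ?addr0 => [|p ne|q ne]; first by rewrite /gR; field.
    by rewrite big1 // => q _; rewrite !mxE (negbTE ne) mulr0n mulr0 mul0r.
  by rewrite !mxE (negbTE ne) mulr0n mulr0.
have tr0 : \tr ((M - mu%:M) *m (M - mu%:M)) <= 0.
  have trE : \tr ((M - mu%:M) *m (M - mu%:M)) = \tr (M *m M) - (\tr M) ^+ 2 / k%:R.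
    rewrite mulmxBl !mulmxBr mul_scalar_mx mul_mx_scalar -scalar_mxM.
    rewrite !raddfB /= !mxtraceZ mxtrace_scalar -[_ *+ k]mulr_natr /mu; field.
    exact: k0.
  have kp : 0 < (k%:R : R) by rewrite lt0r k0 ler0n.
  rewrite trE subr_le0 ler_pdivlMr // mulrC.
  move: ht => /Z.leb_le/Z.le_sub_0/(@zr_le0 R).
  rewrite zrB !zrM !zr_sum subr_le0 => ht.
  rewrite -zr_nat.
  have trM : \tr M = (\sum_(i < k) zr (Mz i i)) / (4 * (Gm * Gm)).
    by rewrite mulr_suml; apply: eq_bigr => i _; rewrite mxE.
  have trMM : \tr (M *m M) = (\sum_(i < k) \sum_(j < k) zr (Mz i j) *
      zr (Mz j i)) / (4 * (Gm * Gm)) ^+ 2.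
    rewrite mulr_suml; apply: eq_bigr => i _; rewrite mxE mulr_suml.
    by apply: eq_bigr => j _; rewrite !mxE /mz; field.
  rewrite trM trMM expr_div_n [leLHS]mulrA ler_pM2r.
    rewrite expr2; apply: le_trans ht; rewrite le_eqVlt; apply/orP; left; apply/eqP.
    congr (_ * _); apply: eq_bigr => i _; rewrite zr_sum.
    by apply: eq_bigr => j _; rewrite zrM.
  by rewrite invr_gt0 exprn_gt0 // mulr_gt0 ?ltr0n // -expr2 exprn_even_gt0.
have ME := cartan_curvature_eigen certificate_metric sF ci free eigen tr0.
have k1 : leq 1 k by exact: ltn_trans hk.
have /matrixP/(_ (Ordinal k1) (Ordinal hk)) := ME; rewrite !mxE /= => /eqP.
rewrite mulr0n mulf_eq0 invr_eq0 mulf_eq0 pnatr_eq0 /= mulf_eq0 (negbTE Gm0) !orbF.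
by move=> /eqP /zr_eq0 e; move: h01; rewrite e.
Qed.

End Soundness.

(* With S = lscale and q = lsq, the integers describe the frame f_0 = S e_0,
   f_(i+1) = S sqrt(q_i) e_(i+1), in which all structure constants of the table
   are integral: lbr lists those of the nilpotent part, one for each pair
   i < j, and lder is the matrix of ad f_0. *)
Record line_data := LineData {
  ldim : nat; lscale : Z; lsq : seq Z; lbr : seq (nat * nat * nat * Z);
  lder : seq (seq Z) }.

Section LineData.
Variable d : line_data.
Local Open Scope Z_scope.

Definition zbr (i j k : nat) : Z :=
  foldr (fun x a => let: (i', j', k', v) := x in
    a + (if [&& i == i', j == j' & k == k'] then v else 0)
      - (if [&& j == i', i == j' & k == k'] then v else 0)) 0 (lbr d).

Definition zder (i k : nat) : Z := nth 0 (nth [::] (lder d) i) k.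

Definition zstruct (i j k : nat) : Z :=
  match i, j, k with
  | O, S j, S k => zder j k
  | S i, O, S k => - zder i k
  | S i, S j, S k => zbr i j k
  | _, _, _ => 0
  end.

(** Index 0 belongs to e_0, so the other indices agree with those of the table, which start at 1,
    whereas [lsq], [lbr] and [lder] count from 0. *)
Definition zgram (s : seq nat) (i : nat) : Z :=
  if i is S i' then lscale d * lscale d * nth 1 (lsq d) i' * (if i \in s then -1 else 1)
  else lscale d * lscale d.

End LineData.

Definition zbiv (w : seq (seq (nat * nat * Z))) (i p q : nat) : Z :=
  foldr (fun x a => let: (p', q', v) := x in
    Z.sub (Z.add a (if (p == p') && (q == q') then v else Z0))
          (if (q == p') && (p == q') then v else Z0)) Z0 (nth [::] w i).

Definition zpiv (w : seq (seq (nat * nat * Z))) (i : nat) : nat * nat :=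
  if nth [::] w i is (p, q, _) :: _ then (p, q) else (O, O).

(** The matrix is tabulated in lists so that evaluation computes each entry once. *)
Definition entry_cert (d : line_data) (s : seq nat) (w : seq (seq (nat * nat * Z))) : bool :=
  let M := mkseq (fun i => mkseq
    (zmat (ldim d).+1 (zstruct d) (zgram d s) (zbiv w) (zpiv w) i) (size w)) (size w) in
  certificate (ldim d).+1 (zstruct d) (zgram d s) (size w) (zbiv w) (zpiv w)
    (fun i j => nth Z0 (nth [::] M i) j).

Local Open Scope Z_scope.

Definition line_datas : seq line_data :=
  [:: LineData 3 7 [:: 1; 1; 1] [:: (0%nat, 1%nat, 2%nat, -4)]
        [:: [:: 6; 8; 0]; [:: 0; -2; 0]; [:: 0; 0; 4]];
      LineData 3 5 [:: 1; 1; 1] [::] [:: [:: 5; 6; 0]; [:: 0; -1; 0]; [:: 0; 0; 2]];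
      LineData 4 51 [:: 1; 66; 22; 187]
        [:: (0%nat, 1%nat, 2%nat, -42); (0%nat, 2%nat, 3%nat, -14)]
        [:: [:: 28; 7; 0; 0]; [:: 0; -21; 0; 0]; [:: 0; 0; 7; 0]; [:: 0; 0; 0; 35]];
      LineData 4 17 [:: 1; 1; 1; 22] [:: (0%nat, 1%nat, 3%nat, -2)]
        [:: [:: 15; 22; 0; 0]; [:: 0; -7; 0; 0]; [:: 0; 0; 6; 0]; [:: 0; 0; 0; 8]];
      LineData 4 3 [:: 1; 1; 2; 6] [:: (0%nat, 1%nat, 3%nat, -1)]
        [:: [:: 0; 0; 0; 0]; [:: 0; 0; 0; 0]; [:: 0; 0; 3; 2]; [:: 0; 0; 0; 0]];
      LineData 4 3 [:: 1; 1; 3; 6] [:: (0%nat, 1%nat, 3%nat, -1)]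
        [:: [:: 2; 0; 2; 0]; [:: 0; 0; 0; 0]; [:: 0; 0; -1; 0]; [:: 0; 0; 0; 2]];
      LineData 4 9 [:: 1; 1; 2; 6] [:: (0%nat, 1%nat, 3%nat, -2)]
        [:: [:: 3; 6; 0; 0]; [:: 0; -3; 0; 0]; [:: 0; 0; 6; 4]; [:: 0; 0; 0; 0]];
      LineData 4 3 [:: 1; 1; 1; 1] [::]
        [:: [:: 3; 4; 0; 0]; [:: 0; -1; 0; 0]; [:: 0; 0; 1; 0]; [:: 0; 0; 0; 1]];
      LineData 4 5 [:: 1; 1; 1; 1] [::]
        [:: [:: 3; 0; 4; 0]; [:: 0; 3; 0; 4]; [:: 0; 0; -1; 0]; [:: 0; 0; 0; -1]] ].
Local Close Scope Z_scope.

(** Lets an entry of the table inherit the axioms from its integer frame, where they are checked by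
    computation. *)
Lemma metric_alg_iso (R : realType) n (A B : metric_algebra R n) P :
  metric_alg B -> P \in unitmx -> gram B = P *m gram A *m P^T ->
  (forall x y, br A (x *m P) (y *m P) = br B x y *m P) -> metric_alg A.
Proof.
move=> [bl br' bxx [uB sB]] uP gB brE.
have E x y : br A x y = br B (x *m invmx P) (y *m invmx P) *m P.
  by rewrite -brE !mulmxKV.
have uPT : P^T \in unitmx by rewrite unitmx_tr.
split=> [a x y z|a x y z|x|].
- by rewrite !E mulmxDl -scalemxAl bl mulmxDl -scalemxAl.
- by rewrite !E mulmxDl -scalemxAl br' mulmxDl -scalemxAl.
- by rewrite E bxx mul0mx.
split.
  by move: uB; rewrite gB !unitmx_mul => /andP[/andP[_ ->] _].
move: sB; rewrite gB !trmx_mul trmxK -!mulmxA => /(can_inj (mulKmx uP)).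
by move/(can_inj (mulmxK uPT)).
Qed.

Section TableEntry.
Variables (R : realType) (L : table_line R) (s : seq nat) (d : line_data).
Local Notation n := (tdim L).
Local Notation zr := (zr R).
Local Notation q i := (Num.sqrt (zr (nth (Zpos xH) (lsq d) i))).

(** The brackets of the rescaled frame, compared along e_(k+1) after cancelling one factor
    [lscale d]. The minus sign is that of d alpha(x, y) = - alpha([x, y]). *)
Definition line_data_of :=
  [/\ ldim d = n, all (fun z => Z.ltb Z0 z) (lscale d :: lsq d),
    forall i j k : 'I_n, - (zr (lscale d) * q i * q j * (tdiff L)`_k i j) =
      zr (zbr d i j k) * q k &
    forall i k : 'I_n, zr (lscale d) * q i * tder L i k = zr (zder d i k) * q k].

Hypothesis hd : line_data_of.
Local Notation E := (semidirect (entry_algebra L s) (tder L) 1).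
Let CR (i j l : 'I_n.+1) : R := zr (zstruct d i j l).
Let gR (i : 'I_n.+1) : R := zr (zgram d s i).
Local Notation F := (frame_alg CR gR).

Let t : 'rV[R]_(1 + n) := row_mx (zr (lscale d))%:M (\row_i (zr (lscale d) * q i)).
Let P := diag_mx t.

Let zr_gt0 z : Z.ltb Z0 z -> 0 < zr z.
Proof.
case: z => // p _; rewrite lt_neqAle; apply/andP; split.
  by apply/eqP => /esym/zr_eq0.
have : zr (Zneg p) <= 0 by apply: zr_le0.
by rewrite -[Zneg p]/(Z.opp (Zpos p)) zrN oppr_le0.
Qed.

Let S0 : 0 < zr (lscale d).
Proof. by case: hd => _ /andP[/zr_gt0]. Qed.

Let q0 i : 0 < zr (nth (Zpos xH) (lsq d) i).
Proof.
apply: zr_gt0; case: hd => _ /andP[_ /allP h] _ _.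
case: (ltnP i (size (lsq d))) => hi; first by apply: h; exact: mem_nth.
by rewrite nth_default.
Qed.

Let t0 i : t 0 i != 0.
Proof.
case: (split_ordP i) => j ->.
  by rewrite row_mxEl !mxE ord1 eqxx mulr1n gt_eqF.
by rewrite row_mxEr mxE mulf_neq0 // gt_eqF // sqrtr_gt0.
Qed.

Let uP : P \in unitmx.
Proof.
rewrite unitmxE det_diag unitfE prodf_seq_neq0; apply/allP => i _.
exact: t0.
Qed.

Let tl j : t 0 (lshift n j) = zr (lscale d).
Proof. by rewrite row_mxEl mxE !ord1 eqxx mulr1n. Qed.

Let tr j : t 0 (rshift 1 j) = zr (lscale d) * q j.
Proof. by rewrite row_mxEr mxE. Qed.

Let gramE : gram F = P *m gram E *m P^T.
Proof.
have -> : gram E = block_mx 1%:M 0 0 (sign_metric R n s) by [].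
rewrite /P tr_diag_mx mul_diag_mx mul_mx_diag; apply/matrixP => i j.
rewrite [RHS]mxE [X in _ = X * _]mxE mxE [(\row_i gR i) 0 i]mxE /gR.
case: (@split_ordP 1 n i) => i' ->; case: (@split_ordP 1 n j) => j' ->; rewrite ?tl ?tr.
- by rewrite block_mxEul !mxE !ord1 eqxx mulr1n mulr1 -zrM.
- by rewrite block_mxEur mxE mulr0 mul0r (@eq_lrshift 1 n).
- by rewrite block_mxEdl mxE mulr0 mul0r (@eq_rlshift 1 n).
rewrite block_mxEdr (@eq_rshift 1 n) /sign_metric [diag_mx _ i' j']mxE.
case: eqP => [<-|_]; last by rewrite !mulr0n mulr0 mul0r.
rewrite !mulr1n [(\row_a _) 0 i']mxE /=.
have qq : q i' * q i' = zr (nth (Zpos xH) (lsq d) i').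
  by rewrite -expr2 sqr_sqrtr // ltW.
have aux (a b c : R) : a * a * (b * b) * c = a * b * c * (a * b) by ring.
transitivity (zr (lscale d) * zr (lscale d) * (q i' * q i') *
  (if i'.+1 \in s then -1 else 1)); last exact: aux.
by rewrite qq !zrM; case: ifP => _; rewrite ?zrN.
Qed.

Let brE x y : br E (x *m P) (y *m P) = br F x y *m P.
Proof.
have dE z i : (z *m P) 0 i = z 0 i * t 0 i by rewrite mul_mx_diag mxE.
have dEr (z : 'rV[R]_(1 + n)) (i : 'I_n) : (rsubmx (z *m P)) 0 i = z 0 (rshift 1 i) * (zr (lscale d) * q i).
  by rewrite mxE dE tr.
have dEl (z : 'rV[R]_(1 + n)) : (lsubmx (z *m P)) 0 0 = z 0 (lshift n 0) * zr (lscale d).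
  by rewrite mxE dE tl.
have [_ _ hb hder] := hd.
apply/rowP => k; rewrite [RHS]dE [X in _ = X * _]mxE.
case: (@split_ordP 1 n k) => k' ->.
  rewrite row_mxEl mxE big1 ?mul0r // => i _; rewrite big1 // => j _.
  rewrite /CR (_ : zstruct d i j _ = Z0) ?mulr0 //.
  by rewrite ord1 /=; case: (nat_of_ord i) => [|?] //; case: (nat_of_ord j).
rewrite row_mxEr tr.
have rowE (a b c : 'rV[R]_n) : (a + b - c) 0 k' = a 0 k' + b 0 k' - c 0 k' by rewrite !mxE.
have scE a (v : 'rV[R]_n) : (a *: v) 0 k' = a * v 0 k' by rewrite mxE.
have mulE (v : 'rV[R]_n) : (v *m tder L) 0 k' = \sum_j v 0 j * tder L j k' by rewrite mxE.
have bE u v : br (entry_algebra L s) u v 0 k' = - bform (tdiff L)`_k' u v by rewrite mxE.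
rewrite rowE !scE !mulE bE !dEl bform_sumE.
rewrite (@big_split_ord _ _ _ 1 n) /= big_ord1 (@big_split_ord _ _ _ 1 n) /= big_ord1.
rewrite [CR _ _ _]/(0) mulr0 add0r.
under [X in _ = (_ + X) * _]eq_bigr => i _.
  rewrite (@big_split_ord _ _ _ 1 n) /= big_ord1.
  over.
rewrite big_split /= !mulrDl addrA [RHS]addrC addrA.
congr (_ + _ + _).
- rewrite -sumrN mulr_suml; apply: eq_bigr => i _; rewrite -sumrN mulr_suml.
  apply: eq_bigr => j _; rewrite !dEr.
  transitivity (zr (lscale d) * (x 0 (rshift 1 i) * y 0 (rshift 1 j)) *
    (zr (lscale d) * q i * q j * - (tdiff L)`_k' i j)); first by ring.
  rewrite mulrN hb; rewrite /CR /=; ring.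
- rewrite mulr_suml mulr_sumr; apply: eq_bigr => j _; rewrite dEr.
  transitivity (x 0 (lshift n 0) * y 0 (rshift 1 j) * zr (lscale d) * (zr (lscale d) * q j * tder L j k')).
    by ring.
  by rewrite hder /CR /=; ring.
- rewrite -mulrN mulr_suml -sumrN mulr_sumr; apply: eq_bigr => j _; rewrite dEr.
  transitivity (- (y 0 (lshift n 0) * x 0 (rshift 1 j) * zr (lscale d) * (zr (lscale d) * q j * tder L j k'))).
    by ring.
  by rewrite hder /CR /= zrN; ring.
Qed.

Lemma entry_metric k w piv M : certificate n.+1 (zstruct d) (zgram d s) k w piv M -> metric_alg E.
Proof. by move=> c; apply: (metric_alg_iso (certificate_metric R c) uP gramE brE). Qed.

Lemma entry_iso k w piv M : certificate n.+1 (zstruct d) (zgram d s) k w piv M ->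
  curv_iso E F P (invmx P).
Proof.
move=> c; apply: (alg_iso_curv (entry_metric c) _ uP gramE brE).
exact: (certificate_metric R c).
Qed.

End TableEntry.

Section Table.
Variable R : realType.
Local Notation zr := (zr R).

Lemma zr_pos p : zr (Zpos p) = (Pos.to_nat p)%:R.
Proof. by []. Qed.
Lemma zr_neg p : zr (Zneg p) = - (Pos.to_nat p)%:R.
Proof. by rewrite -[Zneg p]/(Z.opp (Zpos p)) zrN zr_pos. Qed.
Lemma zr_0 : zr Z0 = 0. Proof. by []. Qed.

Definition nth_line (i : nat) : table_line R := nth (@TableLine R 0 [::] 0 [::]) (table R) i.
Definition nth_data (i : nat) := nth (LineData 0 0 [::] [::] [::]) line_datas i.

(** Such relations explain the squares 66, 22, 187 chosen for the third line: each radical in a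
    structure constant is absorbed by those of the frame vectors. *)
Let s66_3 : Num.sqrt 66%:R * Num.sqrt 3%:R = 3 * Num.sqrt 22%:R :> R.
Proof.
rewrite -sqrtrM ?ler0n // -natrM -[muln 66 3]/(muln (expn 3 2) 22) natrM sqrtrM ?ler0n //.
by rewrite natrX sqrtr_sqr ger0_norm ?ler0n.
Qed.

Let s22_34 : Num.sqrt 22%:R * Num.sqrt 34%:R = 2 * Num.sqrt 187%:R :> R.
Proof.
rewrite -sqrtrM ?ler0n // -natrM -[muln 22 34]/(muln (expn 2 2) 187) natrM sqrtrM ?ler0n //.
by rewrite natrX sqrtr_sqr ger0_norm ?ler0n.
Qed.

Let s2_3 : Num.sqrt 2%:R * Num.sqrt 3%:R = Num.sqrt 6%:R :> R.
Proof. by rewrite -sqrtrM ?ler0n // -natrM. Qed.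

Ltac eval_int :=
  repeat match goal with
  | |- context [zbr ?d ?i ?j ?k] =>
      let v := eval vm_compute in (zbr d i j k) in change (zbr d i j k) with v
  | |- context [zder ?d ?i ?k] =>
      let v := eval vm_compute in (zder d i k) in change (zder d i k) with v
  end.

Ltac entry := rewrite /wedge2 /ot /diag ?mxE /= ?mxE /= ?mxE /=; eval_int;
  rewrite ?zr_pos ?zr_neg ?zr_0 ?sqrtr1;
  first [by rewrite ?mulr1n ?mulr0n ?subrr ?addr0 ?mulr0 ?oppr0 ?mul0r
    | by rewrite ?mulr1n ?mulr0n /Pos.to_nat /=; lra].

Ltac ord_cases x := let h := fresh in
  destruct x as [[|[|[|[|x]]]] h]; try by [].

Ltac check_line := split=> //;
  [let i := fresh in let j := fresh in let k := fresh in intros i j k;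
     ord_cases k; ord_cases i; ord_cases j; entry
  |let i := fresh in let k := fresh in intros i k; ord_cases i; ord_cases k; entry].

Let line0P : line_data_of (nth_line 0) (nth_data 0). Proof. check_line. Qed.
Let line1P : line_data_of (nth_line 1) (nth_data 1). Proof. check_line. Qed.
Let line2P : line_data_of (nth_line 2) (nth_data 2).
Proof. have := s66_3; have := s22_34. check_line. Qed.
Let line3P : line_data_of (nth_line 3) (nth_data 3). Proof. check_line. Qed.
Let line4P : line_data_of (nth_line 4) (nth_data 4).
Proof. have := s2_3. check_line. Qed.
Let line5P : line_data_of (nth_line 5) (nth_data 5). Proof. check_line. Qed.
Let line6P : line_data_of (nth_line 6) (nth_data 6).
Proof. have := s2_3. check_line. Qed.
Let line7P : line_data_of (nth_line 7) (nth_data 7). Proof. check_line. Qed.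
Let line8P : line_data_of (nth_line 8) (nth_data 8). Proof. check_line. Qed.

Definition bvector p q (v : Z) : seq (nat * nat * Z) := [:: (p, q, v)].
Local Notation b p q := (bvector p q (Zpos xH)).

Definition certified (L : table_line R) (s : seq nat) := exists d w,
  line_data_of L d /\ entry_cert d s w.

Lemma table_certified (L : table_line R) (s : seq nat) :
  List.In L (table R) -> s \in tsigns L -> certified L s.
Proof.
case=> [<-|[<-|[<-|[<-|[<-|[<-|[<-|[<-|[<-|[]]]]]]]]]].
- rewrite !inE => /orP[] /eqP ->.
    (* Both bivectors lie in one eigenspace of the Hodge star, which the curvature operator of an
       Einstein metric preserves in dimension four. The star depends on the signature, hence the
       opposite signs for the other metric of this line. *)
    exists (nth_data 0), [:: (0, 1, Zpos xH) :: b 2 3; (0, 2, Zpos xH) :: b 1 3].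
    by split; [exact: line0P|vm_compute].
  exists (nth_data 0), [:: (0, 1, Zpos xH) :: bvector 2 3 (Zneg xH);
                           (0, 2, Zpos xH) :: bvector 1 3 (Zneg xH)].
  by split; [exact: line0P|vm_compute].
- move=> hs; exists (nth_data 1), [:: b 0 1; b 0 2]; split; first exact: line1P.
  by move: hs; rewrite !inE => /or4P[] /eqP ->; vm_compute.
- move=> hs; exists (nth_data 2), [:: b 0 3; b 1 2; b 1 4; b 2 4].
  split; first exact: line2P.
  by move: hs; rewrite !inE => /orP[] /eqP ->; vm_compute.
- move=> hs; exists (nth_data 3), [:: b 1 3; b 2 3]; split; first exact: line3P.
  by move: hs; rewrite !inE => /or4P[] /eqP ->; vm_compute.
- move=> hs; exists (nth_data 4), [:: b 0 1; b 2 3]; split; first exact: line4P.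
  by move: hs; rewrite !inE => /or3P[] /eqP ->; vm_compute.
- move=> hs; exists (nth_data 5), [:: b 0 2; b 3 4; b 1 4].
  split; first exact: line5P.
  by move: hs; rewrite !inE => /or4P[] /eqP ->; vm_compute.
- move=> hs; exists (nth_data 6), [:: b 0 3; b 1 2]; split; first exact: line6P.
  by move: hs; rewrite !inE => /orP[] /eqP ->; vm_compute.
- move=> hs; exists (nth_data 7), [:: b 0 1; b 0 2]; split; first exact: line7P.
  by move: hs; rewrite !inE => /or4P[|||/or3P[]] /eqP ->; vm_compute.
- move=> hs; exists (nth_data 8), [:: b 0 1; b 0 3]; split; first exact: line8P.
  by move: hs; rewrite !inE => /or3P[] /eqP ->; vm_compute.
Qed.

(** Pair symmetry is left as a condition on the entry; an isometry with an extension supplies it. *)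
Lemma table_not_cartan (L : table_line R) (s : seq nat)
    (E := semidirect (entry_algebra L s) (tder L) 1) :
  List.In L (table R) -> s \in tsigns L ->
  [/\ metric_alg E, exists y, ricci E y y != 0 &
      forall phi sg, pair_symmetric E -> ~ cartan_involution E phi sg].
Proof.
move=> hL hs; have [d [w [hd cert]]] := table_certified hL hs.
have [dn _ _ _] := hd; rewrite /entry_cert dn in cert.
have okE := entry_metric hd cert; have iso := entry_iso hd cert.
have okF := certificate_metric R cert.
split=> // [|phi sg sE ci].
  have [y ry] := certificate_ricci R cert.
  by eexists; rewrite -(curv_iso_ricci y y okE okF iso) in ry; exact: ry.
have iso' := curv_iso_sym iso.
apply: (certificate_sound cert (pair_curv_iso iso' sE)).
exact: (cartan_curv_iso iso' ci).
Qed.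

End Table.

Theorem proposition3p4 (R : realType)
    (L : table_line R) (hL : List.In L (table R))
    (s : seq nat) (hs : s \in tsigns L)
    (m : nat) (h : metric_algebra R m) (D : 'M[R]_m) (c : R)
    (hext : pseudo_iwasawa_einstein_extension h D c)
    (hnice : has_nice_orthonormal_basis h) :
  ~ isometric_solvmanifolds (semidirect (entry_algebra L s) (tder L) 1)
                            (semidirect h D c).
Proof.
move=> isom; have [okA [y ry] no_cartan] := table_not_cartan hL hs.
have [okB pairB] := pseudo_iwasawa_metric hext.
have [a [b iso]] := isometric_curv_iso okA okB isom.
(* The root argument requires nilradicals of dimension at most 4; the bound passes from the entry to
   [h] because the tangent spaces have equal dimension. *)
have m4 := table_dim hL; have := curv_iso_dim iso.
rewrite !add1n => -[mE]; rewrite -mE in m4.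
have [B [nice onb]] := hnice.
have [phi [sg ci]] : exists phi sg, cartan_involution (semidirect h D c) phi sg.
  apply: (pseudo_iwasawa_cartan hext nice onb m4).
  (* A vector with nonzero Ricci curvature on the entry, moved to the extension. *)
  exists (y *m b); have [_ ba _ _] := iso.
  by rewrite -(curv_iso_ricci _ _ okA okB iso) -!mulmxA ba !mulmx1.
exact: (no_cartan _ _ (pair_curv_iso iso pairB) (cartan_curv_iso iso ci)).
Qed.
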